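(* Let $r\ge 2$ be an integer and $\boldsymbol d^\vee=(1,\ldots,1,2)\in\mathbb{Z}^r$ (so $d_1=\dots=d_{r-1}=1$, $d_r=2$). Let $A^\vee=(A^\vee_{ij})$ be the $r\times r$ matrix with $$A^\vee_{11}=1,\quad A^\vee_{1r}=\tfrac12,\quad A^\vee_{r1}=1,\quad A^\vee_{1j}=A^\vee_{j1}=0\ (2\le j\le r-1),$$ $$A^\vee_{ij}=2(\min(i,j)-1)\ (2\le i\le r,\ 2\le j\le r-1),\qquad A^\vee_{ir}=i-1\ (2\le i\le r).$$ Let $\boldsymbol b_0=(1,1,2,3,\ldots,r-1)^T$ (first entry $1$, $i$-th entry $i-1$ for $2\le i\le r$) and $c_0=\frac{8r^2-14r+5}{32r-8}$, and for $1\le j\le r$ let $$\boldsymbol b_j=(0,\ldots,0,1,2,\ldots,r-j)^T\in\mathbb{Q}^r,\qquad c_j=\frac{8(r-j)^2+4j-6r+1}{32r-8},$$ i.e. the $i$-th entry of $\boldsymbol b_j$ is $\max(i-j,0)$ for $1\le i\le r$. Then for every $0\le j\le r$ the generalized Nahm sum $\widetilde f_{A^\vee,\boldsymbol b_j,c_j,\boldsymbol d^\vee}(q^{32r-8})$, as a function of $\tau\in\mathbb{H}$ with $q=e^{2\pi i\tau}$, is a modular function for $\Gamma_1(128(4r-1)^2)$.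
   Context: Notation: $(a;q)_\infty=\prod_{n\ge0}(1-aq^n)$, $(a;q)_n=(a;q)_\infty/(aq^n;q)_\infty$; $\mathbb{N}=\{0,1,2,\dots\}$; $\mathbb{H}$ is the upper half-plane; $q=e^{2\pi i\tau}$, and for rational $x$, $q^x$ means $e^{2\pi i x\tau}$. For $\boldsymbol d=(d_1,\ldots,d_r)\in\mathbb{Z}_{>0}^r$, $D=\mathrm{diag}(d_1,\ldots,d_r)$, a matrix $A\in\mathbb{Q}^{r\times r}$ such that $AD$ is symmetric positive definite, $\boldsymbol b\in\mathbb{Q}^r$ and $c\in\mathbb{Q}$, the (generalized) Nahm sum for the symmetrizable matrix $A$ of index $\boldsymbol d$ is $$\widetilde f_{A,\boldsymbol b,c,\boldsymbol d}(q)=\sum_{\boldsymbol n=(n_1,\ldots,n_r)^T\in\mathbb{N}^r}\frac{q^{\frac12\boldsymbol n^TAD\boldsymbol n+\boldsymbol n^T\boldsymbol b+c}}{(q^{d_1};q^{d_1})_{n_1}\cdots(q^{d_r};q^{d_r})_{n_r}}.$$ $\Gamma_1(N)$ is the group of integer matrices $\begin{pmatrix}a&b\\c&d\end{pmatrix}$ of determinant $1$ with $c\equiv0$, $a\equiv d\equiv1\pmod N$. A modular function for $\Gamma_1(N)$ is a meromorphic function $f:\mathbb{H}\to\mathbb{C}$ such that (1) $f(\gamma\tau)=f(\tau)$ for all $\gamma\in\Gamma_1(N)$; (2) for every $\gamma\in SL_2(\mathbb{Z})$, $f(\gamma\tau)$ has an expansion $\sum_{n\ge n_\gamma}a(n)e^{2\pi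 i n\tau/w_\gamma}$ with $n_\gamma\in\mathbb{Z}$, where $w_\gamma$ is the least positive integer $h$ with $\begin{pmatrix}1&h\\0&1\end{pmatrix}\in\gamma^{-1}\Gamma_1(N)\gamma$. *)

(* Defs.v *)
From HB Require Import structures.
From mathcomp Require Import all_boot all_order all_algebra finmap.
From mathcomp.real_closed Require Import complex.
From mathcomp Require Import all_classical all_reals all_analysis summability.

Set Implicit Arguments.
Unset Strict Implicit.
Unset Printing Implicit Defensive.

Import Order.TTheory GRing.Theory Num.Theory.
Import numFieldNormedType.Exports.

Local Open Scope classical_set_scope.
Local Open Scope ring_scope.
Local Open Scope complex_scope.

(* The normed-module structure over R[i], hence limits and complex
   derivatives, is carried by the alias R[i]^o of R[i]. *)

Definition cexp (R : realType) (z : R[i]) : R[i] :=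
  (expR (complex.Re z))%:C * (cos (complex.Im z) +i* sin (complex.Im z)).

(* q ^ x for q = e^(2 pi i tau) *)
Definition qpow (R : realType) (tau : R[i]) (x : rat) : R[i] :=
  cexp ((2 * pi)%:C * 'i * ratr x * tau).

Definition qpoch_inf (R : realType) (a q : R[i]) : R[i] :=
  limn (fun n => \prod_(0 <= k < n) (1 - a * q ^+ k) : R[i]^o).

Definition qpoch (R : realType) (a q : R[i]) (n : nat) : R[i] :=
  qpoch_inf a q / qpoch_inf (a * q ^+ n) q.

Definition nahm_exponent (r : nat) (d : 'I_r -> nat) (A : 'M[rat]_r)
    (b : 'cV[rat]_r) (c : rat) (n : 'cV[nat]_r) : rat :=
  let D : 'M[rat]_r := diag_mx (\row_i (d i)%:R) in
  let v : 'cV[rat]_r := map_mx (fun k : nat => k%:R) n in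
  2^-1 * (v^T *m A *m D *m v) 0 0 + (v^T *m b) 0 0 + c.

Definition nahm_term (R : realType) (r : nat) (d : 'I_r -> nat)
    (A : 'M[rat]_r) (b : 'cV[rat]_r) (c : rat) (tau : R[i])
    (n : 'cV[nat]_r) : R[i] :=
  qpow tau (nahm_exponent d A b c n) /
  \prod_(i < r) qpoch (qpow tau (d i)%:R) (qpow tau (d i)%:R) (n i 0).

(* Unordered sum over N^r: the limit of the finite partial sums along the
   directed set of finite subsets of N^r. *)
Definition nahm_sum (R : realType) (r : nat) (d : 'I_r -> nat)
    (A : 'M[rat]_r) (b : 'cV[rat]_r) (c : rat) (tau : R[i]) : R[i] :=
  @summability.sum _ _ R[i]^o (fun n => nahm_term d A b c tau n : R[i]^o).

Definition upper_half_plane (R : realType) : set R[i] :=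
  [set z | 0 < complex.Im z].

Definition holomorphic_at (R : realType) (f : R[i] -> R[i]) (z : R[i]) : Prop :=
  \forall w \near (z : R[i]^o), derivable (f : R[i]^o -> R[i]^o) w 1.

Definition pole_at (R : realType) (f : R[i] -> R[i]) (z : R[i]) : Prop :=
  (\forall w \near (z : R[i]^o)^', derivable (f : R[i]^o -> R[i]^o) w 1) /\
  (`|f w| : R[i]^o) @[w --> (z : R[i]^o)^'] --> +oo.

(* A meromorphic function is a total function whose values at its poles are
   arbitrary; removable singularities are not allowed. *)
Definition meromorphic_on (R : realType) (U : set R[i]) (f : R[i] -> R[i]) :
  Prop := forall z, U z -> holomorphic_at f z \/ pole_at f z.

Definition SL2Z : set 'M[int]_2 := [set g | \det g = 1].

Definition Gamma1 (N : nat) : set 'M[int]_2 :=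
  [set g | [/\ \det g = 1, (N %| g 1%R 0%R)%Z,
      (g 0%R 0%R = 1 %[mod N])%Z & (g 1%R 1%R = 1 %[mod N])%Z]].

Definition mobius (R : realType) (g : 'M[int]_2) (tau : R[i]) : R[i] :=
  ((g 0 0)%:~R * tau + (g 0 1)%:~R) / ((g 1 0)%:~R * tau + (g 1 1)%:~R).

Definition translation (h : nat) : 'M[int]_2 := 1%:M + h%:Z *: delta_mx 0 1.

Definition cusp_translation (N : nat) (g : 'M[int]_2) (h : nat) : Prop :=
  exists2 gamma, Gamma1 N gamma & translation h = invmx g *m gamma *m g.

Definition is_cusp_width (N : nat) (g : 'M[int]_2) (w : nat) : Prop :=
  [/\ (0 < w)%N, cusp_translation N g w &
      forall h : nat, (0 < h)%N -> cusp_translation N g h -> (w <= h)%N].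

(* The expansion is one near i*oo: a meromorphic f may have poles, and a
   Laurent expansion in e^(2 pi i tau / w) represents it only above them. *)
Definition has_q_expansion (R : realType) (w : nat) (f : R[i] -> R[i]) : Prop :=
  exists (n0 : int) (a : int -> R[i]) (Y : R), forall tau : R[i],
    upper_half_plane tau -> Y < complex.Im tau ->
    series (fun k : nat =>
        a (n0 + k%:Z) * qpow tau ((n0 + k%:Z)%:~R / w%:R) : R[i]^o) @ \oo
      --> (f tau : R[i]^o).

Definition modular_function (R : realType) (N : nat) (f : R[i] -> R[i]) :
    Prop :=
  [/\ meromorphic_on (@upper_half_plane R) f,
      forall g, Gamma1 N g -> forall tau, upper_half_plane tau ->
        f (mobius g tau) = f tau
    & forall g, SL2Z g -> exists2 w, is_cusp_width N g w &
        has_q_expansion w (fun tau => f (mobius g tau))].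

(* The indices i and j of A_dual and b_vec are 1-based: k : 'I_r is index k.+1 *)

Definition d_dual (r : nat) (i : 'I_r) : nat :=
  if i.+1 == r then 2%N else 1%N.

Definition A_dual_entry (r i j : nat) : rat :=
  if i == 1%N then
    if j == 1%N then 1 else if j == r then 2^-1 else 0
  else if j == 1%N then
    if i == r then 1 else 0
  else if j == r then (i - 1)%N%:R
  else (2 * (minn i j - 1))%N%:R.

Definition A_dual (r : nat) : 'M[rat]_r :=
  \matrix_(i, j) A_dual_entry r i.+1 j.+1.

Definition b_vec (r j : nat) : 'cV[rat]_r :=
  \col_i (if j == 0%N then (if i.+1 == 1%N then 1 else (i.+1 - 1)%N%:R)
          else (i.+1 - j)%N%:R).

Definition c_val (r j : nat) : rat :=
  if j == 0%N then
    (8 * r%:R ^+ 2 - 14 * r%:R + 5) / (32 * r%:R - 8)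
  else
    (8 * (r%:R - j%:R) ^+ 2 + 4 * j%:R - 6 * r%:R + 1) / (32 * r%:R - 8).

(* Main.v *)
(* With p = e(4 M tau), Q = p^2 and M = 4r - 1, a Bailey chain started from an
   explicit pair with summand (-1)^m p^((3 m^2 +- m)/2), together with a finite
   q-binomial theorem for the variable n_1, evaluates truncations of the Nahm
   sum; as the truncation level grows they give (-p;Q)_oo / (Q;Q)_oo times a
   theta series in p. The triple product turns this into a quotient of Siegel
   functions g_(a,0). Siegel functions transform under SL_2(Z) up to a root of
   unity: the inversion tau -> -1/tau is read off from partial products of the
   lattice product over square boxes, which are swapped by it, and whose defect
   with respect to Eisenstein summation is a factor exp(c w^2). Expansions at
   the cusps come from the product formula by formal inversion of power
   series. *)
From HB Require Import structures.
Require Import Defs.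
From mathcomp Require Import all_boot all_order all_algebra finmap.
From mathcomp.real_closed Require Import complex.
From mathcomp Require Import all_classical all_reals all_analysis summability.
From mathcomp Require Import ring lra zify.

Set Implicit Arguments.
Unset Strict Implicit.
Unset Printing Implicit Defensive.

Import Order.TTheory GRing.Theory Num.Theory.
Import numFieldNormedType.Exports.

Local Open Scope classical_set_scope.
Local Open Scope ring_scope.

(** The inversion of theta uses neither Poisson summation nor the transformation of eta. The
    exponent of the defect is first only known to be bounded; its limit is forced by comparing the
    quasi-periods of the two theta functions at two real points that differ by 1. The factor
    depending on t alone is left open there and found later from torsion values. With n = 2 r - 1
    and M = 2 n + 1, the product (p;p)_oo splits modulo M into n pairs of residues and one factor
    with residue 0. The theta series cancels this factor and one pair, so n - 1 Siegel functions
    remain in the denominator, an even number, and their signs disappear. The rational number c_j is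
    what absorbs the leading exponents. The level is 128 M^2 = (32 M)(4 M) = (4 M^2)(32): after
    rescaling t by 32 M or by 4 M^2 the off-diagonal entries of a matrix of the group are still
    divisible by 4, so that only the part modulo 3 of the multiplier has to cancel between numerator
    and denominator. Exchanges of limits with sums and products all rest on one dominated
    convergence theorem for finite sets. *)

(* An interface for the field R[i] over R: working over an abstract carrier
   keeps unification from unfolding the arithmetic of pairs. *)
Structure cplxField (R : realType) := CplxField {
  cplx_sort :> numFieldType;
  ofR : {rmorphism R -> cplx_sort};
  imu : cplx_sort;
  re : cplx_sort -> R;
  im : cplx_sort -> R;
  imu_sq : imu * imu = -1;
  reimE : forall z, z = ofR (re z) + imu * ofR (im z);
  re_mk : forall a b, re (ofR a + imu * ofR b) = a;
  im_mk : forall a b, im (ofR a + imu * ofR b) = b;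
  norm_reim : forall z, `|z| = ofR (Num.sqrt (re z ^+ 2 + im z ^+ 2));
  ofR_gt0 : forall x, (0 < ofR x) = (0 < x) }.

Arguments ofR {R _}.
Arguments imu {R _}.
Arguments re {R _}.
Arguments im {R _}.

(** * Convergence in the complex field *)

Section Modulus.
Variables (R : realType) (K : cplxField R).
Implicit Types (z w : K) (x y : R).

Lemma ofR_ge0 x : (0 <= (ofR x : K)) = (0 <= x).
Proof. by rewrite !le_eqVlt ofR_gt0 ![0 == _]eq_sym fmorph_eq0. Qed.

Lemma ofR_le x y : ((ofR x : K) <= ofR y) = (x <= y).
Proof. by rewrite -subr_ge0 -rmorphB ofR_ge0 subr_ge0. Qed.

Lemma ofR_lt x y : ((ofR x : K) < ofR y) = (x < y).
Proof. by rewrite -subr_gt0 -rmorphB ofR_gt0 subr_gt0. Qed.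

Lemma ofR_inj : injective (ofR : R -> K).
Proof. exact: fmorph_inj. Qed.

Definition nm z : R := Num.sqrt (re z ^+ 2 + im z ^+ 2).

Lemma normE z : `|z| = ofR (nm z). Proof. exact: norm_reim. Qed.

Lemma nm_ge0 z : 0 <= nm z. Proof. exact: sqrtr_ge0. Qed.

Lemma nmM z w : nm (z * w) = nm z * nm w.
Proof. by apply: ofR_inj; rewrite rmorphM -!normE normrM. Qed.

Lemma nmD z w : nm (z + w) <= nm z + nm w.
Proof. by rewrite -ofR_le rmorphD -!normE ler_normD. Qed.

Lemma nmN z : nm (- z) = nm z.
Proof. by apply: ofR_inj; rewrite -!normE normrN. Qed.

Lemma nmB z w : nm (z - w) <= nm z + nm w.
Proof. by rewrite -[nm w]nmN nmD. Qed.

Lemma nmBC z w : nm (z - w) = nm (w - z).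
Proof. by rewrite -nmN opprB. Qed.

Lemma nmV z : nm z^-1 = (nm z)^-1.
Proof. by apply: ofR_inj; rewrite fmorphV -!normE normfV. Qed.

Lemma nmX z n : nm (z ^+ n) = nm z ^+ n.
Proof. by apply: ofR_inj; rewrite rmorphXn -!normE normrX. Qed.

Lemma nm0 : nm 0 = 0.
Proof. by apply: ofR_inj; rewrite -normE normr0 rmorph0. Qed.

Lemma nm1 : nm 1 = 1.
Proof. by apply: ofR_inj; rewrite -normE normr1 rmorph1. Qed.

Lemma nm_eq0 z : (nm z == 0) = (z == 0).
Proof. by rewrite -(inj_eq ofR_inj) -normE rmorph0 normr_eq0. Qed.

Lemma nm_gt0 z : (0 < nm z) = (z != 0).
Proof. by rewrite lt_neqAle nm_ge0 andbT eq_sym nm_eq0. Qed.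

Lemma nm_ofR x : nm (ofR x) = `|x|.
Proof.
have h : forall x : R, 0 <= x -> nm (ofR x) = x.
  by move=> t t0; apply: ofR_inj; rewrite -normE ger0_norm // ofR_ge0.
case: (ger0P x) => [/h//|x0].
by rewrite -nmN -rmorphN h // oppr_ge0 ltW.
Qed.

Lemma nm_nat n : nm n%:R = n%:R.
Proof. by rewrite -(rmorph_nat ofR) nm_ofR ger0_norm. Qed.

Lemma nm_sum (I : Type) (s : seq I) (P : pred I) (f : I -> K) :
  nm (\sum_(i <- s | P i) f i) <= \sum_(i <- s | P i) nm (f i).
Proof.
elim/big_ind2: _ => [|x1 y1 x2 y2 h1 h2|//]; first by rewrite nm0.
exact: le_trans (nmD _ _) (lerD h1 h2).
Qed.

Lemma nm_prod (I : Type) (s : seq I) (P : pred I) (f : I -> K) :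
  nm (\prod_(i <- s | P i) f i) = \prod_(i <- s | P i) nm (f i).
Proof. exact: (big_morph nm nmM nm1). Qed.

Lemma nm_sqr z : nm z ^+ 2 = re z ^+ 2 + im z ^+ 2.
Proof. by rewrite sqr_sqrtr // addr_ge0 ?sqr_ge0. Qed.

Lemma nm_imu : nm imu = 1.
Proof.
by apply/eqP; rewrite -sqrp_eq1 ?nm_ge0 // expr2 -nmM imu_sq nmN nm1.
Qed.

Lemma reim_eq z w : re z = re w -> im z = im w -> z = w.
Proof. by move=> h1 h2; rewrite [z]reimE h1 h2 -reimE. Qed.

Lemma re_ofR x : re (ofR x : K) = x.
Proof. by rewrite -[ofR x]addr0 -(mulr0 imu) -(rmorph0 ofR) re_mk. Qed.

Lemma im_ofR x : im (ofR x : K) = 0.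
Proof. by rewrite -[ofR x]addr0 -(mulr0 imu) -(rmorph0 ofR) im_mk. Qed.

Lemma reD z w : re (z + w) = re z + re w.
Proof.
rewrite {1}[z]reimE {1}[w]reimE addrACA -rmorphD -mulrDr -rmorphD; exact: re_mk.
Qed.

Lemma imD z w : im (z + w) = im z + im w.
Proof.
rewrite {1}[z]reimE {1}[w]reimE addrACA -rmorphD -mulrDr -rmorphD; exact: im_mk.
Qed.

Lemma mulE z w :
  z * w = ofR (re z * re w - im z * im w) + imu * ofR (re z * im w + im z * re w).
Proof.
rewrite {1}[z]reimE {1}[w]reimE rmorphB rmorphD !rmorphM.
set a := ofR (re z); set b := ofR (im z); set c := ofR (re w); set d := ofR (im w).
have := imu_sq K; set i := imu => h.
transitivity (a * c + (i * i) * (b * d) + i * (a * d + b * c)); first by ring.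
by rewrite h; ring.
Qed.

Lemma reM z w : re (z * w) = re z * re w - im z * im w.
Proof. by rewrite mulE re_mk. Qed.

Lemma imM z w : im (z * w) = re z * im w + im z * re w.
Proof. by rewrite mulE im_mk. Qed.

Lemma reN z : re (- z) = - re z.
Proof. by apply/eqP; rewrite -addr_eq0 -reD addNr -(rmorph0 ofR) re_ofR. Qed.

Lemma imN z : im (- z) = - im z.
Proof. by apply/eqP; rewrite -addr_eq0 -imD addNr -(rmorph0 ofR) im_ofR. Qed.

Lemma re_le_nm z : `|re z| <= nm z.
Proof.
by rewrite -sqrtr_sqr ler_wsqrtr // lerDl sqr_ge0.
Qed.

Lemma im_le_nm z : `|im z| <= nm z.
Proof.
by rewrite -sqrtr_sqr ler_wsqrtr // lerDr sqr_ge0.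
Qed.

Lemma re_imu : re (imu : K) = 0.
Proof. by rewrite -[imu]add0r -[imu]mulr1 -(rmorph0 ofR) -(rmorph1 ofR) re_mk. Qed.

Lemma im_imu : im (imu : K) = 1.
Proof. by rewrite -[imu]add0r -[imu]mulr1 -(rmorph0 ofR) -(rmorph1 ofR) im_mk. Qed.

Lemma nm_le_reim z : nm z <= `|re z| + `|im z|.
Proof.
rewrite {1}[z]reimE; apply: le_trans (nmD _ _) _.
by rewrite nmM !nm_ofR nm_imu mul1r.
Qed.

End Modulus.

Section Convergence.
Variables (R : realType) (K : cplxField R).

Lemma cvgnmP (T : Type) (F : set_system T) {FF : Filter F} (f : T -> K) (l : K) :
  f @ F --> l <-> forall e : R, 0 < e -> \forall x \near F, nm (f x - l) < e.
Proof.
split.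
- move/cvgrPdist_lt => h e e0; have := h (ofR e); rewrite ofR_gt0 => /(_ e0).
  by apply: filterS => x; rewrite normE ofR_lt nmBC.
- move=> h; apply/cvgrPdist_lt => e e0.
  have ee : e = ofR (nm e) by rewrite -normE gtr0_norm.
  have e1 : 0 < nm e by rewrite -(ofR_gt0 K) -ee.
  by move: (h _ e1); apply: filterS => x hx; rewrite normE nmBC ee ofR_lt.
Qed.

Lemma cvg_nm0 (T : Type) (F : set_system T) {FF : Filter F} (f : T -> K) (l : K) :
  f @ F --> l <-> (fun x => nm (f x - l)) @ F --> (0 : R).
Proof.
rewrite cvgnmP cvgrPdist_lt; split=> h e e0; have := h e e0;
  by apply: filterS => x; rewrite sub0r normrN ger0_norm ?nm_ge0.
Qed.

Lemma cvg_nm_le (T : Type) (F : set_system T) {FF : Filter F} (f : T -> K) (l : K)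
  (b : T -> R) : (\forall x \near F, nm (f x - l) <= b x) -> b @ F --> (0 : R) ->
  f @ F --> l.
Proof.
move=> h /cvgrPdist_lt hb; apply/cvgnmP => e e0.
near=> x; apply: le_lt_trans (_ : b x < e); first by near: x.
apply: le_lt_trans (ler_norm _) _; rewrite -normrN -sub0r.
by near: x; apply: hb.
Unshelve. all: by end_near. Qed.

Lemma cvg_nm (T : Type) (F : set_system T) {FF : Filter F} (f : T -> K) (l : K) :
  f @ F --> l -> (fun x => nm (f x)) @ F --> nm l.
Proof.
move/cvgnmP => h; apply/cvgrPdist_lt => e /h; apply: filterS => x.
apply: le_lt_trans; rewrite ler_norml; apply/andP; split.
  by rewrite lerBrDl lerBlDr addrC -{1}[f x](subrK l) nmD.
by rewrite lerBlDr -{1}[l](subrK (f x)) nmBC nmD.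
Qed.

Lemma cvg_ofR (T : Type) (F : set_system T) {FF : Filter F} (f : T -> R) (l : R) :
  f @ F --> l -> (fun x => ofR (f x) : K) @ F --> (ofR l : K).
Proof.
move/cvgrPdist_lt => h; apply/cvgnmP => e /h; apply: filterS => x.
by rewrite -rmorphB nm_ofR distrC.
Qed.

Lemma cvgC_unique (T : Type) (F : set_system T) {FF : ProperFilter F}
  (f : T -> K) (a b : K) : f @ F --> a -> f @ F --> b -> a = b.
Proof. by move=> h1 h2; apply: (@cvg_unique _ (@norm_hausdorff _ _) _ _ _ _ h1 h2). Qed.

(** Completeness is not a field of [cplxField]; it is inherited from R, since both coordinates are
    bounded by the modulus. *)
Lemma cauchy_cvgC (u : nat -> K) :
  (forall e : R, 0 < e -> exists N, forall m n, (N <= m)%N -> (N <= n)%N ->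
     nm (u m - u n) < e) -> exists l : K, u @ \oo --> l.
Proof.
move=> hu.
have aux (v : nat -> R) : (forall m n, `|v m - v n| <= nm (u m - u n)) ->
    exists l : R, v @ \oo --> l.
  move=> hv; suff: cvgn v by move=> h; exists (limn v).
  apply/cauchy_cvgP; apply/cauchy_ballP => e e0.
  have [N hN] := hu e e0.
  exists (v @` [set n | (N <= n)%N], v @` [set n | (N <= n)%N]) => /=.
    by split; exists N => // n hn; exists n.
  move=> [_ _] /= [[m hm <-] [n hn <-]]; rewrite -ball_normE /=.
  exact: le_lt_trans (hv _ _) (hN _ _ hm hn).
have [a ha] : exists l : R, (re \o u) @ \oo --> l.
  by apply: aux => m n /=; rewrite -reN -reD re_le_nm.
have [b hb] : exists l : R, (im \o u) @ \oo --> l.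
  by apply: aux => m n /=; rewrite -imN -imD im_le_nm.
exists (ofR a + imu * ofR b).
have -> : u = fun n => ofR (re (u n)) + imu * ofR (im (u n)).
  by apply/funext => n; rewrite -reimE.
apply: cvgD; first exact: cvg_ofR ha.
apply: cvgM; [exact: cvg_cst|exact: cvg_ofR hb].
Qed.

End Convergence.

(** * Dominated convergence for unordered sums *)

Section UnorderedSums.
Variables (R : realType) (K : cplxField R) (T : choiceType).
Local Open Scope fset_scope.
Local Open Scope ring_scope.

Lemma sum_fsetID (V : zmodType) (h : T -> V) (J L : {fset T}) :
  \sum_(x <- J) h x = \sum_(x <- J `&` L) h x + \sum_(x <- J `\` L) h x.
Proof.
rewrite (big_fsetID _ (mem L)); congr (_ + _); apply: eq_fbig => // x.
  by rewrite !inE.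
by rewrite !inE andbC.
Qed.

Lemma sum_fset_sub (V : zmodType) (h : T -> V) (J L : {fset T}) :
  \sum_(x <- J) h x - \sum_(x <- L) h x
  = \sum_(x <- J `\` L) h x - \sum_(x <- L `\` J) h x.
Proof.
rewrite (sum_fsetID h J L) (sum_fsetID h L J) fsetIC opprD addrACA subrr add0r.
by [].
Qed.

Variables (F : T -> R) (B : R).
Hypothesis F_le : forall J : {fset T}, \sum_(x <- J) F x <= B.

(** A finite set whose sum is within e of the supremum of all finite sums leaves less than e outside
    it. *)
Lemma small_tail (e : R) : 0 < e ->
  exists L : {fset T}, forall J : {fset T}, \sum_(x <- J `\` L) F x < e.
Proof.
move=> e0.
pose E := [set y | exists J : {fset T}, y = \sum_(x <- J) F x]%classic.
have hE : has_sup E.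
  by split; [exists (\sum_(x <- fset0) F x), fset0|exists B => _ [J ->]].
have [_ [L ->] hL] := sup_adherent e0 hE.
exists L => J.
have hU : \sum_(x <- J `|` L) F x <= sup E by apply: sup_upper_bound => //; exists (J `|` L).
move: hU; rewrite (sum_fsetID F (J `|` L) L).
have -> : (J `|` L) `&` L = L by apply/fsetP => x; rewrite !inE; case: (x \in L); rewrite ?orbT ?andbF.
have -> : (J `|` L) `\` L = J `\` L by apply/fsetP => x; rewrite !inE; case: (x \in L); rewrite ?orbF.
by move: hL; lra.
Qed.

Variables (f : nat -> T -> K) (g : T -> K).
Hypothesis f_le : forall n x, nm (f n x) <= F x.
Hypothesis fg : forall x, (fun n => f n x) @ \oo --> g x.

Lemma dominated_limit x : nm (g x) <= F x.
Proof. have h : (fun n => nm (f n x)) @ \oo --> nm (g x) by apply: cvg_nm; exact: fg.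
by apply: cvgr_to_le h _; apply: nearW => n; exact: f_le. Qed.

Lemma nm_sum_dominated (h : T -> K) (J L : {fset T}) (e : R) :
  (forall x, nm (h x) <= F x) -> (\sum_(x <- J `\` L) F x < e) ->
  nm (\sum_(x <- J `\` L) h x) < e.
Proof.
move=> hF; apply: le_lt_trans; apply: le_trans (nm_sum _ _ _) _.
by apply: ler_sum.
Qed.

(** Tannery's theorem. Outside a finite set both families contribute less than e by domination, and
    on it the convergence is termwise. The sets [J n] need only contain the support of [f n], which
    is the form in which the truncated Nahm sums arise. *)
Theorem dominated_sum : exists S : K,
  (forall e : R, 0 < e -> exists J0 : {fset T}, forall J : {fset T},
     J0 `<=` J -> nm (\sum_(x <- J) g x - S) < e) /\
  (forall J : nat -> {fset T}, (forall n x, x \notin J n -> f n x = 0) ->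
     (fun n => \sum_(x <- J n) f n x) @ \oo --> S).
Proof.
have h k : exists L : {fset T}, forall J : {fset T},
    \sum_(x <- J `\` L) F x < k.+1%:R^-1.
  by apply: small_tail; rewrite invr_gt0 ltr0n.
have [L hL] := choice h.
pose s k := \sum_(x <- L k) g x.
have gF := dominated_limit.
(* Two of these sums differ only by terms outside one of the sets [L m], [L n], so they form a
   Cauchy sequence. *)
have [S hS] : exists S : K, s @ \oo --> S.
  apply: cauchy_cvgC => e e0.
  have e2 : 0 < e / 2 by lra.
  have [N _ hN] := near_infty_natSinv_lt (PosNum e2).
  exists N => m n hm hn; rewrite /s sum_fset_sub.
  apply: le_lt_trans (nmB _ _) _; rewrite [e]splitr; apply: ltrD.
    by apply: nm_sum_dominated => //; apply: lt_trans (hL _ _) (hN _ hn).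
  by apply: nm_sum_dominated => //; apply: lt_trans (hL _ _) (hN _ hm).
have hS2 (e : R) : 0 < e -> exists J0 : {fset T},
    (forall J, \sum_(x <- J `\` J0) F x < e) /\
    nm (\sum_(x <- J0) g x - S) < e.
  move=> e0.
  have [N _ hN] := near_infty_natSinv_lt (PosNum e0).
  have /cvgnmP /(_ e e0) [N' _ hN'] := hS.
  exists (L (maxn N N')); split=> [J|].
    by apply: lt_trans (hL _ _) (hN _ _); rewrite /= leq_maxl.
  by apply: hN'; rewrite /= leq_maxr.
exists S; split=> [e e0|J hJ].
  have e2 : 0 < e / 2 by lra.
  have [J0 [h1 h2]] := hS2 _ e2.
  exists J0 => J hJ.
  have -> : \sum_(x <- J) g x - S
      = \sum_(x <- J `\` J0) g x + (\sum_(x <- J0) g x - S).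
    by rewrite (sum_fsetID g J J0) (fsetIidPr hJ); ring.
  apply: le_lt_trans (nmD _ _) _; rewrite [e]splitr; apply: ltrD => //.
  exact: nm_sum_dominated.
apply/cvgnmP => e e0.
have e3 : 0 < e / 3 by lra.
have [J0 [h1 h2]] := hS2 _ e3.
have : (fun n => \sum_(x <- J0) f n x) @ \oo --> \sum_(x <- J0) g x.
  by apply: cvg_big => [|x _]; [exact: add_continuous|exact: fg].
move/cvgnmP => /(_ _ e3); apply: filterS => n hn.
have -> : \sum_(x <- J n) f n x - S = \sum_(x <- J n `\` J0) f n x
   + (\sum_(x <- J0) f n x - \sum_(x <- J0) g x) + (\sum_(x <- J0) g x - S).
  have -> : \sum_(x <- J n) f n x = \sum_(x <- J n `\` J0) f n x + \sum_(x <- J0) f n x.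
    rewrite (sum_fsetID _ (J n) J0) (sum_fsetID _ J0 (J n)) fsetIC.
    rewrite [X in _ = _ + (_ + X)]big1_fset ?addr0 1?addrC// => x.
    by rewrite in_fsetD => /andP[/hJ].
  by ring.
apply: le_lt_trans (nmD _ _) _; have := nmD (\sum_(x <- J n `\` J0) f n x) 
   (\sum_(x <- J0) f n x - \sum_(x <- J0) g x).
have : nm (\sum_(x <- J n `\` J0) f n x) < e / 3 by apply: nm_sum_dominated.
by lra.
Qed.

End UnorderedSums.

(** * Series and infinite products with a summable majorant *)

Section Products.
Variables (R : realType) (K : cplxField R).

Lemma fset_sum_nat_le (c : nat -> R) (B : R) : (forall k, 0 <= c k) ->
  (forall n, \sum_(k < n) c k <= B) ->
  forall J : {fset nat}, \sum_(k <- J) c k <= B.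
Proof.
move=> c0 cB J; pose N := (\max_(k <- J) k).+1.
apply: le_trans (cB N).
rewrite -(big_mkord xpredT c).
rewrite (perm_big [seq k <- index_iota 0 N | k \in J]); last first.
  apply: uniq_perm; rewrite ?fset_uniq ?filter_uniq ?iota_uniq // => k.
  rewrite mem_filter mem_index_iota /= ltnS.
  by case kJ: (k \in J) => //=; rewrite leq_bigmax_seq.
rewrite big_filter big_mkcond; apply: ler_sum => k _.
by case: ifP.
Qed.

Theorem dominated_series (c : nat -> R) (B : R) (a : nat -> nat -> K) (A : nat -> K) :
  (forall n, \sum_(k < n) c k <= B) -> (forall n k, nm (a n k) <= c k) ->
  (forall k, (fun n => a n k) @ \oo --> A k) ->
  exists S : K, (fun n => \sum_(k < n) A k) @ \oo --> S /\
   forall m : nat -> nat, (forall n k, (m n <= k)%N -> a n k = 0) ->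
     (fun n => \sum_(k < m n) a n k) @ \oo --> S.
Proof.
move=> cB ac aA.
have c0 k : 0 <= c k by apply: le_trans (nm_ge0 _) (ac 0%N k).
have FB := fset_sum_nat_le c0 cB.
have toJ (h : nat -> K) N : \sum_(k < N) h k
    = \sum_(k <- [fset k in iota 0 N]%fset) h k.
  rewrite -(big_mkord xpredT h); apply: perm_big; apply: uniq_perm.
  - by rewrite iota_uniq.
  - exact: fset_uniq.
  - by move=> k; rewrite !inE /index_iota subn0.
have Ac k : nm (A k) <= c k.
  have h : (fun n => nm (a n k)) @ \oo --> nm (A k) by apply: cvg_nm; exact: aA.
  by apply: cvgr_to_le h _; apply: nearW => n.
have [S [hS1 hS2]] := dominated_sum FB ac aA.
(* The truncations of the limit series form a second dominated family with the same limits. It gives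
   the convergence of the ordered partial sums, and uniqueness of unordered sums identifies the two
   values. *)
pose A' n k := if (k < n)%N then A k else 0.
have A'c n k : nm (A' n k) <= c k by rewrite /A'; case: ifP => _; rewrite ?nm0.
have A'A k : (fun n => A' n k) @ \oo --> A k.
  by apply: cvg_near_cst; exists k.+1 => // n /= hn; rewrite /A' hn.
have [S' [hS1' hS2']] := dominated_sum FB A'c A'A.
have SS : S = S'.
  apply/eqP; rewrite -subr_eq0 -nm_eq0; apply/eqP/le_anti; rewrite nm_ge0 andbT.
  apply/ler_addgt0Pl => e e0; rewrite addr0.
  have e2 : 0 < e / 2 by lra.
  have [J h1] := hS1 _ e2; have [J' h2] := hS1' _ e2.
  have := h1 _ (fsubsetUl J J'); have := h2 _ (fsubsetUr J J').
  set s := \sum_(k <- _) _ => h3 h4.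
  have -> : S - S' = (s - S') - (s - S) by ring.
  have := nmB (s - S') (s - S); lra.
exists S; split.
  rewrite SS.
  have -> : (fun n => \sum_(k < n) A k)
      = (fun n => \sum_(k <- [fset k in iota 0 n]%fset) A' n k).
    apply/funext => n; rewrite -(toJ (A' n)); apply: eq_bigr => k _.
    by rewrite /A' ltn_ord.
  apply: (hS2' (fun n => [fset k in iota 0 n]%fset)) => n k.
  by rewrite !inE mem_iota /= add0n /A' => /negbTE ->.
move=> m hm; under eq_fun do rewrite toJ.
apply: (hS2 (fun n => [fset k in iota 0 (m n)]%fset)) => n k.
by rewrite !inE mem_iota /= add0n -leqNgt; exact: hm.
Qed.

(** The increments of the partial products turn an infinite product into a series with terms at most
    c_k exp(B), to which dominated convergence applies. *)
Lemma prod_telescope (a : nat -> K) n :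
  \prod_(k < n) (1 + a k) = 1 + \sum_(k < n) a k * \prod_(i < k) (1 + a i).
Proof.
elim: n => [|n IH]; first by rewrite !big_ord0 addr0.
by rewrite !big_ord_recr /= addrA -IH; ring.
Qed.

Lemma nm_prod_le (c : nat -> R) (a : nat -> K) (n : nat) :
  (forall k, nm (a k) <= c k) ->
  nm (\prod_(k < n) (1 + a k)) <= expR (\sum_(k < n) c k).
Proof.
move=> ac; rewrite nm_prod expR_sum; apply: ler_prod => k _.
rewrite nm_ge0 /=; apply: le_trans (nmD _ _) _; rewrite nm1.
by apply: le_trans (expR_ge1Dx _); rewrite lerD2l.
Qed.

(** A form of the Weierstrass product inequality; the bound 1/2 keeps all factors of the lower
    estimate nonnegative during the induction. *)
Lemma nm_prod_ge (c : nat -> R) (a : nat -> K) (m n : nat) :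
  (forall k, nm (a k) <= c k) -> \sum_(m <= k < n) c k <= 1 / 2 ->
  1 - \sum_(m <= k < n) c k <= nm (\prod_(m <= k < n) (1 + a k)).
Proof.
move=> ac; case: (leqP n m) => [nm|/ltnW].
  by rewrite !big_geq // nm1 subr0.
move/subnKC <-; elim: (n - m)%N => [|d IH].
  by rewrite addn0 !big_geq // nm1 subr0.
rewrite addnS !big_nat_recr ?leq_addr //= => hs.
have c0 : 0 <= c (m + d)%N by apply: le_trans (nm_ge0 _) (ac _).
have s0 : 0 <= \sum_(m <= i < m + d) c i.
  by apply: sumr_ge0 => i _; apply: le_trans (nm_ge0 _) (ac _).
have {}IH := IH (le_trans _ hs); rewrite nmM.
have h1 : 1 - c (m + d)%N <= nm (1 + a (m + d)%N).
  have := nmB (1 + a (m + d)%N) (a (m + d)%N); rewrite addrK nm1.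
  by have := ac (m + d)%N; lra.
apply: le_trans (ler_pM _ _ (IH _) h1); nra.
Qed.

Theorem dominated_prod (c : nat -> R) (B : R) (a : nat -> nat -> K) (A : nat -> K) :
  (forall n, \sum_(k < n) c k <= B) -> (forall n k, nm (a n k) <= c k) ->
  (forall k, (fun n => a n k) @ \oo --> A k) ->
  exists P : K, [/\ (fun n => \prod_(k < n) (1 + A k)) @ \oo --> P,
   (forall m : nat -> nat, (forall n k, (m n <= k)%N -> a n k = 0) ->
     (fun n => \prod_(k < m n) (1 + a n k)) @ \oo --> P) &
   (forall k, 1 + A k != 0) -> P != 0].
Proof.
move=> cB ac aA.
have c0 k : 0 <= c k by apply: le_trans (nm_ge0 _) (ac 0%N k).
have Ac k : nm (A k) <= c k.
  have h : (fun n => nm (a n k)) @ \oo --> nm (A k) by apply: cvg_nm; exact: aA.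
  by apply: cvgr_to_le h _; apply: nearW => n.
pose C := fun k => c k * expR B.
have CB n : \sum_(k < n) C k <= B * expR B.
  by rewrite -mulr_suml ler_wpM2r ?expR_ge0.
pose b := fun n k => a n k * \prod_(i < k) (1 + a n i).
have bC n k : nm (b n k) <= C k.
  rewrite /b nmM; apply: ler_pM; rewrite ?nm_ge0 //.
  by apply: le_trans (nm_prod_le _ (ac n)) _; rewrite ler_expR.
pose A' := fun k => A k * \prod_(i < k) (1 + A i).
have bA k : (fun n => b n k) @ \oo --> A' k.
  apply: cvgM; first exact: aA.
  apply: cvg_big => [|i _]; first exact: mul_continuous.
  by apply: cvgD; [exact: cvg_cst|exact: aA].
have [S [h1 h2]] := dominated_series CB bC bA.
exists (1 + S); split.
- under eq_fun do rewrite prod_telescope.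
  by apply: cvgD; [exact: cvg_cst|exact: h1].
- move=> m hm; under eq_fun do rewrite prod_telescope.
  apply: cvgD; [exact: cvg_cst|apply: h2 => n k hk].
  by rewrite /b hm // mul0r.
- move=> A0.
  (* Beyond the largest element of L the majorant sums to at most 1/2, so the tail product stays
     above 1/2 in modulus and the limit is at least half the modulus of a nonzero finite product. *)
  have [L hL] := small_tail (fset_sum_nat_le c0 cB) (ltac:(lra) : 0 < (1 / 2 : R)).
  pose m := (\max_(k <- L) k).+1.
  have tail n : \sum_(m <= k < n) c k <= 1 / 2.
    apply: ltW; apply: le_lt_trans (hL [fset k in index_iota m n]%fset).
    rewrite le_eqVlt; apply/orP; left; apply/eqP.
    apply: perm_big; apply: uniq_perm; rewrite ?iota_uniq ?fset_uniq // => k.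
    rewrite !inE andbC mem_index_iota; case kL: (k \in L) => //=; last by rewrite andbT.
    rewrite andbF; apply/negbTE; rewrite negb_and -leqNgt; apply/orP; left.
    by rewrite -ltnNge ltnS leq_bigmax_seq.
  have hP : (fun n => \prod_(k < n) (1 + A k)) @ \oo --> 1 + S.
    under eq_fun do rewrite prod_telescope.
    by apply: cvgD; [exact: cvg_cst|exact: h1].
  rewrite -nm_gt0.
  apply: (@lt_le_trans _ _ (nm (\prod_(k < m) (1 + A k)) / 2)).
    by rewrite divr_gt0 // nm_gt0; apply/prodf_neq0 => k _.
  have h : (fun n => nm (\prod_(k < n) (1 + A k))) @ \oo --> nm (1 + S).
    by apply: cvg_nm; exact: hP.
  apply: cvgr_to_ge h _.
  exists m => // n /= mn.
  rewrite -!(big_mkord xpredT (fun k => 1 + A k)).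
  rewrite [X in _ <= nm X](big_cat_nat (n := m)) //= nmM.
  rewrite ler_wpM2l ?nm_ge0 //; apply: le_trans (nm_prod_ge Ac (tail n)).
  by have := tail n; lra.
Qed.

End Products.

(** * Elementary bounds for sine, cosine and the real exponential *)

Section RealBounds.
Variable R : realType.
Implicit Types x y : R.

Lemma sin_mvt y : 0 <= y -> exists2 c, 0 <= c <= y & sin y = cos c * y.
Proof.
move=> y0.
have hc : {within `[0, y], continuous (sin : R -> R)}.
  by apply: continuous_subspaceT => x; exact: continuous_sin.
have [c] := MVT_segment y0 (fun x _ => is_derive_sin x) hc.
by rewrite in_itv /= sin0 !subr0 => ? ->; exists c.
Qed.

Lemma abs_sin_le y : `|sin y| <= `|y|.
Proof.
wlog y0 : y / 0 <= y => [h|].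
  case: (lerP 0 y) => [/h//|/ltW y0]; rewrite -normrN -sinN -(normrN y).
  by apply: h; rewrite oppr_ge0.
have [c _ ->] := sin_mvt y0.
by rewrite normrM ler_piMl // cos_max.
Qed.

Lemma cos_ge_quad y : 1 - y ^+ 2 / 2 <= cos y.
Proof.
have [a ->] : exists a, y = a *+ 2 by exists (y / 2); rewrite mulr2n -splitr.
rewrite cos_mulr2n mulr2n.
have := cos2Dsin2 a; have := abs_sin_le a.
rewrite -ler_sqr ?nnegrE // !real_normK ?num_real //.
by rewrite (_ : (a + a) ^+ 2 / 2 = a ^+ 2 + a ^+ 2) ?mulr2n; [lra|field].
Qed.

Lemma sin_sub_le y : `|sin y - y| <= `|y| ^+ 3 / 2.
Proof.
wlog y0 : y / 0 <= y => [h|].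
  case: (lerP 0 y) => [/h//|/ltW y0].
  have := h (- y); rewrite sinN oppr_ge0 normrN => /(_ y0).
  by rewrite -opprD normrN.
have [c /andP[c0 cy] ->] := sin_mvt y0.
rewrite -{2}[y]mul1r -mulrBl normrM (ger0_norm y0).
have h1 := cos_ge_quad c; have h2 := cos_le1 c.
rewrite ler0_norm; last by lra.
have h3 : c ^+ 2 <= y ^+ 2 by rewrite ler_sqr ?nnegrE.
rewrite (_ : y ^+ 3 / 2 = (y ^+ 2 / 2) * y); last by rewrite exprS; ring.
by apply: ler_wpM2r => //; lra.
Qed.

(** A weak form of Jordan's inequality. Up to 1 the cubic estimate is enough; beyond 1,
    monotonicity, sin 1 >= 1/2 and pi / 2 < 2 are. *)
Lemma sin_ge_quarter y : 0 <= y <= pi / 2 -> y / 4 <= sin y.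
Proof.
have low (z : R) : 0 <= z -> z <= 1 -> z / 2 <= sin z.
  move=> z0 z1; have := sin_sub_le z; rewrite (ger0_norm z0) ler_norml => /andP[h _].
  have : z ^+ 3 <= z by rewrite -[leRHS]expr1 ler_wiXn2l.
  by lra.
move=> /andP[y0 y1]; case: (lerP y 1) => hy.
  by have := low _ y0 hy; lra.
have h1 := low 1 ler01 (lexx 1).
have h2 : sin 1 < sin y.
  by rewrite ltr_sin ?in_itv //=; have := pihalf_ge1 R; lra.
by have := pihalf_lt2 R; lra.
Qed.

Lemma expR_small x : `|x| <= 1 / 2 ->
  [/\ `|expR x - 1 - x| <= 2 * x ^+ 2, `|expR x - 1| <= 2 * `|x| & expR x <= 2].
Proof.
move=> hx; have [h1 h2] : - (1/2) <= x /\ x <= 1 / 2 by move: hx; rewrite ler_norml => /andP.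
have l := expR_ge1Dx x; have := expR_ge1Dx (- x).
have e0 := expR_gt0 x.
have xx : expR x * expR (- x) = 1 by rewrite -expRD subrr expR0.
move=> l'; have u : expR x * (1 - x) <= 1 by rewrite -[leRHS]xx ler_pM2l.
have u2 : expR x <= 2 by nra.
have u3 : expR x - 1 - x <= 2 * x ^+ 2 by rewrite expr2; nra.
split=> //; first by rewrite ger0_norm //; lra.
rewrite ler_norml; case: (lerP 0 x) => x0; last first.
  by rewrite ltr0_norm //; apply/andP; split; nra.
by rewrite ger0_norm //; apply/andP; split; nra.
Qed.

End RealBounds.

(** * Exponential and sine *)

HB.lock Definition cx {R : realType} {K : cplxField R} (z : K) : K :=
  ofR (expR (re z)) * (ofR (cos (im z)) + imu * ofR (sin (im z))).

Section Exponential.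
Variables (R : realType) (K : cplxField R).
Implicit Types (z w : K).

Lemma re_cx z : re (cx z) = expR (re z) * cos (im z).
Proof. by rewrite unlock reM re_ofR im_ofR re_mk mul0r subr0. Qed.

Lemma im_cx z : im (cx z) = expR (re z) * sin (im z).
Proof. by rewrite unlock imM re_ofR im_ofR im_mk mul0r addr0. Qed.

Lemma cxD z w : cx (z + w) = cx z * cx w.
Proof.
apply: reim_eq.
  by rewrite re_cx (reM (cx z)) !re_cx !im_cx reD imD expRD cosD; ring.
by rewrite im_cx (imM (cx z)) !re_cx !im_cx reD imD expRD sinD; ring.
Qed.

Lemma re0 : re (0 : K) = 0. Proof. by rewrite -(rmorph0 ofR) re_ofR. Qed.
Lemma im0 : im (0 : K) = 0. Proof. by rewrite -(rmorph0 ofR) im_ofR. Qed.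
Lemma re1 : re (1 : K) = 1. Proof. by rewrite -(rmorph1 ofR) re_ofR. Qed.
Lemma im1 : im (1 : K) = 0. Proof. by rewrite -(rmorph1 ofR) im_ofR. Qed.

Lemma cx0 : cx (0 : K) = 1.
Proof. by apply: reim_eq; rewrite ?re_cx ?im_cx ?re0 ?im0 expR0 ?cos0 ?sin0 ?re1 ?im1 mul1r. Qed.

Lemma cxN_mul z : cx z * cx (- z) = 1.
Proof. by rewrite -cxD subrr cx0. Qed.

Lemma cx_neq0 z : cx z != 0.
Proof. by apply/negP => /eqP h; have := cxN_mul z; rewrite h mul0r => /eqP; rewrite eq_sym oner_eq0. Qed.

Lemma cxN z : cx (- z) = (cx z)^-1.
Proof. by apply: (mulfI (cx_neq0 z)); rewrite cxN_mul divff // cx_neq0. Qed.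

Lemma nm_cx z : nm (cx z) = expR (re z).
Proof.
rewrite unlock nmM nm_ofR gtr0_norm ?expR_gt0 //.
rewrite (_ : nm _ = 1) ?mulr1 //; apply/eqP; rewrite -sqrp_eq1 ?nm_ge0 // nm_sqr.
by rewrite re_mk im_mk cos2Dsin2.
Qed.

Lemma cx_quad z : nm z <= 1 / 2 -> nm (cx z - 1 - z) <= 6 * nm z ^+ 2.
Proof.
move=> hz; have hx := le_trans (re_le_nm z) hz; have hy := le_trans (im_le_nm z) hz.
apply: le_trans (nm_le_reim _) _.
rewrite !reD !imD !reN !imN re1 im1 re_cx im_cx nm_sqr subr0.
have [h1 h2 h3] := expR_small hx.
set x := re z in hx h1 h2 h3 *; set y := im z in hy *.
have e0 := expR_gt0 x.
have c1 := cos_ge_quad y; have c2 := cos_le1 y; have s1 := sin_sub_le y.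
have A : `|expR x * cos y - 1 - x| <= 2 * x ^+ 2 + y ^+ 2.
  rewrite (_ : _ - x = (expR x - 1 - x) + expR x * (cos y - 1)); last by ring.
  apply: le_trans (ler_normD _ _) _; apply: lerD => //.
  by rewrite normrM (gtr0_norm e0) ler0_norm; [nra|lra].
have B : `|expR x * sin y - y| <= `|y| ^+ 3 + 2 * `|x| * `|y|.
  rewrite (_ : _ - y = expR x * (sin y - y) + (expR x - 1) * y); last by ring.
  apply: le_trans (ler_normD _ _) _; rewrite !normrM (gtr0_norm e0); apply: lerD.
    have : 0 <= `|y| ^+ 3 by rewrite exprn_ge0.
    by move: s1; set u := `|sin y - y|; set v := `|y| ^+ 3; nra.
  by rewrite ler_wpM2r.
have y2 : `|y| ^+ 2 = y ^+ 2 by rewrite real_normK ?num_real.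
have x2 : `|x| ^+ 2 = x ^+ 2 by rewrite real_normK ?num_real.
have y0 := normr_ge0 y; have x0 := normr_ge0 x.
have y3 : `|y| ^+ 3 <= y ^+ 2 by rewrite exprS y2; nra.
rewrite -!y2 -!x2 in A B y3 *.
by move: A B y3; set a := `|_ - x|; set b := `|_ - y|; nra.
Qed.

Lemma cx_sub1_le z : nm z <= 1 / 2 -> nm (cx z - 1) <= 4 * nm z.
Proof.
move=> hz; have h1 := cx_quad hz; rewrite -[cx z - 1](subrK z).
have h2 := nmD (cx z - 1 - z) z; have h3 := nm_ge0 z.
have h4 : nm z ^+ 2 <= nm z / 2 by rewrite expr2; nra.
by lra.
Qed.

(** Quantitative injectivity of the exponential at 0: it lifts a limit of exponentials to a limit of
    small exponents, as the theta inversion requires. *)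
Lemma cx_sub1_ge z : nm z <= 1 / 12 -> nm z / 2 <= nm (cx z - 1).
Proof.
move=> hz; have := cx_quad (ltac:(lra) : nm z <= 1 / 2).
have := nmB (cx z - 1) (cx z - 1 - z); rewrite opprB addrC subrK.
have h3 := nm_ge0 z; have h4 : nm z ^+ 2 <= nm z / 12 by rewrite expr2; nra.
by lra.
Qed.

Lemma cvg_cx (T : Type) (F : set_system T) {FF : Filter F} (f : T -> K) (l : K) :
  f @ F --> l -> (fun x => cx (f x)) @ F --> cx l.
Proof.
move=> hf; apply: (cvg_nm_le (b := fun x => nm (cx l) * (4 * nm (f x - l)))).
  have e0 : 0 < (1 / 2 : R) by lra.
  have /cvgnmP /(_ _ e0) := hf; apply: filterS => x hx.
  rewrite -{1}(subrK l (f x)) cxD -{2}[cx l]mul1r -mulrBl mulrC nmM.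
  by rewrite ler_wpM2l ?nm_ge0 // cx_sub1_le // ltW.
move/cvg_nm0: hf => hf; 
have : (fun x => nm (cx l) * (4 * nm (f x - l))) @ F --> nm (cx l) * (4 * 0).
  by apply: cvgM; [exact: cvg_cst|apply: cvgM; [exact: cvg_cst|exact: hf]].
by rewrite !mulr0.
Qed.

Definition ee z : K := cx (ofR (2 * pi) * imu * z).

Lemma re_ee_arg z : re (ofR (2 * pi) * imu * z) = - (2 * pi * im z).
Proof. rewrite !reM imM re_ofR im_ofR re_imu im_imu; ring. Qed.

Lemma im_ee_arg z : im (ofR (2 * pi) * imu * z) = 2 * pi * re z.
Proof. rewrite !imM reM re_ofR im_ofR re_imu im_imu; ring. Qed.

Lemma eeD z w : ee (z + w) = ee z * ee w.
Proof. by rewrite /ee mulrDr cxD. Qed.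

Lemma ee0 : ee (0 : K) = 1. Proof. by rewrite /ee mulr0 cx0. Qed.
Lemma ee_neq0 z : ee z != 0. Proof. exact: cx_neq0. Qed.
Lemma eeN z : ee (- z) = (ee z)^-1. Proof. by rewrite /ee mulrN cxN. Qed.
Lemma eeB z w : ee (z - w) = ee z / ee w. Proof. by rewrite eeD eeN. Qed.

Lemma nm_ee z : nm (ee z) = expR (- (2 * pi * im z)).
Proof. by rewrite /ee nm_cx re_ee_arg. Qed.

Lemma eeMn z n : ee (z *+ n) = ee z ^+ n.
Proof. by elim: n => [|n IH]; rewrite ?mulr0n ?ee0 // mulrS eeD IH exprS. Qed.

Lemma ee1 : ee (1 : K) = 1.
Proof.
apply: reim_eq; rewrite ?re_cx ?im_cx re_ee_arg im_ee_arg re1 im1 mulr0 oppr0 expR0 mul1r mulr1.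
  by rewrite (_ : 2 * pi = pi *+ 2) ?cos2pi // mulr_natl.
by rewrite (_ : 2 * pi = pi *+ 2) ?mulr_natl // mulr2n sinD sinpi mul0r mulr0 addr0.
Qed.

Lemma ee_nat n : ee n%:R = 1. Proof. by rewrite eeMn ee1 expr1n. Qed.

Lemma ee_int (n : int) : ee n%:~R = 1.
Proof. by case: n => n; rewrite ?NegzE ?mulrNz ?eeN ee_nat ?invr1. Qed.

Lemma ee_half : ee (1 / 2) = -1.
Proof.
rewrite (_ : 1 / 2 = ofR (1 / 2) :> K); last by rewrite fmorph_div rmorph1 rmorph_nat.
apply: reim_eq; rewrite ?re_cx ?im_cx re_ee_arg im_ee_arg re_ofR im_ofR mulr0 oppr0 expR0 mul1r ?reN ?imN ?re1 ?im1.
  by rewrite (_ : 2 * pi * (1 / 2) = pi) ?cospi //; field.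
by rewrite (_ : 2 * pi * (1 / 2) = pi) ?sinpi ?oppr0 //; field.
Qed.

Lemma ee_quarter : ee (1 / 4) = imu.
Proof.
rewrite (_ : 1 / 4 = ofR (1 / 4) :> K); last by rewrite fmorph_div rmorph1 rmorph_nat.
apply: reim_eq; rewrite ?re_cx ?im_cx re_ee_arg im_ee_arg re_ofR im_ofR mulr0 oppr0 expR0 mul1r ?re_imu ?im_imu.
  by rewrite (_ : 2 * pi * (1 / 4) = pi / 2) ?cos_pihalf //; field.
by rewrite (_ : 2 * pi * (1 / 4) = pi / 2) ?sin_pihalf //; field.
Qed.

(** The modulus forces z to be real. After subtraction of the floor, the double-angle formula
    reduces the claim to the positivity of the sine on (0, pi). *)
Lemma ee_eq1 z : ee z = 1 -> exists n : int, z = n%:~R.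
Proof.
move=> h; have i0 : im z = 0.
  have := nm_ee z; rewrite h nm1 => /esym/eqP; rewrite -[X in _ == X](@expR0 R) (inj_eq (@expR_inj R)) oppr_eq0 !mulf_eq0.
  by rewrite pnatr_eq0 /= gt_eqF ?pi_gt0 //= => /eqP.
pose n := Num.floor (re z); pose f := re z - n%:~R.
have zE : z = n%:~R + ofR f.
  rewrite [LHS]reimE i0 rmorph0 mulr0 addr0 /f rmorphB rmorph_int; ring.
have f0 : 0 <= f by rewrite subr_ge0 floor_le.
have f1 : f < 1 by have := floorD1_gt (re z); rewrite intrD -/n /f; lra.
exists n; rewrite zE; have : ee (ofR f) = 1 by move: h; rewrite zE eeD ee_int mul1r.
move/(congr1 re); rewrite re_cx re_ee_arg im_ee_arg im_ofR re_ofR mulr0 oppr0 expR0 mul1r re1.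
rewrite (_ : 2 * pi * f = (pi * f) *+ 2); last by rewrite mulr2n; ring.
rewrite cos_mulr2n => hc.
have hs : sin (pi * f) ^+ 2 = 0.
  by have := cos2Dsin2 (pi * f); move: hc; rewrite mulr2n; lra.
case: (ltrgtP f 0) f0 => // [f0 _|-> _]; last by rewrite rmorph0 addr0.
have : 0 < sin (pi * f).
  apply: sin_gt0_pi; rewrite mulr_gt0 ?pi_gt0 //=.
  by rewrite -[ltRHS]mulr1 ltr_pM2l ?pi_gt0.
by move/eqP: hs; rewrite sqrf_eq0 => /eqP ->; rewrite ltxx.
Qed.

End Exponential.

(** This is 2 i sin(pi z). *)
HB.lock Definition ss {R : realType} {K : cplxField R} (z : K) : K :=
  ee (z / 2) - ee (- (z / 2)).

(** * Euler's product for the sine *)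

Section SineProduct.
Variables (R : realType) (K : cplxField R).
Implicit Types (z w : K).

Lemma ssN z : ss (- z) = - ss z.
Proof. by rewrite unlock mulNr opprK opprB. Qed.

Lemma ssE z : ss z = ee (- (z / 2)) * (ee z - 1).
Proof. by rewrite unlock mulrBr mulr1 -eeD; congr (ee _ - _); field. Qed.

Lemma ee_primitive n : (0 < n)%N -> n.-primitive_root (ee (n%:R^-1 : K)).
Proof.
move=> n0; have nz : (n%:R : K) != 0 by rewrite pnatr_eq0 -lt0n.
apply/andP; split => //; apply/forallP => i; rewrite unity_rootE -eeMn.
case: (ltngtP i.+1 n) => hi; last 2 first.
- by have := ltn_ord i; rewrite ltnNge -ltnS hi.
- by rewrite hi -[n%:R^-1 *+ n]mulr_natr mulVf // ee1 !eqxx.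
apply/eqP/negbTE/negP => /eqP /ee_eq1 [m hm].
have {}hm : (i.+1%:R : K) = (m * n)%:~R.
  by rewrite intrM -hm mulrnAl mulVf.
have {}hm : (i.+1)%:Z = m * n by apply: (@intr_inj K); rewrite -hm.
case: m hm => m hm; last by move: hm; rewrite NegzE; lia.
by move: hm; case: m => [|m]; [lia|nia].
Qed.

Lemma ss_sqrE z : ss z ^+ 2 = ee z + ee (- z) - 2.
Proof.
rewrite [in RHS](_ : z = z / 2 + z / 2); last by field.
rewrite unlock opprD !eeD !eeN; have := ee_neq0 (z / 2).
by set a := ee _ => ha; field.
Qed.

Lemma prod_upper_half k (F : nat -> K) :
  \prod_(k.+1 <= i < k.*2.+1) F i = \prod_(j < k) F (k.*2.+1 - j.+1)%N.
Proof.
rewrite -[X in \prod_(X <= _ < _) _]add0n big_addn.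
rewrite (_ : (k.*2.+1 - k.+1 = k)%N); last by rewrite -addnn; lia.
rewrite big_nat_rev big_mkord; apply: eq_bigr => j _; congr F.
by rewrite -addnn; have := ltn_ord j; lia.
Qed.

(** Factor X^n - 1 over the n-th roots of unity at X = e(z). As n = 2 k + 1 is odd, the roots other
    than 1 fall into k pairs of inverses, and each pair contributes e(z) times a difference of
    squares. *)
Lemma ss_multiple k z : ss (k.*2.+1%:R * z)
  = ss z * \prod_(j < k) (ss z ^+ 2 - ss (j.+1%:R / k.*2.+1%:R) ^+ 2).
Proof.
set n := k.*2.+1; have nz : (n%:R : K) != 0 by rewrite pnatr_eq0.
pose zt : K := ee n%:R^-1.
have /(congr1 (fun p => p.[ee z])) := factor_Xn_sub_1 (ee_primitive (isT : (0 < n)%N)).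
rewrite hornerD hornerN hornerC hornerXn horner_prod.
under eq_bigr do rewrite hornerXsubC.
rewrite (big_cat_nat (n := 1)) //= big_nat1 expr0 (big_cat_nat (n := k.+1)) //=; last first.
  by rewrite /n -addnn; lia.
rewrite prod_upper_half big_add1 /= big_mkord -big_split /= -/zt.
have step (j : 'I_k) : (ee z - zt ^+ j.+1) * (ee z - zt ^+ (n - j.+1))
   = ee z * (ss z ^+ 2 - ss (j.+1%:R / n%:R) ^+ 2).
  have zj : zt ^+ (n - j.+1) = (zt ^+ j.+1)^-1.
    have z0 : zt ^+ j.+1 != 0 by rewrite expf_neq0 // ee_neq0.
    apply: (mulfI z0); rewrite divff // -exprD subnKC; last first.
      by rewrite /n -addnn; have := ltn_ord j; lia.
    by rewrite -eeMn -[n%:R^-1 *+ n]mulr_natr mulVf // ee1.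
  rewrite zj !ss_sqrE !eeN (_ : _ / _ = n%:R^-1 *+ j.+1); last by rewrite mulr_natl.
  rewrite eeMn -/zt.
  have h1 := ee_neq0 z; have h2 : zt ^+ j.+1 != 0 by rewrite expf_neq0 // ee_neq0.
  by set a := zt ^+ _ in h2 *; set b := ee z in h1 *; field; rewrite h1 h2.
under eq_bigr do rewrite step.
rewrite big_split /= prodr_const card_ord -/n => h.
have h1 := ssE (n%:R * z); move: h1.
rewrite mulr_natl eeMn -{}h => ->.
rewrite ssE -!mulrA; set P := \prod_(_ < _) _.
have -> : ee (- (z *+ n / 2)) = ee (- (z / 2)) * ee (- z) ^+ k.
  by rewrite -eeMn -eeD /n -addnn; congr ee; rewrite mulrS mulrnDr; field.
rewrite (eeN z); have h1 := ee_neq0 z; have h2 := expf_neq0 k h1.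
by rewrite exprVn; set a := ee z in h1 h2 *; field.
Qed.

Lemma sum_inv_sq n : \sum_(j < n) ((j.+1)%:R ^+ 2)^-1 <= 2 :> R.
Proof.
case: n => [|n]; first by rewrite big_ord0.
suff : \sum_(j < n.+1) ((j.+1)%:R ^+ 2)^-1 <= 2 - n.+1%:R^-1 :> R.
  by move/le_trans; apply; rewrite lerBlDr lerDl invr_ge0.
elim: n => [|n IH]; first by rewrite big_ord1 expr1n invr1; lra.
rewrite big_ord_recr /=; apply: le_trans (lerD IH (lexx _)) _.
have a0 : (0 : R) < n.+1%:R by rewrite ltr0n.
rewrite -[n.+2]addn1 natrD; set a : R := n.+1%:R in a0 *.
rewrite -subr_ge0 (_ : _ - _ = (a * (a + 1) ^+ 2)^-1).
  by rewrite invr_ge0 mulr_ge0 ?sqr_ge0 // ltW.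
by field; rewrite !gt_eqF //; lra.
Qed.

Lemma ss_sub_le z : nm z <= 1 / 8 ->
  nm (ss z - ofR (2 * pi) * imu * z) <= 12 * (4 * nm z) ^+ 2.
Proof.
move=> hz; pose t := ofR (2 * pi) * imu * (z / 2).
have -> : ss z - ofR (2 * pi) * imu * z = (cx t - 1 - t) - (cx (- t) - 1 - - t).
  rewrite unlock /ee mulrN -/t; have -> : ofR (2 * pi) * imu * z = t + t.
    by rewrite /t; field.
  by ring.
have p0 := pi_gt0 R; have p2 := pihalf_lt2 R.
have tz : nm t <= 4 * nm z.
  rewrite /t !nmM nm_imu nm_ofR nmV nm_nat ger0_norm; last by lra.
  by have := nm_ge0 z; set m := nm z; nra.
have th : nm t <= 1 / 2 by lra.
have h1 := cx_quad th; have h2 : nm (cx (- t) - 1 - - t) <= 6 * nm t ^+ 2.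
  by rewrite -(nmN t); apply: cx_quad; rewrite nmN.
have := nmB (cx t - 1 - t) (cx (- t) - 1 - - t).
have : nm t ^+ 2 <= (4 * nm z) ^+ 2 by rewrite ler_sqr ?nnegrE ?mulr_ge0 ?nm_ge0.
by lra.
Qed.

Lemma cvg_ss_scaled z :
  (fun n => n.*2.+1%:R * ss (z / n.*2.+1%:R)) @ \oo --> ofR (2 * pi) * imu * z.
Proof.
have inv0 : (fun n => (n.*2.+1%:R)^-1) @ \oo --> (0 : R).
  apply: (squeeze_cvgr _ (cvg_cst 0) cvg_harmonic); apply: nearW => n.
  rewrite invr_ge0 ler0n /= lef_pV2 ?posrE ?ltr0n // ler_nat -addnn; lia.
apply: (cvg_nm_le (b := fun n => 12 * (4 * nm z) ^+ 2 * (n.*2.+1%:R)^-1)); last first.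
  rewrite -[X in _ --> X](mulr0 (12 * (4 * nm z) ^+ 2)).
  by apply: cvgM; [exact: cvg_cst|exact: inv0].
have : (fun n => nm z * (n.*2.+1%:R)^-1) @ \oo --> (0 : R).
  by rewrite -[X in _ --> X](mulr0 (nm z)); apply: cvgM; [exact: cvg_cst|exact: inv0].
move/cvgrPdist_lt => /(_ (1 / 8) ltac:(lra)); apply: filterS => n.
set m : K := n.*2.+1%:R; have m0 : m != 0 by rewrite pnatr_eq0.
have mE : nm m = n.*2.+1%:R by rewrite nm_nat.
rewrite sub0r normrN ger0_norm ?mulr_ge0 ?nm_ge0 ?invr_ge0 // -mE -nmV -nmM => h.
have -> : m * ss (z / m) - ofR (2 * pi) * imu * z
  = m * (ss (z / m) - ofR (2 * pi) * imu * (z / m)) by field.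
rewrite nmM; apply: le_trans (ler_wpM2l (nm_ge0 _) (ss_sub_le (ltW h))) _.
have m1 : 0 < nm m by rewrite nm_gt0.
by rewrite nmM !nmV le_eqVlt; apply/orP; left; apply/eqP; field; rewrite gt_eqF.
Qed.

(** A lower bound, uniform in k after scaling, for the denominators of the finite sine product; it
    supplies the majorant C / j^2. *)
Lemma nm_ss_ratio_ge k j : (j < k)%N ->
  j.+1%:R / k.*2.+1%:R <= nm (ss (j.+1%:R / k.*2.+1%:R) : K).
Proof.
move=> jk; set x : R := j.+1%:R / k.*2.+1%:R.
have p0 := pi_gt0 R; have p2 := pi_ge2 R.
have x0 : 0 <= x by rewrite divr_ge0.
have x1 : x <= 1 / 2.
  rewrite /x ler_pdivrMr ?ltr0n // mul1r mulrC ler_pdivlMr // -natrM ler_nat -addnn; lia.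
have -> : j.+1%:R / k.*2.+1%:R = ofR x :> K by rewrite fmorph_div !rmorph_nat.
rewrite unlock /ee mulrN cxN; set t := _ * (_ / _).
have tE : t = imu * ofR (pi * x).
  by rewrite /t rmorphM rmorphM rmorph_nat; field.
have -> : cx t - (cx t)^-1 = 2 * imu * ofR (sin (pi * x)).
  rewrite -cxN tE; apply: reim_eq; rewrite ?reD ?imD ?reN ?imN !(re_cx, im_cx).
    rewrite !(reN, imN, reM, imM, re_imu, im_imu, re_ofR, im_ofR).
    rewrite -[2]/(1 + 1) reD imD re1 im1.
    by rewrite !(mul0r, mul1r, mulr0, subr0, sub0r, add0r, addr0, oppr0, expR0, cosN, sinN) subrr.
  rewrite !(reN, imN, reM, imM, re_imu, im_imu, re_ofR, im_ofR).
  rewrite -[2]/(1 + 1) reD imD re1 im1.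
  rewrite !(mul0r, mul1r, mulr0, subr0, sub0r, add0r, addr0, oppr0, expR0, cosN, sinN); ring.
rewrite !nmM nm_imu nm_nat nm_ofR mulr1.
have hs : pi * x / 4 <= sin (pi * x).
  by apply: sin_ge_quarter; rewrite mulr_ge0 ?pi_ge0 //= ler_wpM2l ?pi_ge0 // -div1r.
by rewrite ger0_norm; nra.
Qed.

(** The finite product for an odd multiple is taken to the limit. Comparison with the point 1/2
    removes its normalising factors, so the constant need not be evaluated; only its independence of
    z and its being nonzero matter later. *)
Theorem sine_product : exists2 c : K, c != 0 & forall z,
  (fun n => z * \prod_(j < n) (1 - z ^+ 2 / j.+1%:R ^+ 2)) @ \oo --> c * ss z.
Proof.
pose A z := fun j : nat => - (z ^+ 2 / j.+1%:R ^+ 2).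
(* The j-th factor of the finite product for n = 2 k + 1, normalised to 1 at z = 0 and replaced by 1
   beyond the range. *)
pose a z := fun n j : nat => if (j < n)%N then
   - (ss (z / n.*2.+1%:R) ^+ 2 / ss (j.+1%:R / n.*2.+1%:R) ^+ 2) else 0.
have gen (t m u : K) : t != 0 -> m != 0 -> - (u ^+ 2 / m ^+ 2) = - ((t * u) ^+ 2 * ((t * m) ^+ 2)^-1).
  by move=> ht hm; field; rewrite ?ht ?hm.
have aA z j : (fun n => a z n j) @ \oo --> A z j.
  have t0 : ofR (2 * pi) * imu != 0 :> K.
    by rewrite -nm_eq0 nmM nm_imu mulr1 nm_ofR normr_eq0 gt_eqF // mulr_gt0 ?pi_gt0.
  have j0 : (j.+1%:R : K) != 0 by rewrite pnatr_eq0.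
  have : (fun n => - ((n.*2.+1%:R * ss (z / n.*2.+1%:R)) ^+ 2 *
       ((n.*2.+1%:R * ss (j.+1%:R / n.*2.+1%:R)) ^+ 2)^-1)) @ \oo --> A z j.
    rewrite (_ : A z j = - ((ofR (2 * pi) * imu * z) ^+ 2 * ((ofR (2 * pi) * imu * j.+1%:R) ^+ 2)^-1)).
      apply: cvgN; apply: cvgM.
        by rewrite expr2; apply: cvgM; exact: cvg_ss_scaled.
      apply: cvgV; first by rewrite expf_neq0 // mulf_neq0.
      by rewrite expr2; apply: cvgM; exact: cvg_ss_scaled.
    exact: gen.
  apply: cvg_trans; apply: near_eq_cvg; exists j.+1 => // n /= hn.
  rewrite /a hn; have n0 : (n.*2.+1%:R : K) != 0 by rewrite pnatr_eq0.
  have := nm_ss_ratio_ge hn => h; have s0 : ss (j.+1%:R / n.*2.+1%:R : K) != 0.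
    by rewrite -nm_gt0; apply: lt_le_trans h; rewrite divr_gt0 ?ltr0n.
  exact/esym/gen.
have bnd z : exists C : R, forall n j, nm (a z n j) <= C * ((j.+1)%:R ^+ 2)^-1.
  have h := @cvg_nm _ _ _ _ eventually_filter _ _ (@cvg_ss_scaled z).
  have [M [_ hM]] := cvg_seq_bounded (cvgP _ h).
  exists ((M + 1) ^+ 2) => n j; rewrite /a; case: ifP => jn; last first.
    by rewrite nm0 mulr_ge0 ?sqr_ge0 // invr_ge0 sqr_ge0.
  have h1 := nm_ss_ratio_ge jn.
  have /= := hM (M + 1) ltac:(lra) n I; rewrite ger0_norm ?nm_ge0 // nmM nm_nat => h2.
  rewrite nmN nmM nmV !nmX.
  have n0 : (0 : R) < n.*2.+1%:R by rewrite ltr0n.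
  have j0 : (0 : R) < j.+1%:R by rewrite ltr0n.
  have h3 : nm (ss (z / n.*2.+1%:R)) <= (M + 1) / n.*2.+1%:R by rewrite ler_pdivlMr // mulrC.
  apply: (@le_trans _ _ (((M + 1) / n.*2.+1%:R) ^+ 2 / (j.+1%:R / n.*2.+1%:R) ^+ 2)).
    apply: ler_pM; rewrite ?exprn_ge0 ?invr_ge0 ?nm_ge0 //.
    - exact: sqr_ge0.
    - by rewrite ler_sqr ?nnegrE ?nm_ge0 //; apply: le_trans h3; exact: nm_ge0.
    - have q0 : 0 < j.+1%:R / n.*2.+1%:R :> R by rewrite divr_gt0.
      rewrite lef_pV2 ?posrE ?exprn_gt0 //; last exact: lt_le_trans h1.
      by rewrite ler_sqr ?nnegrE ?nm_ge0 // ltW.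
  rewrite le_eqVlt; apply/orP; left; apply/eqP.
  by field; rewrite !gt_eqF.
have prodE z : exists2 P : K, (fun n => \prod_(j < n) (1 - z ^+ 2 / j.+1%:R ^+ 2)) @ \oo --> P &
   (fun n => \prod_(j < n) (1 + a z n j)) @ \oo --> P /\
   ((forall j, 1 + A z j != 0) -> P != 0).
  have [C hC] := bnd z.
  have C0 : 0 <= C.
    have := hC 0%N 0%N; rewrite expr1n invr1 mulr1; apply: le_trans; exact: nm_ge0.
  have [P [h1 h2 h3]] := @dominated_prod R K (fun j => C * ((j.+1)%:R ^+ 2)^-1) (C * 2)
    (a z) (A z) (fun n => ltac:(by rewrite -mulr_sumr ler_wpM2l ?sum_inv_sq)) hC (aA z).
  exists P => //; split=> //; apply: (h2 id) => n k.
  by rewrite /a ltnNge => ->.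
(* For each n, ss z and ss w contain the same product of values at j / n; cross multiplication
   eliminates it before the limit is taken. *)
have key z w P Q : (fun n => \prod_(j < n) (1 + a z n j)) @ \oo --> P ->
    (fun n => \prod_(j < n) (1 + a w n j)) @ \oo --> Q -> z * P * ss w = w * Q * ss z.
  move=> hP hQ; have t0 : ofR (2 * pi) * imu != 0 :> K.
    by rewrite -nm_eq0 nmM nm_imu mulr1 nm_ofR normr_eq0 gt_eqF // mulr_gt0 ?pi_gt0.
  apply: (mulfI t0); rewrite !mulrA.
  have c1 : (fun n => n.*2.+1%:R * ss (z / n.*2.+1%:R) * \prod_(j < n) (1 + a z n j) * ss w) @ \oo
     --> ofR (2 * pi) * imu * z * P * ss w.
    by apply: cvgM; [apply: cvgM => //; exact: cvg_ss_scaled|exact: cvg_cst].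
  have c2 : (fun n => n.*2.+1%:R * ss (w / n.*2.+1%:R) * \prod_(j < n) (1 + a w n j) * ss z) @ \oo
     --> ofR (2 * pi) * imu * w * Q * ss z.
    by apply: cvgM; [apply: cvgM => //; exact: cvg_ss_scaled|exact: cvg_cst].
  apply: cvgC_unique c1 _; apply: cvg_trans c2; apply: near_eq_cvg; apply: nearW => n.
  have n0 : (n.*2.+1%:R : K) != 0 by rewrite pnatr_eq0.
  have ze u : ss u = ss (u / n.*2.+1%:R) * \prod_(j < n) (1 + a u n j) *
     \prod_(j < n) (- ss (j.+1%:R / n.*2.+1%:R) ^+ 2).
    rewrite -{1}[u](divfK n0) mulrC ss_multiple -mulrA -big_split /=; congr (_ * _).
    apply: eq_bigr => j _; rewrite /a ltn_ord.
    have h := nm_ss_ratio_ge (ltn_ord j); have s0 : ss (j.+1%:R / n.*2.+1%:R : K) != 0.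
      by rewrite -nm_gt0; apply: lt_le_trans h; rewrite divr_gt0 ?ltr0n.
    by move: s0; set s1 := ss _; set s2 := ss _ => s0; field.
  by rewrite (ze z) (ze w); ring.
have [P2 hP2 [hP2a hP2n]] := prodE (1 / 2).
have s2 : ss (1 / 2 : K) != 0.
  rewrite unlock (_ : 1 / 2 / 2 = 1 / 4); last by field.
  rewrite eeN ee_quarter; have i0 : (imu : K) != 0 by rewrite -nm_eq0 nm_imu oner_eq0.
  rewrite (_ : imu - imu^-1 = 2 * imu); first by rewrite mulf_neq0 // pnatr_eq0.
  apply: (mulfI i0); rewrite mulrBr divff // mulrCA imu_sq; ring.
exists (1 / 2 * P2 / ss (1 / 2)).
  rewrite !mulf_neq0 ?invr_eq0 ?pnatr_eq0 ?oner_eq0 //; apply: hP2n => j; rewrite /A.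
  have : (1 : K) - (2 * j.+1%:R) ^- 2 != 0.
    rewrite subr_eq0 eq_sym invr_eq1 -natrM -natrX pnatr_eq1.
    by rewrite gtn_eqF // -[1%N](exp1n 2) ltn_exp2r // mulnS ltn_addr.
  have m0 : (j.+1%:R : K) != 0 by rewrite pnatr_eq0.
  by rewrite (_ : (2 * _) ^- 2 = (1 / 2) ^+ 2 / j.+1%:R ^+ 2) //; field.
move=> z; have [P hP [hPa _]] := prodE z.
have -> : 1 / 2 * P2 / ss (1 / 2) * ss z = z * P.
  by apply: (mulIf s2); rewrite (key _ _ _ _ hPa hP2a); field.
by apply: cvgM; [exact: cvg_cst|exact: hP].
Qed.

End SineProduct.

(** * Infinite products and the theta function *)

Section Pochhammer.
Variables (R : realType) (K : cplxField R).
Implicit Types (a q w t : K).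

Lemma geo_sum_le (x : R) n : 0 <= x -> x < 1 -> \sum_(k < n) x ^+ k <= (1 - x)^-1.
Proof.
move=> x0 x1; have d0 : 0 < 1 - x by lra.
rewrite -div1r ler_pdivlMr // mulrC -opprB mulNr -subrX1 opprB.
by rewrite lerBlDr lerDl exprn_ge0.
Qed.

Definition poch a q : K := lim ((fun n => \prod_(k < n) (1 - a * q ^+ k)) @ \oo).

Lemma poch_spec a q : nm q < 1 ->
  (fun n => \prod_(k < n) (1 - a * q ^+ k)) @ \oo --> poch a q /\
  ((forall k, 1 - a * q ^+ k != 0) -> poch a q != 0).
Proof.
move=> q1; pose A k := - (a * q ^+ k).
have [||//|P [h1 _ h3]] := @dominated_prod R K (fun k => nm a * nm q ^+ k)
   (nm a * (1 - nm q)^-1) (fun=> A) A.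
- by move=> n; rewrite -mulr_sumr ler_wpM2l ?nm_ge0 // geo_sum_le ?nm_ge0.
- by move=> n k; rewrite nmN nmM nmX.
- by move=> k; exact: cvg_cst.
have -> : poch a q = P by apply: cvg_lim => //; exact: norm_hausdorff.
by [].
Qed.

Lemma cvg_poch a q : nm q < 1 ->
  (fun n => \prod_(k < n) (1 - a * q ^+ k)) @ \oo --> poch a q.
Proof. by move=> q1; have [] := poch_spec a q1. Qed.

Lemma poch_neq0 a q : nm q < 1 -> (forall k, 1 - a * q ^+ k != 0) -> poch a q != 0.
Proof. by move=> q1; have [] := poch_spec a q1. Qed.

Lemma sub1_neq0 a : nm a < 1 -> 1 - a != 0.
Proof.
by move=> a1; rewrite subr_eq0; apply/negP => /eqP h; move: a1; rewrite -h nm1 ltxx.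
Qed.

Lemma poch_neq0_lt1 a q : nm q < 1 -> nm a < 1 -> poch a q != 0.
Proof.
move=> q1 a1; apply: poch_neq0 => // k; apply: sub1_neq0; rewrite nmM nmX.
apply: le_lt_trans a1; rewrite ler_piMr ?nm_ge0 // exprn_ile1 ?nm_ge0 //; exact: ltW.
Qed.

Lemma poch_rec a q : nm q < 1 -> poch a q = (1 - a) * poch (a * q) q.
Proof.
move=> q1; have h := @cvg_poch a q q1.
have h2 : (fun n => \prod_(k < n.+1) (1 - a * q ^+ k)) @ \oo --> (1 - a) * poch (a * q) q.
  under eq_fun do rewrite big_ord_recl expr0 mulr1.
  apply: cvgM; first exact: cvg_cst.
  have -> : (fun n => \prod_(i < n) (1 - a * q ^+ bump 0 i))
     = (fun n => \prod_(k < n) (1 - a * q * q ^+ k)).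
    by apply/funext => n; apply: eq_bigr => i _; rewrite /bump add1n exprS mulrA.
  exact: cvg_poch.
apply: cvgC_unique h2; rewrite -(cvg_shiftS (fun n => \prod_(k < n) (1 - a * q ^+ k))) in h.
exact: h.
Qed.

Lemma nm_ee_lt1 t : 0 < im t -> nm (ee t) < 1.
Proof. by move=> t0; rewrite nm_ee expR_lt1 oppr_lt0 mulr_gt0 ?mulr_gt0 ?pi_gt0. Qed.

End Pochhammer.

(** Jacobi's odd theta function in product form, without the factors that depend on t alone. *)
HB.lock Definition th {R : realType} {K : cplxField R} (w t : K) : K :=
  ss w * poch (ee (t + w)) (ee t) * poch (ee (t - w)) (ee t).

Section Theta.
Variables (R : realType) (K : cplxField R).
Implicit Types (a q w t : K).

Lemma ss_ee w : ss w = ee (w / 2) * (1 - ee (- w)).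
Proof. by rewrite unlock mulrBr mulr1 -eeD; congr (_ - ee _); field. Qed.

Lemma ssD1 w : ss (w + 1) = - ss w.
Proof.
rewrite !ssE (eeD w) ee1 mulr1 (mulrDl w) opprD (eeD (- (w / 2))) (eeN (1 / 2)) ee_half.
by rewrite invrN1; ring.
Qed.

Lemma thN w t : th (- w) t = - th w t.
Proof. by rewrite unlock ssN opprK; ring. Qed.

Lemma thD1 w t : th (w + 1) t = - th w t.
Proof. by rewrite unlock ssD1 opprD !addrA !(eeD _ 1) !eeB ee1 !mulr1 divr1; ring. Qed.

Lemma thDt w t : 0 < im t -> th (w + t) t = - ee (- w - t / 2) * th w t.
Proof.
move=> t0; have q1 := nm_ee_lt1 t0.
rewrite unlock opprD [t + (_ - t)]addrC subrK [in LHS]ssE [in RHS]ss_ee.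
rewrite (poch_rec (ee (- w)) q1) (poch_rec (ee (t + w)) q1) -!eeD.
rewrite (addrC w t) (addrC (- w) t) -!addrA [w + t]addrC.
have -> : ee (- w - t / 2) = ee (- ((t + w) / 2)) / ee (w / 2).
  by rewrite -eeB; congr ee; field.
by have := ee_neq0 (w / 2); set x := ee (w / 2) => x0; field.
Qed.

Lemma thBt w t : 0 < im t -> th (w - t) t = - ee (w - t / 2) * th w t.
Proof.
move=> t0; have h := @thDt (- w) t t0; rewrite opprK thN in h.
by rewrite -[w - t]opprK opprB [t - w]addrC thN h; ring.
Qed.

Lemma th_neq0 w t : 0 < im t ->
  (forall m n : int, w != m%:~R * t + n%:~R) -> th w t != 0.
Proof.
move=> t0 hw; have q1 := nm_ee_lt1 t0.
have ne x : (forall n : int, x != n%:~R) -> 1 - ee x != 0.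
  by move=> hx; rewrite subr_eq0 eq_sym; apply/negP => /eqP /ee_eq1 [n /eqP]; apply/negP.
have ne2 (s : K) (k : nat) : (s = w \/ s = - w) -> 1 - ee (t + s) * ee t ^+ k != 0.
  move=> hs; rewrite -eeMn -eeD; apply: ne => n; case: hs => ->; apply/negP => /eqP h.
    move/negP: (hw (- (k.+1)%:Z) n); apply; rewrite -h mulrNz.
    by apply/eqP; rewrite -[t *+ k]mulr_natl -[k.+1]addn1 PoszD intrD; ring.
  move/negP: (hw k.+1 (- n)); apply; rewrite mulrNz -h.
  by apply/eqP; rewrite -[t *+ k]mulr_natl -[k.+1]addn1 PoszD intrD; ring.
rewrite unlock !mulf_neq0 //.
- rewrite ss_ee mulf_neq0 ?ee_neq0 // ne // => n; apply/negP => /eqP h.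
  by move/negP: (hw 0 (- n)); apply; rewrite mulrNz -h mul0r add0r opprK.
- by apply: poch_neq0 => // k; apply: ne2; left.
- by apply: poch_neq0 => // k; apply: ne2; right.
Qed.

End Theta.

(** * Lattice products and orders of summation *)

Section IteratedLimit.

(* The limit L -> oo first, then N -> oo: Eisenstein's order of summation. *)
Definition iter_lim : set_system (nat * nat) :=
  [set A | \forall N \near \oo, \forall L \near \oo, A (N, L)].

Global Instance iter_lim_filter : ProperFilter iter_lim.
Proof.
apply: Build_ProperFilter_ex.
  by move=> A [N _ /(_ N (leqnn N)) [L _ /(_ L (leqnn L)) h]]; exists (N, L).
split.
- by apply: nearW => N; apply: nearW.
- move=> A B [N1 _ h1] [N2 _ h2]; exists (maxn N1 N2) => // N /=.
  by rewrite geq_max => /andP[/h1 hA /h2 hB]; exact: filterI.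
- move=> A B AB [N1 _ h1]; exists N1 => // N /h1.
  by apply: filterS => L; exact: AB.
Qed.

Lemma cvg_iter (R : realType) (K : cplxField R) (f : nat -> nat -> K) (g : nat -> K) (l : K) :
  (forall N, (fun L => f N L) @ \oo --> g N) -> g @ \oo --> l ->
  (fun p => f p.1 p.2) @ iter_lim --> l.
Proof.
move=> h1 h2; apply/cvgnmP => e e0; have e2 : 0 < e / 2 by lra.
have /cvgnmP /(_ _ e2) := h2; apply: filterS => N hN.
have /cvgnmP /(_ _ e2) := h1 N; apply: filterS => L hL /=.
rewrite -[f N L](subrK (g N)) -addrA; apply: le_lt_trans (nmD _ _) _.
by rewrite [e]splitr ltrD.
Qed.

Lemma cvg_iter_real (R : realType) (b : nat -> R) :
  b @ \oo --> (0 : R) -> (fun p => b p.1) @ iter_lim --> (0 : R).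
Proof.
move/cvgrPdist_lt => h; apply/cvgrPdist_lt => e /h; apply: filterS => N hN.
exact: nearW.
Qed.

End IteratedLimit.

Section Box.
Variables (R : realType) (K : cplxField R).
Implicit Types (w t x : K).

(* Truncation of w * prod' (1 - w / (m t + j)) to |m| <= N, |j| <= L, with the
   factors of opposite lattice points paired. *)
Definition box N L w t : K :=
  w * \prod_(j < L) (1 - w ^+ 2 / j.+1%:R ^+ 2) *
  \prod_(m < N) ((1 - w ^+ 2 / (m.+1%:R * t) ^+ 2) *
    \prod_(j < L) ((1 - w ^+ 2 / (m.+1%:R * t + j.+1%:R) ^+ 2) *
                   (1 - w ^+ 2 / (m.+1%:R * t - j.+1%:R) ^+ 2))).

(** Multiplication by t maps the lattice of -1/t to that of t with rows and columns exchanged up to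
    sign, so a square box is preserved; only the leading factor w produces 1/t. *)
Lemma box_inversion N w t : t != 0 -> box N N (w / t) (- t^-1) = box N N w t / t.
Proof.
move=> t0; have aux x : (w / t) ^+ 2 / x ^+ 2 = w ^+ 2 / (x * t) ^+ 2.
  by rewrite expr_div_n -mulrA -invfM -exprMn [t * x]mulrC.
rewrite /box !big_split /= [X in _ * (_ * X)]exchange_big /=.
under eq_bigr do rewrite aux.
under [X in _ * (X * _)]eq_bigr => m _ do rewrite aux mulrN mulNr mulfVK // sqrrN.
rewrite [X in _ * (_ * X)](_ : _ = \prod_(j < N) \prod_(i < N)
      ((1 - w ^+ 2 / (j.+1%:R * t + i.+1%:R) ^+ 2) *
       (1 - w ^+ 2 / (j.+1%:R * t - i.+1%:R) ^+ 2))).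
  by set A := \prod_(_ < _) _; set B := \prod_(_ < _) _; set C := \prod_(_ < _) _; ring.
apply: eq_bigr => j _; apply: eq_bigr => i _; rewrite !aux mulrC; congr ((1 - _ / _) * (1 - _ / _)).
  by rewrite mulrDl mulrN mulNr mulfVK // mulNr -opprD sqrrN addrC.
by rewrite mulrDl mulrN mulNr mulfVK // addrC.
Qed.

Lemma lattice_neq0 t (m n : int) : 0 < im t -> (m != 0) || (n != 0) ->
  m%:~R * t + n%:~R != 0.
Proof.
move=> t0 mn; apply/negP => /eqP h.
have : im (m%:~R * t + n%:~R) = 0 by rewrite h im0.
rewrite imD imM -(rmorph_int ofR) -(rmorph_int ofR n) !(im_ofR, re_ofR) mul0r !addr0.
move/eqP; rewrite mulf_eq0 (gt_eqF t0) orbF intr_eq0 => /eqP m0.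
by move: h mn; rewrite m0 mul0r add0r eqxx /= => /eqP; rewrite intr_eq0 => ->.
Qed.

Lemma row_neq0 t m (j : int) : 0 < im t -> m.+1%:R * t + j%:~R != 0.
Proof. by move=> t0; have := @lattice_neq0 t m.+1 j t0 isT. Qed.

(** Each factor is (y + w)(y - w) / y^2 with y = x or y = x + j or y = x - j. Regrouping these by x
    + w, x - w and x gives truncated sine products, whose limits in L are known. *)
Lemma box_row L w x : (forall n : int, x + n%:~R != 0) ->
  (1 - w ^+ 2 / x ^+ 2) *
    \prod_(j < L) ((1 - w ^+ 2 / (x + j.+1%:R) ^+ 2) * (1 - w ^+ 2 / (x - j.+1%:R) ^+ 2))
  = ((x + w) * \prod_(j < L) (1 - (x + w) ^+ 2 / j.+1%:R ^+ 2)) *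
    ((x - w) * \prod_(j < L) (1 - (x - w) ^+ 2 / j.+1%:R ^+ 2)) /
    (x * \prod_(j < L) (1 - x ^+ 2 / j.+1%:R ^+ 2)) ^+ 2.
Proof.
move=> hx; have x0 : x != 0 by have := hx 0; rewrite addr0.
have h1 j : x + j.+1%:R != 0 by exact: (hx j.+1).
have h2 j : x - j.+1%:R != 0 by have := hx (- j.+1%:Z); rewrite mulrNz.
rewrite (eq_bigr (fun j : 'I_L => (1 - (x + w) ^+ 2 / j.+1%:R ^+ 2) *
   (1 - (x - w) ^+ 2 / j.+1%:R ^+ 2) / ((1 - x ^+ 2 / j.+1%:R ^+ 2) * (1 - x ^+ 2 / j.+1%:R ^+ 2)))).
  rewrite !big_split /= prodfV big_split /=.
  set A := \prod_(_ < _) _; set B := \prod_(_ < _) _; set C := \prod_(_ < _) _.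
  have C0 : C != 0.
    apply/prodf_neq0 => j _; have j0 : (j.+1%:R : K) != 0 by rewrite pnatr_eq0.
    rewrite (_ : 1 - _ = - ((x + j.+1%:R) * (x - j.+1%:R)) / j.+1%:R ^+ 2); last by field.
    by rewrite mulf_neq0 ?oppr_eq0 ?invr_eq0 ?expf_neq0 ?mulf_neq0.
  by field; rewrite x0 C0.
move=> j _; have j0 : (j.+1%:R : K) != 0 by rewrite pnatr_eq0.
move: (h1 j) (h2 j) j0; move: (j.+1%:R : K) => y b0 a0 y0.
have c0 : y ^+ 2 - x ^+ 2 != 0 by rewrite subr_sqr -opprB mulNr oppr_eq0 mulf_neq0 // addrC.
rewrite (_ : 1 - x ^+ 2 / y ^+ 2 = (y ^+ 2 - x ^+ 2) / y ^+ 2); last by field.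
rewrite (_ : y ^+ 2 - x ^+ 2 = - ((x - y) * (x + y))) in c0 *; last by ring.
by field; rewrite y0 a0 b0.
Qed.

(** For N <= L, the lattice points, one from each opposite pair, that [box N L] has in addition to
    [box N N]. *)
Definition tail N L t : seq K :=
  [seq j.+1%:R | j <- index_iota N L] ++
  ([seq m.+1%:R * t + j.+1%:R | m <- index_iota 0 N, j <- index_iota N L] ++
   [seq m.+1%:R * t - j.+1%:R | m <- index_iota 0 N, j <- index_iota N L]).

Lemma box_split N L w t : (N <= L)%N ->
  box N L w t = box N N w t * \prod_(x <- tail N L t) (1 - w ^+ 2 / x ^+ 2).
Proof.
move=> NL; rewrite /tail !big_cat /= big_map !big_allpairs_dep /=.
rewrite !(big_mkord xpredT (fun m => \prod_(_ <- index_iota N L) _)).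
rewrite /box -!(big_mkord xpredT (fun j => 1 - w ^+ 2 / j.+1%:R ^+ 2)).
rewrite (big_cat_nat (n := N)) //=.
rewrite [X in _ * X = _](_ : _ = \prod_(m < N) ((1 - w ^+ 2 / (m.+1%:R * t) ^+ 2) *
    \prod_(j < N) ((1 - w ^+ 2 / (m.+1%:R * t + j.+1%:R) ^+ 2) *
                   (1 - w ^+ 2 / (m.+1%:R * t - j.+1%:R) ^+ 2))) *
   (\prod_(m < N) \prod_(N <= j < L) (1 - w ^+ 2 / (m.+1%:R * t + j.+1%:R) ^+ 2) *
    \prod_(m < N) \prod_(N <= j < L) (1 - w ^+ 2 / (m.+1%:R * t - j.+1%:R) ^+ 2))).
  by ring.
rewrite -!big_split /=; apply: eq_bigr => m _.
rewrite -(big_mkord xpredT (fun j => (1 - w ^+ 2 / (m.+1%:R * t + j.+1%:R) ^+ 2) *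
                   (1 - w ^+ 2 / (m.+1%:R * t - j.+1%:R) ^+ 2))).
rewrite (big_cat_nat (n := N)) //= big_mkord [in LHS]mulrA; congr (_ * _).
by rewrite big_split.
Qed.

(** The modulus is at least x im t and at least |y| - x |t|; the combination of the two with weights
    |t| and im t eliminates x and gives the value of d. *)
Lemma lattice_gap t : 0 < im t -> exists d : R, [/\ 0 < d, d <= 1 &
  forall x y : R, 0 <= x -> d * `|y| <= nm (ofR x * t + ofR y)].
Proof.
move=> t0; have T0 := nm_ge0 t; have i0 : 0 < im t + nm t by lra.
exists (im t / (im t + nm t)); split.
- by rewrite divr_gt0.
- by rewrite ler_pdivrMr // mul1r lerDl.
move=> x y x0; have h1 : x * im t <= nm (ofR x * t + ofR y).
  apply: le_trans (im_le_nm _); rewrite imD imM !(im_ofR, re_ofR) mul0r !addr0.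
  exact: ler_norm.
have h2 : `|y| - x * nm t <= nm (ofR x * t + ofR y).
  have := nmB (ofR x * t + ofR y) (ofR x * t); rewrite addrAC subrr add0r.
  by rewrite nmM !nm_ofR (ger0_norm x0); lra.
have y0 := normr_ge0 y; rewrite mulrAC ler_pdivrMr //.
by move: h1 h2; set v := nm (_ + _); set u := `|y| in y0 *; nra.
Qed.

Lemma tail_mem N L t d x : (forall x y : R, 0 <= x -> d * `|y| <= nm (ofR x * t + ofR y)) ->
  d <= 1 -> x \in tail N L t -> exists2 j, (N <= j)%N & d * j.+1%:R <= nm x.
Proof.
move=> hd d1; rewrite /tail !mem_cat => /or3P[/mapP[j]|/allpairsP[[m j] /= [_]]|/allpairsP[[m j] /= [_]]];
  rewrite mem_index_iota => /andP[Nj _] ->; exists j => //.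
- by rewrite nm_nat ler_piMl.
- by have := hd m.+1%:R j.+1%:R (ler0n _ _); rewrite !rmorph_nat normr_nat.
- have := hd m.+1%:R (- j.+1%:R) (ler0n _ _).
  by rewrite rmorphN !rmorph_nat normrN normr_nat.
Qed.

Lemma tail_sum_le N L t d (f : K -> R) (b : nat -> R) :
  (forall x y : R, 0 <= x -> d * `|y| <= nm (ofR x * t + ofR y)) -> d <= 1 ->
  (forall j x, (N <= j)%N -> d * j.+1%:R <= nm x -> f x <= b j) ->
  \sum_(x <- tail N L t) f x <= N.*2.+1%:R * \sum_(N <= j < L) b j.
Proof.
move=> hd d1 hf; rewrite /tail !big_cat /= big_map !big_allpairs_dep /=.
have inner (g : nat -> K) : (forall j, d * j.+1%:R <= nm (g j)) ->
    \sum_(N <= j < L) f (g j) <= \sum_(N <= j < L) b j.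
  by move=> hg; rewrite !big_nat; apply: ler_sum => j /andP[Nj _]; exact: hf.
set B := \sum_(N <= j < L) b j.
have outer (g : nat -> nat -> K) : (forall m j, d * j.+1%:R <= nm (g m j)) ->
    \sum_(0 <= m < N) \sum_(N <= j < L) f (g m j) <= N%:R * B.
  move=> hg; apply: (@le_trans _ _ (\sum_(0 <= m < N) B)).
    by apply: ler_sum => m _; exact: inner.
  by rewrite sumr_const_nat subn0 mulr_natl.
rewrite (_ : N.*2.+1%:R * B = B + (N%:R * B + N%:R * B)); last first.
  by rewrite -addnn -natr1 natrD; ring.
apply: lerD; first by apply: inner => j; rewrite nm_nat ler_piMl.
apply: lerD; apply: outer => m j.
  by have := hd m.+1%:R j.+1%:R (ler0n _ _); rewrite !rmorph_nat normr_nat.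
have := hd m.+1%:R (- j.+1%:R) (ler0n _ _).
by rewrite rmorphN !rmorph_nat normrN normr_nat.
Qed.

Lemma sum_inv_sq_tail N L : (0 < N)%N ->
  \sum_(N <= j < L) ((j.+1)%:R ^+ 2)^-1 <= N%:R^-1 :> R.
Proof.
move=> N0; case: (leqP L N) => [LN|/ltnW NL].
  by rewrite big_geq // invr_ge0 ler0n.
suff : \sum_(N <= j < L) ((j.+1)%:R ^+ 2)^-1 <= N%:R^-1 - L%:R^-1 :> R.
  by move/le_trans; apply; rewrite lerBlDr lerDl invr_ge0.
rewrite -(subnKC NL); elim: (L - N)%N => [|d IH]; first by rewrite addn0 big_geq // subrr.
rewrite addnS big_nat_recr ?leq_addr //=; apply: le_trans (lerD IH (lexx _)) _.
have a0 : (0 : R) < (N + d)%:R by rewrite ltr0n addn_gt0 N0.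
rewrite -natr1; move: a0; move: ((N + d)%:R : R) => a a0.
rewrite -subr_ge0 (_ : _ - _ = (a * (a + 1) ^+ 2)^-1).
  by rewrite invr_ge0 mulr_ge0 ?sqr_ge0 // ltW.
have aN : a != 0 by rewrite gt_eqF.
have a1 : a + 1 != 0 by rewrite gt_eqF //; lra.
have nN : (N%:R : R) != 0 by rewrite pnatr_eq0 -lt0n.
by field; rewrite ?aN ?a1 ?nN.
Qed.

(** Each (1 - F) exp(F) equals 1 + r with |r| <= 10 |F|^2, and the product of the 1 + r differs from
    1 by at most exp(sum |r|) - 1. *)
Lemma prod_exp_close (s : seq K) (F : K -> K) : (forall x, x \in s -> nm (F x) <= 1 / 2) ->
  nm (\prod_(x <- s) (1 - F x) * cx (\sum_(x <- s) F x) - 1)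
    <= expR (\sum_(x <- s) 10 * nm (F x) ^+ 2) - 1.
Proof.
elim: s => [|x s IH] hs; first by rewrite !big_nil cx0 mulr1 !subrr nm0 expR0 subrr.
have {}IH := IH (fun y ys => hs y (mem_behead (s := x :: s) ys)).
rewrite !big_cons cxD; move: IH.
set P := \prod_(_ <- _) _; set S := \sum_(_ <- _) _; set C := \sum_(_ <- _) _ => IH.
have x2 : nm (F x) <= 1 / 2 by apply: hs; rewrite mem_head.
have := cx_quad x2; have h1 := nm_ge0 (F x).
set r := (1 - F x) * cx (F x) - 1.
have rE : r = (1 - F x) * (cx (F x) - 1 - F x) - F x * F x by rewrite /r; ring.
have := nmB ((1 - F x) * (cx (F x) - 1 - F x)) (F x * F x); rewrite -rE !nmM.
have := nmB 1 (F x); rewrite nm1 => h2 h3 h4.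
have h5 := nm_ge0 (cx (F x) - 1 - F x).
have hr : nm r <= 10 * nm (F x) ^+ 2.
  apply: le_trans h3 _; rewrite expr2; apply: (@le_trans _ _ (3 / 2 * (6 * nm (F x) ^+ 2) + nm (F x) * nm (F x))).
    by rewrite lerD2r; apply: ler_pM => //; [exact: nm_ge0|lra].
  by rewrite expr2; nra.
have -> : (1 - F x) * P * (cx (F x) * cx S) - 1 = (P * cx S - 1) + r * (P * cx S - 1) + r.
  by rewrite /r; ring.
apply: le_trans (nmD _ _) _; have := nmD (P * cx S - 1) (r * (P * cx S - 1)).
rewrite nmM expRD => h6.
have h7 := expR_ge1Dx (10 * nm (F x) ^+ 2).
have h8 : 1 <= expR C.
  by apply: le_trans (expR_ge1Dx _); rewrite lerDl sumr_ge0 // => y _; rewrite mulr_ge0 // sqr_ge0.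
move: IH h6 hr h7; set p := nm (_ - 1); set e := expR C in h8 *; set q := expR _.
have := nm_ge0 r; set rr := nm r; set c := 10 * _ => *.
have : rr * p <= c * (e - 1) by apply: ler_pM => //; exact: nm_ge0.
by nra.
Qed.

(** The difference between Eisenstein's order and square boxes for the sum of inverse squares over
    half of the lattice. *)
Definition tail_sum (p : nat * nat) t : K := \sum_(x <- tail p.1 p.2 t) (x ^+ 2)^-1.

(** The 2 N + 1 rows are balanced by the tail 1 / N of the inverse squares: the sum is bounded, with
    no decay in N. *)
Lemma tail_sum_bounded t : 0 < im t ->
  exists B : R, \forall p \near iter_lim, nm (tail_sum p t) <= B.
Proof.
move=> t0; have [d [d0 d1 hd]] := lattice_gap t0.
exists (3 / d ^+ 2); exists 1%N => // N /= N0; apply: nearW => L.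
apply: le_trans (nm_sum _ _ _) _.
apply: le_trans (tail_sum_le L hd d1 (b := fun j => (d ^+ 2)^-1 * ((j.+1)%:R ^+ 2)^-1) _) _.
  move=> j x _ h; rewrite nmV nmX -invfM -exprMn.
  have q0 : 0 < d * j.+1%:R by rewrite mulr_gt0.
  rewrite lef_pV2 ?posrE ?exprn_gt0 //; last exact: lt_le_trans h.
  by rewrite ler_sqr ?nnegrE ?nm_ge0 // ltW.
rewrite -mulr_sumr mulrCA mulrC ler_wpM2r ?invr_ge0 ?exprn_ge0 ?(ltW d0) //.
apply: le_trans (ler_wpM2l (ler0n _ _) (sum_inv_sq_tail L N0)) _.
have n0 : (0 : R) < N%:R by rewrite ltr0n.
rewrite /= ler_pdivrMr // -natrM ler_nat -addnn; lia.
Qed.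

(** The error in [prod_exp_close] involves inverse fourth powers, bounded by j^-4 <= N^-2 j^-2; over
    2 N + 1 rows they sum to O(N^-2), so only the exponential of the inverse squares survives. The
    constant 60 collects 10, 2 N + 1 <= 3 N and N + 1 <= 2 N^2. *)
Lemma tail_prod_lim w t : 0 < im t ->
  (fun p => \prod_(x <- tail p.1 p.2 t) (1 - w ^+ 2 / x ^+ 2) * cx (w ^+ 2 * tail_sum p t))
    @ iter_lim --> (1 : K).
Proof.
move=> t0; have [d [d0 d1 hd]] := lattice_gap t0.
pose C := nm w ^+ 4 / d ^+ 4.
have C0 : 0 <= C by rewrite divr_ge0 ?exprn_ge0 ?nm_ge0 // ltW.
have harm : (fun n => C * 60 * (n.+1%:R)^-1) @ \oo --> (0 : R).
  by rewrite -[X in _ --> X](mulr0 (C * 60)); apply: cvgM; [exact: cvg_cst|exact: cvg_harmonic].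
apply: (cvg_nm_le (b := fun p => expR (C * 60 * (p.1.+1%:R)^-1) - 1)); last first.
  apply: (@cvg_iter_real R (fun n => expR (C * 60 * (n.+1%:R)^-1) - 1)).
  have h : (fun n => expR (C * 60 * (n.+1%:R)^-1)) @ \oo --> expR (0 : R).
    exact: (cvg_comp _ _ harm (@continuous_expR R 0)).
  have : (fun n => expR (C * 60 * (n.+1%:R)^-1) - 1) @ \oo --> expR (0 : R) - 1.
    by apply: cvgB => //; exact: cvg_cst.
  by rewrite expR0 subrr.
have small : \forall N \near \oo, nm w ^+ 2 / (d ^+ 2) * (N.+1%:R)^-1 <= 1 / 2.
  have h : (fun n => nm w ^+ 2 / (d ^+ 2) * (n.+1%:R)^-1) @ \oo --> (0 : R).
    by rewrite -[X in _ --> X](mulr0 (nm w ^+ 2 / (d ^+ 2))); apply: cvgM; [exact: cvg_cst|exact: cvg_harmonic].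
  move/cvgrPdist_lt: h => /(_ (1 / 2) ltac:(lra)); apply: filterS => n.
  rewrite sub0r normrN => h; apply: le_trans (ler_norm _) _; exact: ltW.
case: small => N1 _ hN1; exists (maxn 1 N1) => // N /=; rewrite geq_max => /andP[N0 NN1].
have sm := hN1 _ NN1; apply: nearW => L /=.
rewrite /tail_sum mulr_sumr; apply: le_trans (prod_exp_close _) _.
  move=> x /(tail_mem hd d1)[j Nj hj]; apply: le_trans sm.
  have q0 : 0 < d * j.+1%:R by rewrite mulr_gt0.
  rewrite nmM nmV !nmX -mulrA -invfM ler_wpM2l ?exprn_ge0 ?nm_ge0 // lef_pV2 ?posrE; last 2 first.
  - by rewrite exprn_gt0 //; exact: lt_le_trans hj.
  - by rewrite mulr_gt0 ?exprn_gt0.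
  have h2 : (d * j.+1%:R) ^+ 2 <= nm x ^+ 2 by rewrite ler_sqr ?nnegrE ?nm_ge0 // ltW.
  apply: le_trans h2; rewrite exprMn ler_wpM2l ?exprn_ge0 ?(ltW d0) //.
  by rewrite -natrX ler_nat expnS expn1; nia.
rewrite lerD2r ler_expR -mulr_sumr.
apply: (@le_trans _ _ (10 * (N.*2.+1%:R * \sum_(N <= j < L) (C / N%:R ^+ 2 * ((j.+1)%:R ^+ 2)^-1)))).
  rewrite ler_wpM2l //; apply: tail_sum_le hd d1 _ => j x Nj hj.
  have q0 : 0 < d * j.+1%:R by rewrite mulr_gt0.
  have n0 : (0 : R) < N%:R by rewrite ltr0n.
  rewrite nmM nmV !nmX.
  have h2 : (d * j.+1%:R) ^+ 4 <= nm x ^+ 4 by rewrite lerXn2r ?nnegrE ?nm_ge0 // ltW.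
  rewrite (_ : (_ / _) ^+ 2 = nm w ^+ 4 * (nm x ^+ 4)^-1); last first.
    by rewrite expr_div_n -!exprM.
  rewrite (_ : C / _ / _ = nm w ^+ 4 * (d ^+ 4 * (N%:R ^+ 2 * j.+1%:R ^+ 2))^-1); last first.
    by rewrite /C !invfM; ring.
  rewrite ler_wpM2l ?exprn_ge0 ?nm_ge0 // lef_pV2 ?posrE; last 2 first.
  - by rewrite exprn_gt0 //; exact: lt_le_trans hj.
  - by rewrite !mulr_gt0 ?exprn_gt0.
  apply: le_trans h2; rewrite exprMn ler_wpM2l ?exprn_ge0 ?(ltW d0) //.
  rewrite (_ : j.+1%:R ^+ 4 = j.+1%:R ^+ 2 * j.+1%:R ^+ 2); last by rewrite -exprD.
  rewrite mulrC ler_wpM2l ?exprn_ge0 // ler_sqr ?nnegrE // ler_nat; exact: leqW.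
rewrite -mulr_sumr.
have n0 : (0 : R) < N%:R by rewrite ltr0n.
have n1 : (0 : R) < N.+1%:R by rewrite ltr0n.
apply: (@le_trans _ _ (10 * (N.*2.+1%:R * (C / N%:R ^+ 2 * N%:R^-1)))).
  apply: ler_wpM2l => //; apply: ler_wpM2l => //.
  apply: ler_wpM2l; first by rewrite divr_ge0 // exprn_ge0.
  exact: (@sum_inv_sq_tail N L N0).
have e1 : (N.*2.+1%:R : R) <= 3 * N%:R by rewrite -natrM ler_nat -addnn; lia.
have e2 : (N.+1%:R : R) <= 2 * N%:R ^+ 2.
  rewrite -natrX -natrM ler_nat expnS expn1; nia.
rewrite ler_pdivlMr //.
rewrite (_ : 10 * _ * _ = (C * 10 / N%:R ^+ 3) * (N.*2.+1%:R * N.+1%:R)); last by field; rewrite gt_eqF.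
apply: (@le_trans _ _ ((C * 10 / N%:R ^+ 3) * ((3 * N%:R) * (2 * N%:R ^+ 2)))).
  by rewrite ler_wpM2l ?ler_pM // divr_ge0 ?exprn_ge0 // mulr_ge0.
by rewrite le_eqVlt; apply/orP; left; apply/eqP; field; rewrite gt_eqF.
Qed.

End Box.

(** * Inversion of the theta function *)

Section Inversion.
Variables (R : realType) (K : cplxField R).
Implicit Types (w t x : K).

Lemma cvgMI (f g : nat * nat -> K) (a b : K) : f @ iter_lim --> a -> g @ iter_lim --> b ->
  (fun p => f p * g p) @ iter_lim --> a * b.
Proof. by move=> h1 h2; apply: cvgM. Qed.

Lemma cvgVI (f : nat * nat -> K) (a : K) : a != 0 -> f @ iter_lim --> a ->
  (fun p => (f p)^-1) @ iter_lim --> a^-1.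
Proof. by move=> a0 h; apply: cvgV. Qed.

Definition eta0 t : K := poch (ee t) (ee t) ^+ 2.

Lemma eta0_neq0 t : 0 < im t -> eta0 t != 0.
Proof. by move=> t0; rewrite expf_neq0 // poch_neq0_lt1 // nm_ee_lt1. Qed.

Lemma upper_neq0 t : 0 < im t -> t != 0.
Proof. by move=> t0; apply/negP => /eqP h; move: t0; rewrite h im0 ltxx. Qed.

(** In Eisenstein's order every row tends to a quotient of sines; the exponential prefactors of a
    row cancel, and what remains is a quotient of factors of the q-products in [th] and [eta0]. *)
Lemma box_lim : exists2 c : K, c != 0 & forall w t, 0 < im t ->
  (fun p => box p.1 p.2 w t) @ iter_lim --> c * th w t / eta0 t.
Proof.
have [c c0 hc] := sine_product K; exists c => // w t t0.
have q1 := nm_ee_lt1 t0.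
have s0 m : ss (m.+1%:R * t) != 0.
  rewrite ss_ee mulf_neq0 ?ee_neq0 // subr_eq0 eq_sym; apply/negP => /eqP /ee_eq1 [n /eqP].
  rewrite -subr_eq0 -oppr_eq0 opprB opprK addrC; apply/negP; exact: row_neq0.
pose row m : K := ss (m.+1%:R * t + w) * ss (m.+1%:R * t - w) / ss (m.+1%:R * t) ^+ 2.
apply: (@cvg_iter R K (fun N L => box N L w t) (fun N => c * ss w * \prod_(m < N) row m)).
  move=> N; apply: cvgM; first exact: hc.
  apply: cvg_big => [|m _]; first exact: mul_continuous.
  under eq_fun do rewrite (box_row _ _ (@row_neq0 _ _ t m ^~ t0)).
  rewrite (_ : row m = c * ss (m.+1%:R * t + w) * (c * ss (m.+1%:R * t - w)) * ((c * ss (m.+1%:R * t)) ^+ 2)^-1).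
    apply: cvgM; first by apply: cvgM; exact: hc.
    apply: cvgV; first by rewrite expf_neq0 // mulf_neq0.
    by rewrite expr2; apply: cvgM; exact: hc.
  by rewrite /row; have := s0 m; move: (ss _) (ss _) (ss _) => z x y z0; field; rewrite ?c0 ?z0.
have rowE m : row m = (1 - ee (t + w) * ee t ^+ m) * (1 - ee (t - w) * ee t ^+ m) *
    ((1 - ee t * ee t ^+ m) ^+ 2)^-1.
  have mt : m.+1%:R * t = t + t *+ m by rewrite mulr_natl mulrS.
  rewrite -eeMn -!eeD (addrAC t w) (addrAC t (- w)) -mt /row !ss_ee !mulrDl !eeD.
  have s1 : 1 - ee (- (m.+1%:R * t)) != 0.
    by have := s0 m; rewrite ss_ee mulf_eq0 negb_or => /andP[].
  have e x : 1 - ee (- x) = - ee (- x) * (1 - ee x).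
    by rewrite mulrBr mulr1 mulNr -eeD addNr ee0; ring.
  have s2 : 1 - ee (m.+1%:R * t) != 0.
    by move: s1; rewrite e mulf_eq0 negb_or => /andP[].
  have -> : ee (- w / 2) = (ee (w / 2))^-1 by rewrite mulNr eeN.
  rewrite !e -!eeD !opprD !eeD opprK [ee (- w)]eeN [ee (- (m.+1%:R * t))]eeN.
  move: s2 (ee_neq0 (m.+1%:R * t)) (ee_neq0 (m.+1%:R * t / 2)) (ee_neq0 w) (ee_neq0 (w / 2)).
  move: (ee (m.+1%:R * t)) (ee (m.+1%:R * t / 2)) (ee w) (ee (w / 2)) => a b x y s2 a0 b0 x0 y0.
  by field; rewrite ?s2 ?a0 ?b0 ?x0 ?y0.
under eq_fun => N do under eq_bigr => m _ do rewrite rowE.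
under eq_fun => N do rewrite !big_split /= prodfV.
rewrite (_ : c * th w t / eta0 t = c * ss w * (poch (ee (t + w)) (ee t) * poch (ee (t - w)) (ee t) * (eta0 t)^-1)).
  apply: cvgM; first exact: cvg_cst.
  apply: cvgM; first by apply: cvgM; exact: cvg_poch.
  apply: cvgV; first exact: eta0_neq0.
  under eq_fun do rewrite big_split /=.
  by rewrite /eta0 expr2; apply: cvgM; exact: cvg_poch.
by rewrite th.unlock; ring.
Qed.

Lemma im_inv t : t != 0 -> im (- t^-1) = im t / nm t ^+ 2.
Proof.
move=> t0; have n0 : nm t ^+ 2 != 0 by rewrite expf_neq0 // nm_eq0.
have -> : - t^-1 = ofR (nm t ^+ 2)^-1 * (- ofR (re t) + imu * ofR (im t)).
  apply: (mulfI t0); rewrite mulrN divff // mulrCA.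
  have -> : t * (- ofR (re t) + imu * ofR (im t)) = - ofR (nm t ^+ 2).
    have gen (a b i : K) : i * i = -1 -> (a + i * b) * (- a + i * b) = - (a ^+ 2 + b ^+ 2).
      move=> h; transitivity (- a ^+ 2 + i * i * b ^+ 2); first by ring.
      by rewrite h; ring.
    by rewrite {1}[t]reimE nm_sqr rmorphD !rmorphXn; exact/gen/imu_sq.
  by rewrite mulrN -rmorphM mulVf // rmorph1.
by rewrite imM re_ofR im_ofR mul0r addr0 -rmorphN im_mk mulrC.
Qed.

Lemma im_inv_gt0 t : 0 < im t -> 0 < im (- t^-1).
Proof.
by move=> t0; rewrite im_inv ?upper_neq0 // divr_gt0 // exprn_gt0 // nm_gt0 upper_neq0.
Qed.

(** The square box of t completed by the tail of the inverted lattice belongs to -1/t.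
    Multiplication by exp(- w^2 kap) trades this tail for that of t, where kap is the tail sum of t
    minus t^-2 times that of -1/t. *)
Lemma th_box_compare : exists2 c : K, c != 0 & forall t, 0 < im t ->
  exists kap : nat * nat -> K, [/\ exists B : R, \forall p \near iter_lim, nm (kap p) <= B,
    forall w, (fun p => box p.1 p.1 w t * \prod_(x <- tail p.1 p.2 (- t^-1)) (1 - (w / t) ^+ 2 / x ^+ 2))
       @ iter_lim --> t * (c * th (w / t) (- t^-1) / eta0 (- t^-1)) &
    forall w, (fun p => box p.1 p.1 w t * \prod_(x <- tail p.1 p.2 (- t^-1)) (1 - (w / t) ^+ 2 / x ^+ 2)
       * cx (- (w ^+ 2 * kap p))) @ iter_lim --> c * th w t / eta0 t].
Proof.
have [c c0 hc] := box_lim; exists c => // t t0.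
have tn0 := upper_neq0 t0; have t0' := im_inv_gt0 t0.
exists (fun p => tail_sum p t - tail_sum p (- t^-1) / t ^+ 2).
have near_le : iter_lim (fun p => (p.1 <= p.2)%N).
  by exists 0%N => // N _; exists N.
have inv w : (fun p => box p.1 p.1 w t * \prod_(x <- tail p.1 p.2 (- t^-1)) (1 - (w / t) ^+ 2 / x ^+ 2))
       @ iter_lim --> t * (c * th (w / t) (- t^-1) / eta0 (- t^-1)).
  have : (fun p => t * box p.1 p.2 (w / t) (- t^-1)) @ iter_lim --> t * (c * th (w / t) (- t^-1) / eta0 (- t^-1)).
    by apply: cvgM; [exact: cvg_cst|exact: hc].
  apply: cvg_trans; apply: near_eq_cvg; apply: filterS near_le => p hp.
  by rewrite (box_split _ _ hp) box_inversion // mulrA mulrCA divff // mulr1.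
split=> //.
  have [B hB] := tail_sum_bounded t0; have [B' hB'] := tail_sum_bounded t0'.
  exists (B + B' / nm t ^+ 2); apply: filterS2 hB hB' => p h h'.
  apply: le_trans (nmB _ _) _; apply: lerD => //.
  by rewrite nmM nmV nmX ler_wpM2r // invr_ge0 exprn_ge0 // nm_ge0.
move=> w.
have T1 := tail_prod_lim w t0; have T2 := tail_prod_lim (w / t) t0'.
have T1' := cvgVI (oner_neq0 K) T1.
have : (fun p => box p.1 p.2 w t * (\prod_(x <- tail p.1 p.2 t) (1 - w ^+ 2 / x ^+ 2) * cx (w ^+ 2 * tail_sum p t))^-1
    * (\prod_(x <- tail p.1 p.2 (- t^-1)) (1 - (w / t) ^+ 2 / x ^+ 2) * cx ((w / t) ^+ 2 * tail_sum p (- t^-1))))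
    @ iter_lim --> c * th w t / eta0 t * 1^-1 * 1.
  exact: cvgMI (cvgMI (hc w t t0) T1') T2.
rewrite invr1 !mulr1; apply: cvg_trans; apply: near_eq_cvg.
have : \forall p \near iter_lim, \prod_(x <- tail p.1 p.2 t) (1 - w ^+ 2 / x ^+ 2) != 0.
  have /cvgnmP /(_ 1 ltr01) := T1; apply: filterS => p h; apply/negP => /eqP h0.
  by move: h; rewrite h0 mul0r sub0r nmN nm1 ltxx.
apply: filterS2 near_le => p hp nz /=.
have -> : - (w ^+ 2 * (tail_sum p t - tail_sum p (- t^-1) / t ^+ 2))
   = (w / t) ^+ 2 * tail_sum p (- t^-1) - w ^+ 2 * tail_sum p t by field.
rewrite (box_split _ _ hp) cxD cxN.
have := cx_neq0 (w ^+ 2 * tail_sum p t); move: nz.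
move: (\prod_(_ <- _) _) (cx _) (cx _) (\prod_(_ <- _) _) => a x y b a0 x0.
by field; rewrite ?a0 ?x0.
Qed.

Lemma scale_bound (x y : R) : 0 < x -> x * (24 * (y + 1)) = 1 -> x * y <= 1 / 12.
Proof. lra. Qed.

(** The functional equations at w0 and w0 + 1 only determine an exponential of the limit of [kap];
    boundedness of [kap] and a small multiplier u remove the ambiguity of the logarithm. *)
Theorem th_inversion t : 0 < im t -> exists C : K, forall w,
  th (w / t) (- t^-1) = C * ee (w ^+ 2 / (2 * t)) * th w t.
Proof.
move=> t0; have tn0 := upper_neq0 t0; have t0' := im_inv_gt0 t0.
have [c c0 /(_ t t0) [kap [[B hB] hinv hlim]]] := th_box_compare.
pose k0 : K := ofR pi * imu / t.
pose G w := c * th w t / eta0 t; pose G' w := t * (c * th (w / t) (- t^-1) / eta0 (- t^-1)).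
have e0 := eta0_neq0 t0; have e0' := eta0_neq0 t0'.
pose B' := `|B| + 1 + nm k0.
have B'0 : 0 < B' by rewrite /B'; have := nm_ge0 k0; have := normr_ge0 B; lra.
(* Eventually |k0 - kap| <= B', so u (k0 - kap) stays within 1/12, where [cx_sub1_ge] applies. *)
pose u : R := (24 * (B' + 1))^-1.
have u0 : 0 < u by rewrite invr_gt0 mulr_gt0 // addr_gt0.
have u1 : u < 1.
  by rewrite /u invf_lt1; lra.
(* Chosen so that w1 = w0 + 1 and w1^2 - w0^2 = u. Both are real of modulus strictly between 0 and
   1, hence outside the lattice, and the theta functions do not vanish there. *)
pose w0 : K := ofR ((u - 1) / 2); pose w1 : K := ofR ((u + 1) / 2).
have w1E : w1 = w0 + 1 by rewrite -(rmorph1 ofR) -rmorphD; apply: (congr1 ofR); field.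
have nonlat (v : R) : 0 < `|v| < 1 -> forall m n : int, (ofR v : K) != m%:~R * t + n%:~R.
  move=> /andP[v0 v1] m n; apply/negP => /eqP h.
  have := congr1 im h; rewrite imD imM -(rmorph_int ofR) -(rmorph_int ofR n) !(im_ofR, re_ofR) mul0r !addr0.
  move/esym/eqP; rewrite mulf_eq0 (gt_eqF t0) orbF intr_eq0 => /eqP m0.
  move: h; rewrite m0 mul0r add0r -(rmorph_int ofR) => /ofR_inj hv.
  move: v0 v1; rewrite hv -intr_norm ltr0z ltrz1; clear; lia.
have Gn0 v : 0 < `|v| < 1 -> G (ofR v) != 0.
  by move=> hv; rewrite /G !mulf_neq0 ?invr_eq0 // th_neq0 //; exact: nonlat.
have G'n0 v : 0 < `|v| < 1 -> G' (ofR v) != 0.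
  move=> hv; rewrite /G' !mulf_neq0 ?invr_eq0 // th_neq0 // => m n; apply/negP => /eqP h.
  move/negP: (nonlat v hv n (- m)); apply; apply/eqP.
  by rewrite -[ofR v](divfK tn0) h mulrNz mulrDl mulrN mulNr mulfVK //; ring.
have w0r : 0 < `|(u - 1) / 2| < 1 by rewrite normrM ltr0_norm ?gtr0_norm ?invr_gt0 //; lra.
have w1r : 0 < `|(u + 1) / 2| < 1 by rewrite normrM !gtr0_norm ?invr_gt0 //; lra.
have ratio w : G' w != 0 -> (fun p => cx (- (w ^+ 2 * kap p))) @ iter_lim --> G w / G' w.
  move=> g0; have h1 := hinv w; have h2 := hlim w.
  have := cvgMI h2 (cvgVI g0 h1); apply: cvg_trans; apply: near_eq_cvg.
  have /cvgnmP /(_ (nm (G' w))) := h1; rewrite nm_gt0 => /(_ g0).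
  apply: filterS => p; rewrite -/(G' w) /=; move: (box _ _ _ _ * _) => a ha.
  have a0 : a != 0 by apply/negP => /eqP a0; move: ha; rewrite a0 sub0r nmN ltxx.
  by rewrite /= mulrC mulKf.
have G1 : G w1 = - G w0 by rewrite /G w1E thD1; ring.
have G'1 : G' w1 = - ee ((2 * w0 + 1) / (2 * t)) * G' w0.
  rewrite /G' w1E (_ : (w0 + 1) / t = w0 / t - - t^-1); last by rewrite opprK mulrDl mul1r.
  rewrite thBt // (_ : w0 / t - - t^-1 / 2 = (2 * w0 + 1) / (2 * t)); last by field.
  by ring.
have k0E : ee ((2 * w0 + 1) / (2 * t)) = cx (k0 * ofR u).
  rewrite /ee; congr cx; rewrite /k0 rmorphM rmorph_nat /w0 fmorph_div rmorphB rmorph1 rmorph_nat; field.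
  by rewrite tn0.
(* Adding 1 to w changes the sign of th(w, t), while w / t moves by the quasi-period of th(., -1/t).
   The quotient of these two multipliers is exp(- u k0), the limit of exp(- u kap). *)
have lim1 : (fun p => cx (ofR u * (k0 - kap p))) @ iter_lim --> (1 : K).
  have g0 := G'n0 _ w0r; have g1 := G'n0 _ w1r; have f0 := Gn0 _ w0r.
  have f0i : (G w0 / G' w0) != 0 by rewrite mulf_neq0 ?invr_eq0.
  have one : G w1 / G' w1 * (G w0 / G' w0)^-1 * cx (k0 * ofR u) = 1.
    rewrite G1 G'1 k0E; have := cx_neq0 (k0 * ofR u); move: g0 f0.
    move: (G w0) (G' w0) (cx _) => a b x b0 a0 x0; field.
    by rewrite ?a0 ?b0 ?x0.
  have lim0 : (fun p => cx (- (w1 ^+ 2 * kap p)) * (cx (- (w0 ^+ 2 * kap p)))^-1 * cx (k0 * ofR u))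
      @ iter_lim --> (1 : K).
    rewrite -one; apply: cvgMI; last exact: cvg_cst.
    by apply: cvgMI; [exact: ratio|apply: cvgVI => //; exact: ratio].
  apply: cvg_trans lim0; apply: near_eq_cvg; apply: nearW => p.
  rewrite /= -cxN -!cxD; congr cx.
  rewrite w1E (_ : ofR u = 2 * w0 + 1); first by ring.
  by rewrite /w0 fmorph_div rmorphB rmorph1 rmorph_nat; field.
have kap_lim : kap @ iter_lim --> k0.
  apply: (cvg_nm_le (b := fun p => 2 / u * nm (cx (ofR u * (k0 - kap p)) - 1))); last first.
    rewrite -[X in _ --> X](mulr0 (2 / u)); apply: cvgM; first exact: cvg_cst.
    by apply/cvg_nm0; exact: lim1.
  apply: filterS hB => p hp.
  have hd : nm (k0 - kap p) <= B'.
    apply: le_trans (nmB _ _) _; rewrite /B'; have := ler_norm B; lra.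
  have hs : nm (ofR u * (k0 - kap p)) <= 1 / 12.
    rewrite nmM nm_ofR gtr0_norm //; apply: le_trans (ler_wpM2l (ltW u0) hd) _.
    have : u * (24 * (B' + 1)) = 1 by rewrite mulVf // gt_eqF // mulr_gt0 // addr_gt0.
    exact: scale_bound.
  have := cx_sub1_ge hs; rewrite nmM nm_ofR gtr0_norm // nmBC.
  by move=> h; rewrite mulrAC ler_pdivlMr //; lra.
exists (eta0 (- t^-1) / (t * eta0 t)) => w.
have l1 := hinv w.
have l2 : (fun p => box p.1 p.1 w t * \prod_(x <- tail p.1 p.2 (- t^-1)) (1 - (w / t) ^+ 2 / x ^+ 2))
   @ iter_lim --> G w * cx (w ^+ 2 * k0).
  have h : (fun p => cx (w ^+ 2 * kap p)) @ iter_lim --> cx (w ^+ 2 * k0).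
    by apply: cvg_cx; apply: cvgM => //; exact: cvg_cst.
  have := cvgMI (hlim w) h; apply: cvg_trans; apply: near_eq_cvg; apply: nearW => p /=.
  by rewrite -mulrA -cxD addNr cx0 mulr1.
have := cvgC_unique l1 l2; rewrite /G.
have -> : cx (w ^+ 2 * k0) = ee (w ^+ 2 / (2 * t)).
  by rewrite /ee /k0 rmorphM rmorph_nat; congr cx; field; rewrite tn0.
move: (th (w / t) _) (th w t) (ee _) e0 e0' => a b x e0 e0' h.
have tc : t * c / eta0 (- t^-1) != 0 by rewrite !mulf_neq0 ?invr_eq0.
apply: (mulfI tc); transitivity (t * (c * a / eta0 (- t^-1))); first by ring.
by rewrite h; field; rewrite ?e0 ?e0' ?tn0.
Qed.

End Inversion.

(** * Dissections of q-products *)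

Section PochhammerProducts.
Variables (R : realType) (K : cplxField R).
Implicit Types (a q w t : K).

Lemma cvg_subseq (f : nat -> K) (l : K) (k : nat) : (0 < k)%N ->
  f @ \oo --> l -> (fun n => f (n * k)%N) @ \oo --> l.
Proof.
move=> k0 /cvgnmP h; apply/cvgnmP => e /h [N _ hN]; exists N => // n /= Nn.
by apply: hN; rewrite /=; apply: leq_trans Nn _; rewrite leq_pmulr.
Qed.

Lemma cvgMn (f g : nat -> K) (a b : K) : f @ \oo --> a -> g @ \oo --> b ->
  (fun n => f n * g n) @ \oo --> a * b.
Proof. by move=> h1 h2; apply: cvgM. Qed.

Lemma nmX_lt1 q k : (0 < k)%N -> nm q < 1 -> nm (q ^+ k) < 1.
Proof. by move=> k0 q1; rewrite nmX exprn_ilt1 ?nm_ge0 // -lt0n. Qed.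

Lemma poch_dissect a q k : (0 < k)%N -> nm q < 1 ->
  poch a q = \prod_(i < k) poch (a * q ^+ i) (q ^+ k).
Proof.
move=> k0 q1.
have h1 := cvg_subseq k0 (@cvg_poch R K a q q1).
have h2 : (fun n => \prod_(i < k) \prod_(m < n) (1 - a * q ^+ i * (q ^+ k) ^+ m)) @ \oo
    --> \prod_(i < k) poch (a * q ^+ i) (q ^+ k).
  apply: cvg_big => [|i _]; first exact: mul_continuous.
  by apply: cvg_poch; exact: nmX_lt1.
apply: cvgC_unique h1 _; apply: cvg_trans h2; apply: near_eq_cvg; apply: nearW => n.
rewrite exchange_big /= -(big_mkord xpredT (fun j => 1 - a * q ^+ j)) big_nat_mul big_mkord.
apply: eq_bigr => m _; rewrite -[X in \prod_(X <= _ < _) _]add0n big_addn mulSn addnK big_mkord.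
by apply: eq_bigr => i _; rewrite -exprM -mulrA -exprD mulnC.
Qed.

Lemma poch_mulN a q : nm q < 1 -> poch a q * poch (- a) q = poch (a ^+ 2) (q ^+ 2).
Proof.
move=> q1; have h1 := @cvg_poch R K (a ^+ 2) (q ^+ 2) (nmX_lt1 (isT : (0 < 2)%N) q1).
have h2 := cvgMn (@cvg_poch R K a q q1) (@cvg_poch R K (- a) q q1).
apply: cvgC_unique h2 _; apply: cvg_trans h1; apply: near_eq_cvg; apply: nearW => n /=.
by rewrite -big_split /=; apply: eq_bigr => i _; rewrite -exprM mulnC exprM; ring.
Qed.

Lemma poch_cube a q w : w ^+ 2 + w + 1 = 0 -> nm q < 1 ->
  poch a q * poch (a * w) q * poch (a * w ^+ 2) q = poch (a ^+ 3) (q ^+ 3).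
Proof.
move=> hw q1; have h1 := @cvg_poch R K (a ^+ 3) (q ^+ 3) (nmX_lt1 (isT : (0 < 3)%N) q1).
have h2 := cvgMn (cvgMn (@cvg_poch R K a q q1) (@cvg_poch R K (a * w) q q1)) (@cvg_poch R K (a * w ^+ 2) q q1).
apply: cvgC_unique h2 _; apply: cvg_trans h1; apply: near_eq_cvg; apply: nearW => n /=.
rewrite -!big_split /=; apply: eq_bigr => i _; rewrite -exprM mulnC exprM.
move: (q ^+ i) => x; have w2 : w ^+ 2 = - w - 1 by apply/eqP; rewrite -subr_eq0 -hw; apply/eqP; ring.
have w3 : w ^+ 3 = 1 by rewrite exprS w2 mulrBr mulrN -expr2 w2; ring.
transitivity (1 - a * x * (w ^+ 2 + w + 1) + (a * x) ^+ 2 * w * (w ^+ 2 + w + 1) - (a * x) ^+ 3 * w ^+ 3).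
  by rewrite hw w3; ring.
by ring.
Qed.

End PochhammerProducts.

(** * Siegel functions *)
(* The Siegel function of index (a, b) up to a constant factor, which is chosen
   so that SL_2(Z) acts through the index up to a multiplier free of (a, b). *)
HB.lock Definition gs {R : realType} {K : cplxField R} (a b t : K) : K :=
  ee (a * (a * t + b) / 2 + t / 12) * th (a * t + b) t.

Section Siegel.
Variables (R : realType) (K : cplxField R).
Implicit Types (a b q w t x y : K).

Lemma gs_T a b t : gs a b (t + 1) = ee (1 / 12) * gs a (a + b) t.
Proof.
rewrite gs.unlock (_ : a * (t + 1) + b = a * t + (a + b)); last by ring.
rewrite mulrA -eeD th.unlock !(addrAC t 1) !(eeD _ 1) ee1 !mulr1.
by congr (ee _ * _); field.
Qed.

Lemma gsN a b t : gs (- a) (- b) t = - gs a b t.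
Proof.
rewrite gs.unlock (_ : - a * t + - b = - (a * t + b)); last by ring.
by rewrite thN mulrN; congr (- (ee _ * _)); field.
Qed.

Lemma gs_shift2 a b t : gs a (b + 1) t = - ee (a / 2) * gs a b t.
Proof.
by rewrite gs.unlock addrA thD1 mulrN mulNr mulrA -eeD; congr (- (ee _ * _)); field.
Qed.

Lemma gs_shift1 a b t : 0 < im t -> gs (a + 1) b t = - ee (- (b / 2)) * gs a b t.
Proof.
move=> t0; rewrite gs.unlock (_ : (a + 1) * t + b = (a * t + b) + t); last by ring.
by rewrite thDt // !mulNr mulrN !mulrA -!eeD; congr (- (ee _ * _)); field.
Qed.

Lemma gs_prod a b t : 0 < im t -> gs a b t =
  - ee (a * (a * t + b) / 2 + t / 12 - (a * t + b) / 2) *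
  (poch (ee (a * t + b)) (ee t) * poch (ee (t - (a * t + b))) (ee t)).
Proof.
move=> t0; rewrite gs.unlock th.unlock ssE (poch_rec (ee (a * t + b))) ?nm_ee_lt1 //.
rewrite -(eeD _ t) (addrC _ t) (eeD _ (- ((a * t + b) / 2))); ring.
Qed.

(* The constant depends on t but not on (a, b): products over the 2- and
   3-torsion points then give its cube and its fourth power. *)
Lemma gs_S_raw t : 0 < im t -> exists C : K, forall a b,
  gs a b (- t^-1) = C * gs b (- a) t.
Proof.
move=> t0; have tn0 := upper_neq0 t0; have [C hC] := th_inversion t0.
exists (C * ee (- t^-1 / 12 - t / 12)) => a b; rewrite gs.unlock.
rewrite (_ : a * - t^-1 + b = (b * t - a) / t); last by field.
rewrite hC !mulrA -[_ * C]mulrC -!mulrA; congr (C * _); rewrite !mulrA -!eeD.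
by congr (ee _ * _); field; rewrite tn0.
Qed.

(** With h = q^(1/2) the product reduces to the square of (h;q)(-h;q)(-q;q) = (q;q^2)(-q;q), which
    is 1 by Euler's identity. The factor 2 comes from 1 - e(1/2) at the index (0, 1/2). *)
Lemma gs_two_torsion t : 0 < im t ->
  gs (1 / 2) 0 t * gs 0 (1 / 2) t * gs (1 / 2) (1 / 2) t = 2 * imu * ee (- (1 / 8)).
Proof.
move=> t0; have q1 := nm_ee_lt1 t0; rewrite !gs_prod //.
set q := ee t in q1 *; pose h := ee (t / 2).
have hh : h ^+ 2 = q by rewrite /h /q -eeMn; congr ee; rewrite mulr2n; field.
have eN x : ee (x + 1 / 2) = - ee x by rewrite eeD ee_half mulrN1.
have eN' x : ee (x - 1 / 2) = - ee x by rewrite eeB ee_half invrN1 mulrN1.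
have -> : ee (1 / 2 * t + 0) = h by rewrite /h; congr ee; field.
have -> : ee (t - (1 / 2 * t + 0)) = h by rewrite /h; congr ee; field.
have -> : ee (0 * t + 1 / 2) = -1 by rewrite mul0r add0r ee_half.
have -> : ee (t - (0 * t + 1 / 2)) = - q by rewrite mul0r add0r eN'.
have -> : ee (1 / 2 * t + 1 / 2) = - h by rewrite eN /h; congr (- ee _); field.
have -> : ee (t - (1 / 2 * t + 1 / 2)) = - h.
  by rewrite (_ : t - _ = t / 2 - 1 / 2) ?eN' //; field.
have p1 := poch_mulN h q1; rewrite hh in p1.
have p2 := poch_mulN q q1.
have p3 := poch_dissect q (isT : (0 < 2)%N) q1.
rewrite !big_ord_recl big_ord0 /= expr0 expr1 !mulr1 -expr2 in p3.
have e1 : poch q q != 0 by exact: poch_neq0_lt1.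
have e2 : poch (q ^+ 2) (q ^+ 2) != 0.
  by apply: poch_neq0_lt1; apply: nmX_lt1.
have E : poch h q * poch (- h) q * poch (- q) q = 1.
  apply: (mulfI (mulf_neq0 e1 e2)); rewrite p1 mulr1.
  by rewrite [in RHS]p3 -p2; ring.
rewrite (poch_rec (-1) q1) mulN1r.
set c1 := ee _; set c2 := ee _; set c3 := ee _.
have -> : c2 = ee (t / 12) * ee (- (1 / 4)) by rewrite /c2 -eeD; congr ee; field.
have c13 : c1 * c3 * ee (t / 12) = ee (- (1 / 8)).
  by rewrite /c1 /c3 -!eeD; congr ee; field.
have i4 : ee (- (1 / 4)) = - imu :> K.
  have i0 : (imu : K) != 0 by rewrite -nm_eq0 nm_imu oner_eq0.
  by rewrite eeN ee_quarter; apply: (mulfI i0); rewrite divff // mulrN imu_sq opprK.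
rewrite i4 -c13; transitivity (2 * imu * (c1 * c3 * ee (t / 12)) * (poch h q * poch (- h) q * poch (- q) q) ^+ 2).
  by ring.
by rewrite E expr1n mulr1.
Qed.

Definition omega : K := ee (1 / 3).

Lemma omega_neq1 : omega != 1.
Proof.
apply/negP => /eqP /ee_eq1 [n h].
have : (n * 3)%:~R = 1 :> K by rewrite intrM -h divfK // pnatr_eq0.
rewrite -[RHS]/(1%:~R) => /intr_inj; clear; lia.
Qed.

Lemma omega_eq : omega ^+ 2 + omega + 1 = 0.
Proof.
have h : (omega - 1) * (omega ^+ 2 + omega + 1) = 0.
  have : omega ^+ 3 = 1 by rewrite /omega -eeMn -[_ *+ 3]mulr_natr divfK ?ee1 // pnatr_eq0.
  by move=> w3; rewrite (_ : _ * _ = omega ^+ 3 - 1); [rewrite w3 subrr|ring].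
by move/eqP: h; rewrite mulf_eq0 subr_eq0 (negbTE omega_neq1) => /eqP.
Qed.

(** One index for each of the four pairs of opposite nonzero points. The cube identity for omega
    collects the three indices with first entry 1/3 into (q;q^3)(q^2;q^3), which cancels against the
    index (0, 1/3). *)
Lemma gs_three_torsion t : 0 < im t ->
  gs 0 (1 / 3) t * gs (1 / 3) 0 t * gs (1 / 3) (1 / 3) t * gs (1 / 3) (2 / 3) t
    = ee (- (1 / 2)) * (1 - omega).
Proof.
move=> t0; have q1 := nm_ee_lt1 t0; rewrite !gs_prod //.
set q := ee t in q1 *; pose h := ee (t / 3).
have hh : h ^+ 3 = q by rewrite /h /q -eeMn; congr ee; rewrite -mulr_natr; field.
have w3 : omega ^+ 3 = 1 by rewrite /omega -eeMn -[_ *+ 3]mulr_natr divfK ?ee1 // pnatr_eq0.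
have wV : ee (- (1 / 3)) = omega ^+ 2.
  have w0 : omega != 0 by exact: ee_neq0.
  by apply: (mulfI w0); rewrite -exprS w3 /omega -eeD subrr ee0.
have w2 : ee (2 / 3) = omega ^+ 2 by rewrite /omega -eeMn; congr ee; rewrite -mulr_natr; field.
have h2 : ee (2 * t / 3) = h ^+ 2 by rewrite /h -eeMn; congr ee; rewrite -mulr_natr; field.
have -> : ee (0 * t + 1 / 3) = omega by rewrite mul0r add0r.
have -> : ee (t - (0 * t + 1 / 3)) = q * omega ^+ 2 by rewrite mul0r add0r eeD wV.
have -> : ee (1 / 3 * t + 0) = h by rewrite /h; congr ee; field.
have -> : ee (t - (1 / 3 * t + 0)) = h ^+ 2 by rewrite -h2; congr ee; field.
have -> : ee (1 / 3 * t + 1 / 3) = h * omega by rewrite /h /omega -eeD; congr ee; field.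
have -> : ee (t - (1 / 3 * t + 1 / 3)) = h ^+ 2 * omega ^+ 2 by rewrite -h2 -wV -eeD; congr ee; field.
have -> : ee (1 / 3 * t + 2 / 3) = h * omega ^+ 2 by rewrite /h -w2 -eeD; congr ee; field.
have -> : ee (t - (1 / 3 * t + 2 / 3)) = h ^+ 2 * omega.
  by rewrite (_ : t - _ = 2 * t / 3 + 1 / 3 - 1); [rewrite eeB ee1 divr1 eeD h2|field].
have p1 := poch_cube h omega_eq q1; rewrite hh in p1.
have p2 := poch_cube (h ^+ 2) omega_eq q1; rewrite -exprM mulnC exprM hh in p2.
have p3 := poch_cube q omega_eq q1.
have p4 := poch_dissect q (isT : (0 < 3)%N) q1.
rewrite !big_ord_recl big_ord0 /= /bump /= expr0 !mulr1 -expr2 -exprS in p4.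
have e1 : poch q q != 0 by exact: poch_neq0_lt1.
have e2 : poch (q ^+ 3) (q ^+ 3) != 0 by apply: poch_neq0_lt1; apply: nmX_lt1.
have E : poch (q * omega) q * poch (q * omega ^+ 2) q * poch q (q ^+ 3) * poch (q ^+ 2) (q ^+ 3) = 1.
  apply: (mulfI (mulf_neq0 e1 e2)); rewrite mulr1 [X in _ = X * _]p4 -p3; ring.
rewrite (poch_rec omega q1) (mulrC omega q).
set c1 := ee _; set c2 := ee _; set c3 := ee _; set c4 := ee _.
have c13 : c1 * c2 * c3 * c4 = ee (- (1 / 2)).
  by rewrite /c1 /c2 /c3 /c4 -!eeD; congr ee; field.
rewrite -c13; transitivity (c1 * c2 * c3 * c4 * (1 - omega) *
   (poch (q * omega) q * poch (q * omega ^+ 2) q *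
    (poch h q * poch (h * omega) q * poch (h * omega ^+ 2) q) *
    (poch (h ^+ 2) q * poch (h ^+ 2 * omega) q * poch (h ^+ 2 * omega ^+ 2) q))).
  by ring.
by rewrite p1 p2 E mulr1.
Qed.

(** The inversion permutes the 2-torsion and the 3-torsion indices up to signs and integer shifts,
    whose multipliers are explicit. This gives C^3 = i and C^4 = 1, and the coprime exponents leave
    C = 1 / i. *)
Theorem gs_S a b t : 0 < im t -> gs a b (- t^-1) = ee (- (1 / 4)) * gs b (- a) t.
Proof.
move=> t0; have t0' := im_inv_gt0 t0; have [C hC] := gs_S_raw t0; rewrite hC.
suff -> : C = ee (- (1 / 4)) by [].
have i0 : (imu : K) != 0 by rewrite -nm_eq0 nm_imu oner_eq0.
have i4 : ee (- (1 / 4)) = imu^-1 :> K by rewrite eeN ee_quarter.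
have C3 : C ^+ 3 = imu.
  have := gs_two_torsion t0'; rewrite !hC -(gs_two_torsion t0).
  have -> : gs 0 (- (1 / 2)) t = - gs 0 (1 / 2) t by rewrite -{1}oppr0 gsN.
  rewrite oppr0; have -> : gs (1 / 2) (- (1 / 2)) t = imu * gs (1 / 2) (1 / 2) t.
    have := gs_shift2 (1 / 2) (- (1 / 2)) t.
    rewrite (_ : - (1 / 2) + 1 = 1 / 2); last by field.
    rewrite (_ : 1 / 2 / 2 = 1 / 4); last by field.
    by rewrite ee_quarter => ->; rewrite mulNr mulrN mulrA imu_sq; ring.
  have := gs_two_torsion t0; have n0 : 2 * imu * ee (- (1 / 8)) != 0 :> K.
    by rewrite !mulf_neq0 ?ee_neq0 // pnatr_eq0.
  move: (gs _ _ t) (gs _ _ t) (gs _ _ t) n0 => x y z n0 hn; rewrite -hn in n0.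
  move=> h; apply: (mulfI n0); rewrite -[in RHS]h.
  transitivity (- (imu * imu) * (z * y * x * C ^+ 3)); last by ring.
  by rewrite imu_sq; ring.
have C4 : C ^+ 4 = 1.
  have := gs_three_torsion t0'; rewrite !hC -(gs_three_torsion t0).
  have -> : gs (1 / 3) (- 0) t = gs (1 / 3) 0 t by rewrite oppr0.
  have -> : gs 0 (- (1 / 3)) t = - gs 0 (1 / 3) t by rewrite -{1}oppr0 gsN.
  have e0 := ee_neq0 (1 / 6 : K).
  have -> : gs (1 / 3) (- (1 / 3)) t = - (ee (1 / 6))^-1 * gs (1 / 3) (2 / 3) t.
    have := gs_shift2 (1 / 3) (- (1 / 3)) t.
    rewrite (_ : - (1 / 3) + 1 = 2 / 3); last by field.
    rewrite (_ : 1 / 3 / 2 = 1 / 6); last by field.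
    by move=> ->; field.
  have -> : gs (2 / 3) (- (1 / 3)) t = ee (1 / 6) * gs (1 / 3) (1 / 3) t.
    have := @gs_shift1 (- (2 / 3)) (1 / 3) t t0.
    rewrite (_ : - (2 / 3) + 1 = 1 / 3); last by field.
    rewrite (_ : - (1 / 3 / 2) = - (1 / 6)); last by field.
    by rewrite -[2 / 3]opprK gsN opprK eeN => ->; field.
  have := gs_three_torsion t0; have n0 : ee (- (1 / 2)) * (1 - omega) != 0 :> K.
    by rewrite mulf_neq0 ?ee_neq0 // subr_eq0 eq_sym omega_neq1.
  move: (gs _ _ t) (gs _ _ t) (gs _ _ t) (gs _ _ t) n0 => x y z v n0 hn; rewrite -hn in n0.
  by move=> h; apply: (mulfI n0); rewrite mulr1 -[in RHS]h; field.
apply: (mulIf i0); rewrite i4 mulVf // -C3 -exprS; exact: C4.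
Qed.

End Siegel.

(** * The action of the modular group and its multiplier *)

Section ModularGroup.
Variables (R : realType) (K : cplxField R).
Implicit Types (t x y : K) (a b c d k : int).

(** Residues are kept as naturals, so that the relations for the multiplier become finite
    computations; negation is multiplication by m - 1. *)
Definition res (m : nat) a : nat := `|(a %% m)%Z|%N.

Lemma res_lt m a : (0 < m)%N -> (res m a < m)%N.
Proof.
move=> m0; rewrite -ltz_nat gez0_abs ?modz_ge0 ?ltz_pmod //; last by rewrite -lt0n.
Qed.

Lemma resD m a b : (0 < m)%N -> res m (a + b) = ((res m a + res m b) %% m)%N.
Proof.
move=> m0; have mz : (m%:Z != 0) by rewrite -lt0n.
apply/eqP; rewrite -eqz_nat -modz_nat PoszD !gez0_abs ?modz_ge0 // modzDm.
by rewrite eqxx.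
Qed.

Lemma resM m a b : (0 < m)%N -> res m (a * b) = ((res m a * res m b) %% m)%N.
Proof.
move=> m0; have mz : (m%:Z != 0) by rewrite -lt0n.
apply/eqP; rewrite -eqz_nat -modz_nat PoszM !gez0_abs ?modz_ge0 // modzMm.
by rewrite eqxx.
Qed.

Lemma resN m a : (0 < m)%N -> res m (- a) = ((m.-1 * res m a) %% m)%N.
Proof.
move=> m0; rewrite {1}(_ : - a = (- a) * m%:Z + m.-1%:Z * a); last first.
  by rewrite -[X in _ * X%:Z](prednK m0) -addn1 PoszD; ring.
rewrite /res modzMDl -/(res m _) resM //; congr ((_ * _) %% _)%N.
by rewrite /res modz_small // ltz_nat prednK ?leqnn.
Qed.

Lemma res_det m a b c d : (1 < m)%N -> a * d - b * c = 1 ->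
  ((res m a * res m d + m.-1 * (res m b * res m c)) %% m)%N = 1%N.
Proof.
move=> m1 h; have m0 := ltnW m1.
have : res m (a * d - b * c) = 1%N by rewrite h /res modz_small.
by rewrite resD // resN // !resM // modnMmr modnDmr modnDml.
Qed.

(* The multiplier is e(psi / 12) with psi = (1 - c^2) (b d + 3 (c - 1) d + c + 3)
   + c (a + d - 3); as 1/12 = 1/3 - 1/4, it is given by u3 = psi mod 3 and
   v4 = - psi mod 4, and its cocycle relation is a finite check. *)
Definition u3 (a b c d : nat) : nat :=
  (((1 + 2 * c * c) * (b * d + c) + c * (a + d)) %% 3)%N.

Definition v4 (a b c d : nat) : nat :=
  ((3 * ((1 + 3 * c * c) * (b * d + 3 * (c + 3) * d + c + 3) + c * (a + d + 1))) %% 4)%N.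

Lemma all4P (n : nat) (P : nat -> nat -> nat -> nat -> bool) :
  all (fun a : nat => all (fun b : nat => all (fun c : nat => all (P a b c) (iota 0 n)) (iota 0 n)) (iota 0 n)) (iota 0 n) ->
  forall a b c d : nat, (a < n)%N -> (b < n)%N -> (c < n)%N -> (d < n)%N -> P a b c d.
Proof.
move=> h a b c d ha hb hc hd; move/allP: h => /(_ a); rewrite mem_iota => /(_ ha).
move/allP => /(_ b); rewrite mem_iota => /(_ hb).
move/allP => /(_ c); rewrite mem_iota => /(_ hc).
by move/allP => /(_ d); rewrite mem_iota => /(_ hd).
Qed.

Lemma u3_TS (a b c d : nat) : (a < 3)%N -> (b < 3)%N -> (c < 3)%N -> (d < 3)%N ->
  ((a * d + 2 * (b * c)) %% 3 = 1)%N ->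
  u3 a ((a + b) %% 3) c ((c + d) %% 3) = ((u3 a b c d + 1) %% 3)%N /\
  u3 b ((2 * a) %% 3) d ((2 * c) %% 3) = u3 a b c d.
Proof.
move=> ha hb hc hd /eqP; pose P (a b c d : nat) :=
  ((a * d + 2 * (b * c)) %% 3 == 1)%N ==>
  (u3 a ((a + b) %% 3) c ((c + d) %% 3) == ((u3 a b c d + 1) %% 3)%N) &&
  (u3 b ((2 * a) %% 3) d ((2 * c) %% 3) == u3 a b c d).
have := @all4P 3 P (ltac:(by vm_compute)) a b c d ha hb hc hd.
by move/implyP => h /h /andP[/eqP -> /eqP ->].
Qed.

Lemma v4_TS (a b c d : nat) : (a < 4)%N -> (b < 4)%N -> (c < 4)%N -> (d < 4)%N ->
  ((a * d + 3 * (b * c)) %% 4 = 1)%N ->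
  v4 a ((a + b) %% 4) c ((c + d) %% 4) = ((v4 a b c d + 3) %% 4)%N /\
  v4 b ((3 * a) %% 4) d ((3 * c) %% 4) = ((v4 a b c d + 3) %% 4)%N.
Proof.
move=> ha hb hc hd /eqP; pose P (a b c d : nat) :=
  ((a * d + 3 * (b * c)) %% 4 == 1)%N ==>
  (v4 a ((a + b) %% 4) c ((c + d) %% 4) == ((v4 a b c d + 3) %% 4)%N) &&
  (v4 b ((3 * a) %% 4) d ((3 * c) %% 4) == ((v4 a b c d + 3) %% 4)%N).
have := @all4P 4 P (ltac:(by vm_compute)) a b c d ha hb hc hd.
by move/implyP => h /h /andP[/eqP -> /eqP ->].
Qed.

Lemma ee_modn (m n : nat) : (0 < m)%N -> ee ((n %% m)%:R / m%:R : K) = ee (n%:R / m%:R).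
Proof.
move=> m0; have mz : (m%:R : K) != 0 by rewrite pnatr_eq0 -lt0n.
by rewrite [in RHS](divn_eq n m) natrD natrM mulrDl mulfK // eeD ee_nat mul1r.
Qed.

Definition mult a b c d : K :=
  ee ((u3 (res 3 a) (res 3 b) (res 3 c) (res 3 d))%:R / 3) *
  ee ((v4 (res 4 a) (res 4 b) (res 4 c) (res 4 d))%:R / 4).

Lemma mult_T a b c d : a * d - b * c = 1 ->
  mult a (a + b) c (c + d) = ee (1 / 12) * mult a b c d.
Proof.
move=> h; rewrite /mult !resD //.
have [-> _] := u3_TS (@res_lt 3 a isT) (@res_lt 3 b isT) (@res_lt 3 c isT) (@res_lt 3 d isT) (res_det (isT : 1 < 3)%N h).
have [-> _] := v4_TS (@res_lt 4 a isT) (@res_lt 4 b isT) (@res_lt 4 c isT) (@res_lt 4 d isT) (res_det (isT : 1 < 4)%N h).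
move: (u3 _ _ _ _) (v4 _ _ _ _) => u v.
rewrite !ee_modn // (natrD _ u 1) (natrD _ v 3) (mulrDl u%:R) (mulrDl v%:R).
rewrite (eeD (u%:R / 3)) (eeD (v%:R / 4)).
have -> : ee (3 / 4) = ee (1 / 12) / ee (1 / 3) :> K.
  by rewrite (_ : 3 / 4 = 1 / 12 - 1 / 3 + 1); [rewrite eeD ee1 mulr1 eeB|field].
by have := ee_neq0 (1 / 3 : K); move: (ee (1 / 3)) => x x0; field.
Qed.

Lemma mult_S a b c d : a * d - b * c = 1 ->
  mult b (- a) d (- c) = ee (- (1 / 4)) * mult a b c d.
Proof.
move=> h; rewrite /mult !resN //.
have [_ ->] := u3_TS (@res_lt 3 a isT) (@res_lt 3 b isT) (@res_lt 3 c isT) (@res_lt 3 d isT) (res_det (isT : 1 < 3)%N h).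
have [_ ->] := v4_TS (@res_lt 4 a isT) (@res_lt 4 b isT) (@res_lt 4 c isT) (@res_lt 4 d isT) (res_det (isT : 1 < 4)%N h).
move: (u3 _ _ _ _) (v4 _ _ _ _) => u v.
rewrite ee_modn // (natrD _ v 3) mulrDl eeD.
have -> : ee (3 / 4) = ee (- (1 / 4)) :> K.
  by rewrite (_ : 3 / 4 = - (1 / 4) + 1); [rewrite eeD ee1 mulr1|field].
by ring.
Qed.

Definition gs_equivariant a b c d := forall x y t, 0 < im t ->
  gs x y ((a%:~R * t + b%:~R) / (c%:~R * t + d%:~R))
  = mult a b c d * gs (x * a%:~R + y * c%:~R) (x * b%:~R + y * d%:~R) t.

Lemma equivariant1 : gs_equivariant 1 0 0 1.
Proof.
move=> x y t t0; rewrite !mulr0 !mulr1 addr0 add0r mul1r mul0r addr0 add0r divr1.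
by rewrite /mult /u3 /v4 /res /= !mul0r !ee0 !mul1r.
Qed.

Lemma equivariant_S a b c d : a * d - b * c = 1 -> gs_equivariant a b c d ->
  gs_equivariant b (- a) d (- c).
Proof.
move=> h hP x y t t0; have tn0 := upper_neq0 t0.
have den : d%:~R * t + (- c)%:~R != 0.
  apply: lattice_neq0 => //; rewrite -negb_and; apply/negP => /andP[/eqP d0].
  by rewrite oppr_eq0 => /eqP c0; move: h; rewrite d0 c0 !mulr0 subr0.
rewrite mult_S // (_ : (_ + _) / _ = (a%:~R * - t^-1 + b%:~R) / (c%:~R * - t^-1 + d%:~R)).
  have -> : x * (- a)%:~R + y * (- c)%:~R = - (x * a%:~R + y * c%:~R).
    by rewrite !rmorphN; ring.
  by rewrite hP ?im_inv_gt0 // gs_S //; ring.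
have e (u v : K) : u * - t^-1 + v = (v * t - u) * t^-1 by field.
by rewrite !e !mulrNz invfM invrK mulrACA mulVf // mulr1.
Qed.

Lemma equivariant_T a b c d : a * d - b * c = 1 ->
  gs_equivariant a b c d <-> gs_equivariant a (a + b) c (c + d).
Proof.
move=> h; split=> hP x y t t0.
  rewrite mult_T // (_ : (_ + _) / _ = (a%:~R * (t + 1) + b%:~R) / (c%:~R * (t + 1) + d%:~R)).
    have -> : x * (a + b)%:~R + y * (c + d)%:~R
        = (x * a%:~R + y * c%:~R) + (x * b%:~R + y * d%:~R) by rewrite !rmorphD; ring.
    by rewrite hP ?imD ?im1 ?addr0 // gs_T; ring.
  by rewrite !rmorphD; congr (_ / _); ring.
have t1 : 0 < im (t - 1) by rewrite imD imN im1 subr0.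
rewrite (_ : (_ + _) / _ = (a%:~R * (t - 1) + (a + b)%:~R) / (c%:~R * (t - 1) + (c + d)%:~R)).
  have e : x * (a + b)%:~R + y * (c + d)%:~R
      = (x * a%:~R + y * c%:~R) + (x * b%:~R + y * d%:~R) by rewrite !rmorphD; ring.
  by rewrite hP // mult_T // e -[in RHS](subrK 1 t) gs_T; ring.
by rewrite !rmorphD; congr (_ / _); ring.
Qed.

Lemma equivariant_Tk a b c d (n : nat) : a * d - b * c = 1 ->
  gs_equivariant a b c d <-> gs_equivariant a (a * n%:Z + b) c (c * n%:Z + d).
Proof.
move=> h; elim: n => [|n IH]; first by rewrite !mulr0 !add0r.
rewrite IH.
have e (x y : int) : x * n.+1%:Z + y = x + (x * n%:Z + y) by rewrite -addn1 PoszD; ring.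
rewrite !e.
by apply: equivariant_T; rewrite -h; ring.
Qed.

(** Euclid's algorithm on the bottom row, by induction on |c|: a power of T reduces d modulo c, and
    S moves the remainder into the place of c. *)
Theorem gs_modular a b c d : a * d - b * c = 1 -> gs_equivariant a b c d.
Proof.
have [n] := ubnP `|c|%N; elim: n a b c d => // n IH a b c d cn h.
have Tk (k : int) a1 b1 c1 d1 : a1 * d1 - b1 * c1 = 1 ->
    gs_equivariant a1 (a1 * k + b1) c1 (c1 * k + d1) -> gs_equivariant a1 b1 c1 d1.
  move=> h1; case: k => k; first by rewrite -equivariant_Tk.
  rewrite NegzE => hP.
  have {hP} := (equivariant_Tk (a := a1) (c := c1) (b := a1 * - k.+1%:Z + b1) (d := c1 * - k.+1%:Z + d1) k.+1 _).1 hP.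
  rewrite !addrA -!mulrDr subrr !mulr0 !add0r; apply.
  by rewrite -h1; ring.
have [c0|c0] := eqVneq c 0.
  rewrite c0 mulr0 subr0 in h *.
  have hd : (a == 1) && (d == 1) || (a == -1) && (d == -1).
    have : (`|a| * `|d| = 1)%N by rewrite -abszM h.
    by move/eqP; rewrite muln_eq1 => /andP[/eqP ha /eqP hd]; move: h ha hd; clear; nia.
  have unip (k : int) : gs_equivariant 1 k 0 1.
    apply: (Tk (- k)); first by rewrite mulr0 subr0 mulr1.
    by rewrite mul1r addNr mul0r add0r; exact: equivariant1.
  case/orP: hd => /andP[/eqP -> /eqP ->]; first exact: unip.
  (* The matrix with diagonal -1 is reached from a unipotent one by S^2 = -1. *)
  have := equivariant_S (a := - b) (b := -1) (c := 1) (d := 0) _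
    (equivariant_S (a := 1) (b := - b) (c := 0) (d := 1) _ (unip (- b))).
  rewrite [- - b]opprK; apply; first by rewrite mulr0 sub0r mulN1r opprK.
  by rewrite mulr0 subr0 mulr1.
pose k := (d %/ c)%Z.
have h1 : a * (d %% c)%Z - (b - k * a) * c = 1.
  by rewrite -h {2}(divz_eq d c) -/k; ring.
have lt : (`|(d %% c)%Z| < n)%N.
  apply: leq_trans (_ : `|c| <= n)%N; last by rewrite -ltnS.
  by rewrite -ltz_nat gez0_abs ?modz_ge0 // ltz_mod.
have := IH (b - k * a) (- a) (d %% c)%Z (- c) lt.
rewrite mulrN mulNr opprK addrC [X in X = 1 -> _](_ : _ = a * (d %% c)%Z - (b - k * a) * c); last by ring.
move=> /(_ h1) hP.
(* S^4 = 1, so three more steps by S undo the one contained in the induction hypothesis. *)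
have h2 : (b - k * a) * - c - - a * (d %% c)%Z = 1 by rewrite -h1; ring.
have {}hP := equivariant_S h2 hP.
have h3 : - a * - (d %% c)%Z - - (b - k * a) * - c = 1 by rewrite -h1; ring.
have {}hP := equivariant_S h3 hP.
have h4 : - (b - k * a) * - - c - - - a * - (d %% c)%Z = 1 by rewrite -h1; ring.
have {}hP := equivariant_S h4 hP.
rewrite !opprK in hP.
apply: (Tk (- k)) => //.
rewrite (_ : a * - k + b = b - k * a); last by ring.
by rewrite (_ : c * - k + d = (d %% c)%Z) //; rewrite {1}(divz_eq d c) -/k; ring.
Qed.

End ModularGroup.

(** * The finite Bailey chain *)

Section BilateralSums.
Variables (F : numFieldType).
Implicit Types (f g : int -> F).

(** The sum over |m| <= B. The bound is separate from the level N of the chain, so that all levels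
    share one range and the reciprocals [iq] do the cutting off. *)
Definition bsum (B : nat) f : F := f 0 + \sum_(k < B) (f k.+1%:Z + f (- k.+1%:Z)).

Lemma bsumS B f : bsum B.+1 f = bsum B f + (f B.+1%:Z + f (- B.+1%:Z)).
Proof. by rewrite /bsum big_ord_recr /= addrA. Qed.

Lemma eq_bsum B f g : f =1 g -> bsum B f = bsum B g.
Proof. by move=> fg; rewrite /bsum fg; congr (_ + _); apply: eq_bigr => k _; rewrite !fg. Qed.

Lemma bsumD B f g : bsum B (fun m => f m + g m) = bsum B f + bsum B g.
Proof.
rewrite /bsum addrACA -big_split; congr (_ + _); apply: eq_bigr => k _ /=.
by rewrite addrACA.
Qed.

Lemma bsumZ B a f : bsum B (fun m => a * f m) = a * bsum B f.
Proof.
rewrite /bsum mulrDr mulr_sumr; congr (_ + _); apply: eq_bigr => k _ /=.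
by rewrite mulrDr.
Qed.

Lemma bsumN B f : bsum B (fun m => - f m) = - bsum B f.
Proof.
rewrite -mulN1r -bsumZ; apply: eq_bsum => m; exact/esym/mulN1r.
Qed.

Lemma bsum_opp B f : bsum B (fun m => f (- m)) = bsum B f.
Proof.
rewrite /bsum oppr0; congr (_ + _); apply: eq_bigr => k _.
by rewrite opprK addrC.
Qed.

Lemma bsum_succ B f : bsum B (fun m => f (m + 1)) = bsum B f + f B.+1%:Z - f (- B%:Z).
Proof.
elim: B => [|B IH]; first by rewrite /bsum !big_ord0 add0r oppr0; ring.
rewrite !bsumS IH -[B.+2]addn1 PoszD.
have -> : - B.+1%:Z + 1 = - B%:Z by lia.
by ring.
Qed.

(** Reflection about -1/2 moves the symmetric range by one place; the two zeros are the terms lost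
    and gained at its ends. *)
Lemma bsum_reflect B f : f B%:Z = 0 -> f (- B.+1%:Z) = 0 ->
  bsum B (fun m => f (- 1 - m)) = bsum B f.
Proof.
move=> h1 h2; rewrite -(bsum_opp B f).
rewrite (@eq_bsum B (fun m => f (-1 - m)) (fun m => f (- (m + 1)))); last by move=> m; congr f; ring.
rewrite (bsum_succ B (fun m => f (- m))) h2 opprK h1; ring.
Qed.

Lemma bsum_antisym B f : f B%:Z = 0 -> f (- B.+1%:Z) = 0 ->
  (forall m, f (- 1 - m) = - f m) -> bsum B f = 0.
Proof.
move=> h1 h2 h; have := bsum_reflect h1 h2; rewrite (@eq_bsum B (fun m => f (-1 - m)) (fun m => - f m)) //.
rewrite bsumN => /eqP; rewrite -subr_eq0 -opprD oppr_eq0 -mulr2n mulrn_eq0 /=.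
by move/eqP.
Qed.

Lemma bsum_exchange B (n : nat) (f : 'I_n -> int -> F) :
  \sum_(s < n) bsum B (f s) = bsum B (fun m => \sum_(s < n) f s m).
Proof.
rewrite /bsum big_split /=; congr (_ + _); rewrite exchange_big /=.
by apply: eq_bigr => k _; rewrite big_split.
Qed.

End BilateralSums.

(** * Finite q-series identities *)

Section FiniteQSeries.
Variables (F : numFieldType) (Q : F).
Hypothesis Q0 : Q != 0.
Hypothesis Q1 : forall n, 1 - Q ^+ n.+1 != 0.

Definition qf (n : nat) : F := \prod_(k < n) (1 - Q ^+ k.+1).

Lemma qf_neq0 n : qf n != 0. Proof. by apply/prodf_neq0 => k _. Qed.

Lemma qfS n : qf n.+1 = qf n * (1 - Q ^+ n.+1).
Proof. by rewrite /qf big_ord_recr. Qed.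

(* The reciprocal of (Q;Q)_m, extended by 0 to negative m, as in its product
   formula. *)
Definition iq (m : int) : F := if m is Posz n then (qf n)^-1 else 0.

#[local] Arguments iq m : simpl never.

Lemma iq0 : iq 0 = 1. Proof. by rewrite /iq /= /qf big_ord0 invr1. Qed.

Lemma iq_neg (m : int) : m < 0 -> iq m = 0. Proof. by case: m. Qed.

Lemma iq_pos (n : nat) : iq n = (qf n)^-1. Proof. by []. Qed.

(** At m = -1 the factor 1 - Q^0 vanishes, so the recurrence crosses from negative to nonnegative
    indices, and the sums below need no boundary corrections from it. *)
Lemma iq_rec (m : int) : iq m = (1 - Q ^ (m + 1)) * iq (m + 1).
Proof.
case: m => [n|[|n]].
- rewrite -PoszD addn1 !iq_pos qfS -exprnP; have := qf_neq0 n; have := Q1 n.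
  by move: (qf n) (1 - _) => x y y0 x0; field; rewrite ?x0 ?y0.
- by rewrite NegzE addNr expr0z subrr mul0r.
- have -> : Negz n.+1 + 1 = Negz n by rewrite !NegzE -[n.+2]addn1 PoszD; ring.
  by rewrite !iq_neg // mulr0.
Qed.

Lemma iq_pred (m : int) : iq (m - 1) = (1 - Q ^ m) * iq m.
Proof. by rewrite iq_rec subrK. Qed.

(** Induction on M by the q-Pascal splitting 1 - Q^(M+1) = (1 - Q^(M+1-k)) + Q^(M+1-k) (1 - Q^k).
    The square root p of Q accommodates the exponent k^2 / 2. *)
Lemma qbinomial (p x : F) (M : nat) : p ^+ 2 = Q ->
  \sum_(k < M.+1) p ^+ (k * k) * x ^+ k * iq k * iq (M%:Z - k%:Z)
  = \prod_(i < M) (1 + x * p * Q ^+ i) * iq M.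
Proof.
move=> pQ; elim: M => [|M IH]; first by rewrite big_ord1 big_ord0 !expr0 !mul1r subr0 iq0 mulr1.
apply: (mulfI (Q1 M)); rewrite mulr_sumr.
rewrite (eq_bigr (fun k : 'I_M.+2 => p ^+ (k * k) * x ^+ k * iq k * iq (M%:Z - k%:Z)
   + Q ^ (M.+1%:Z - k%:Z) * (p ^+ (k * k) * x ^+ k) * iq (k%:Z - 1) * iq (M.+1%:Z - k%:Z))); last first.
  move=> k _; have -> : M%:Z - k%:Z = M.+1%:Z - k%:Z - 1 by lia.
  rewrite !iq_pred; have -> : Q ^+ M.+1 = Q ^ (M.+1%:Z - k%:Z) * Q ^ k%:Z.
    by rewrite -expfzDr // subrK.
  ring.
rewrite big_split /= big_ord_recr /= [iq (M%:Z - M.+1%:Z)]iq_neg; last first.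
  by rewrite -addn1 PoszD; lia.
rewrite mulr0 addr0 IH big_ord_recl /= [iq (0 - 1)]iq_neg // mulr0 mul0r add0r.
rewrite (eq_bigr (fun k : 'I_M.+1 => (x * p * Q ^+ M) * (p ^+ (k * k) * x ^+ k * iq k * iq (M%:Z - k%:Z)))); last first.
  move=> k _; rewrite /bump /= add1n.
  have -> : k.+1%:Z - 1 = k by lia.
  have -> : M.+1%:Z - k.+1%:Z = M%:Z - k%:Z by lia.
  have e : p ^+ (k.+1 * k.+1) = p ^+ (k * k) * p * Q ^+ k.
    by rewrite -pQ -exprM -mulrA -exprS -exprD; congr (_ ^+ _); lia.
  have e2 : Q ^+ M = Q ^ (M%:Z - k%:Z) * Q ^+ k.
    by rewrite !exprnP -expfzDr // subrK.
  by rewrite e e2 exprS; ring.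
rewrite -mulr_sumr IH big_ord_recr /= !iq_pos qfS.
have := qf_neq0 M; have := Q1 M.
by move: (qf M) (1 - Q ^+ _) => a b b0 a0; field; rewrite a0 b0.
Qed.

(** The q-Chu-Vandermonde sum, by the same splitting; c is arbitrary because the second half of the
    split raises it by 1. *)
Lemma vandermonde (L c : nat) :
  \sum_(t < L.+1) Q ^+ (t * (t + c)) * iq (L%:Z - t%:Z) * iq t * iq (t + c)%N = iq L * iq (L + c)%N.
Proof.
elim: L c => [|L IH] c; first by rewrite big_ord1 expr0 !mul1r subr0 !add0n iq0 !mul1r.
apply: (mulfI (Q1 L)); rewrite mulr_sumr.
rewrite (eq_bigr (fun t : 'I_L.+2 => Q ^+ (t * (t + c)) * iq (L%:Z - t%:Z) * iq t * iq (t + c)%N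
   + Q ^ (L.+1%:Z - t%:Z) * Q ^+ (t * (t + c)) * iq (L.+1%:Z - t%:Z) * iq (t%:Z - 1) * iq (t + c)%N)); last first.
  move=> t _; have -> : L%:Z - t%:Z = L.+1%:Z - t%:Z - 1 by lia.
  rewrite !iq_pred; have -> : Q ^+ L.+1 = Q ^ (L.+1%:Z - t%:Z) * Q ^ t%:Z.
    by rewrite -expfzDr // subrK.
  ring.
rewrite big_split /= big_ord_recr /= [iq (L%:Z - L.+1%:Z)]iq_neg; last first.
  by rewrite -addn1 PoszD; lia.
rewrite mulr0 !mul0r addr0 IH big_ord_recl /= [iq (0 - 1)]iq_neg // mulr0 mul0r add0r.
rewrite (eq_bigr (fun t : 'I_L.+1 => Q ^+ (L.+1 + c) *
   (Q ^+ (t * (t + c.+1)) * iq (L%:Z - t%:Z) * iq t * iq (t + c.+1)%N))); last first.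
  move=> t _; rewrite /bump /= add1n.
  have -> : t.+1%:Z - 1 = t by lia.
  have -> : L.+1%:Z - t.+1%:Z = L%:Z - t%:Z by lia.
  rewrite addSnnS; rewrite !mulrA; congr (_ * _ * _ * _).
  rewrite !exprnP -!expfzDr //; congr (Q ^ _).
  by move: (t : nat) => k; lia.
rewrite -mulr_sumr IH !addSn addnS !iq_pos !qfS.
have := qf_neq0 L; have := qf_neq0 (L + c); have := Q1 L; have := Q1 (L + c).
move: (Q ^+ (L + c).+1) (Q ^+ L.+1) (qf L) (qf (L + c)) => u v a b u0 v0 b0 a0.
by field; rewrite ?a0 ?b0 ?u0 ?v0.
Qed.

Lemma iq_step_pos (N m s : nat) :
  \sum_(k < N.+1) Q ^+ (k * (k + s)) * iq (N%:Z - k%:Z) * iq (k%:Z - m%:Z) * iq (k%:Z + m%:Z + s%:Z)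
  = Q ^+ (m * (m + s)) * iq (N%:Z - m%:Z) * iq (N%:Z + m%:Z + s%:Z).
Proof.
case: (leqP m N) => [mN|Nm]; last first.
  rewrite [iq (N%:Z - m%:Z)]iq_neg; last by lia.
  rewrite mulr0 mul0r big1 // => k _; rewrite [iq (k%:Z - m%:Z)]iq_neg ?mulr0 ?mul0r //.
  by have := ltn_ord k; lia.
rewrite -(big_mkord xpredT (fun k => Q ^+ (k * (k + s)) * iq (N%:Z - k%:Z) * iq (k%:Z - m%:Z) * iq (k%:Z + m%:Z + s%:Z))).
rewrite (big_cat_nat (n := m)) //=; last exact: leqW.
rewrite big_nat big1 ?add0r; last first.
  by move=> k /andP[_ km]; rewrite [iq (k%:Z - m%:Z)]iq_neg ?mulr0 ?mul0r //; lia.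
rewrite -{1}[m]add0n big_addn subSn // big_mkord.
have := vandermonde (N - m) (2 * m + s); rewrite -subzn // => h.
have -> : iq (N%:Z + m%:Z + s%:Z) = iq (N - m + (2 * m + s))%N by congr iq; lia.
rewrite -mulrA -h mulr_sumr; apply: eq_bigr => t _.
have -> : N%:Z - (t + m)%N%:Z = N%:Z - m%:Z - t%:Z by rewrite PoszD; ring.
have -> : (t + m)%N%:Z - m%:Z = t by rewrite PoszD; ring.
have -> : (t + m)%N%:Z + m%:Z + s%:Z = (t + (2 * m + s))%N by lia.
rewrite !mulrA; congr (_ * _ * _ * _); rewrite -exprD; congr (_ ^+ _); nia.
Qed.

(** The kernel of Bailey's lemma with both free parameters at infinity; s = 0 and s = 1 are the
    pairs relative to 1 and to Q. A negative m is exchanged with - m - s >= 0, which swaps the two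
    reciprocals. *)
Lemma iq_step (N s : nat) (m : int) : (s <= 1)%N ->
  \sum_(k < N.+1) Q ^+ (k * (k + s)) * iq (N%:Z - k%:Z) * iq (k%:Z - m) * iq (k%:Z + m + s%:Z)
  = Q ^ (m * (m + s%:Z)) * iq (N%:Z - m) * iq (N%:Z + m + s%:Z).
Proof.
move=> s1; case: m => m.
  by rewrite iq_step_pos -PoszD -PoszM exprnP.
rewrite NegzE; set m' : nat := (m.+1 - s)%N.
have e : - m.+1%:Z = - m'%:Z - s%:Z by rewrite /m'; lia.
rewrite e.
have -> : (- m'%:Z - s%:Z) * (- m'%:Z - s%:Z + s%:Z) = (m' * (m' + s))%N.
  by rewrite PoszM PoszD; ring.
have h (k : int) : k - (- m'%:Z - s%:Z) = k + m'%:Z + s%:Z by ring.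
have h2 (k : int) : k + (- m'%:Z - s%:Z) + s%:Z = k - m'%:Z by ring.
under eq_bigr do rewrite h h2 mulrAC.
by rewrite iq_step_pos h h2 -exprnP mulrAC.
Qed.

Lemma bailey_step (B N s : nat) (e : int -> F) : (s <= 1)%N ->
  \sum_(k < N.+1) iq (N%:Z - k%:Z) * (Q ^+ (k * (k + s)) *
     bsum B (fun m => e m * (iq (k%:Z - m) * iq (k%:Z + m + s%:Z))))
  = bsum B (fun m => e m * Q ^ (m * (m + s%:Z)) * (iq (N%:Z - m) * iq (N%:Z + m + s%:Z))).
Proof.
move=> s1; under eq_bigr do rewrite -!bsumZ.
rewrite bsum_exchange; apply: eq_bsum => m.
rewrite -mulrA [Q ^ _ * _]mulrA -iq_step // mulr_sumr; apply: eq_bigr => k _; ring.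
Qed.

(** Passes from a pair relative to Q to one relative to 1: by [iq_rec] the two sums differ by a sum
    that is antisymmetric about -1/2. *)
Lemma bailey_switch (B N : nat) (e : int -> F) : (N < B)%N ->
  (forall m, e (- 1 - m) = - (e m * Q ^ (2 * m + 1))) ->
  bsum B (fun m => e m * (iq (N%:Z - m) * iq (N%:Z + m + 1)))
  = bsum B (fun m => e m * (iq (N%:Z - m) * iq (N%:Z + m + 0%:Z))).
Proof.
move=> NB he.
pose h m := e m * Q ^ (N%:Z + m + 1) * (iq (N%:Z - m) * iq (N%:Z + m + 1)).
have h0 : bsum B h = 0.
  apply: bsum_antisym.
  - by rewrite /h [iq (N%:Z - B%:Z)]iq_neg ?mul0r ?mulr0 //; lia.
  - by rewrite /h [iq (N%:Z + - _ + 1)]iq_neg ?mulr0 //; lia.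
  move=> m; rewrite /h he.
  have -> : N%:Z - (-1 - m) = N%:Z + m + 1 by ring.
  have -> : N%:Z + (-1 - m) + 1 = N%:Z - m by ring.
  have -> : Q ^ (N%:Z + m + 1) = Q ^ (2 * m + 1) * Q ^ (N%:Z - m).
    by rewrite -expfzDr //; congr (Q ^ _); ring.
  ring.
rewrite -[LHS]subr0 -h0 -bsumN -bsumD; apply: eq_bsum => m.
by rewrite /h [N%:Z + m + 0%:Z]addr0 (iq_rec (N%:Z + m)); ring.
Qed.

(** Up to the factors in [iq], going from N to N + 1 multiplies the right side by (1 - z Q^N)(1 -
    z^-1 Q^(N+1)). Of the four terms of this product, those with z and z^-1 shift the summation
    index by one, after which the identity holds term by term. *)
Lemma finite_triple_product (B N : nat) (z : F) : z != 0 -> (N < B)%N ->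
  bsum B (fun m => (-1) ^ m * z ^ m * Q ^ (m * (m - 1) %/ 2)%Z * (iq (N%:Z - m) * iq (N%:Z + m + 0%:Z)))
  = \prod_(i < N) ((1 - z * Q ^+ i) * (1 - z^-1 * Q ^+ i.+1)) * iq (2 * N)%N.
Proof.
move=> z0 NB.
pose g (m : int) : F := (-1) ^ m * z ^ m * Q ^ (m * (m - 1) %/ 2)%Z.
have m1 : (-1 : F) != 0 by rewrite oppr_eq0 oner_eq0.
have tri (m : int) : ((m + 1) * (m + 1 - 1) %/ 2)%Z = (m * (m - 1) %/ 2)%Z + m.
  rewrite (_ : (m + 1) * (m + 1 - 1) = m * 2 + m * (m - 1)); last by ring.
  by rewrite divzMDl // addrC.
have gS m : g (m + 1) = - (z * Q ^ m * g m).
  by rewrite /g tri !expfzDr // !expr1z; ring.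
have gP m : g (m - 1) = - (z^-1 * Q ^ (1 - m) * g m).
  have := gS (m - 1); rewrite subrK => ->.
  have -> : Q ^ (1 - m) = (Q ^ (m - 1))^-1 by rewrite invr_expz opprB.
  have : Q ^ (m - 1) != 0 by rewrite expfz_neq0.
  by move: (Q ^ _) => y y0; field; rewrite z0 y0.
elim: N NB => [|N IH] NB.
  rewrite big_ord0 mul1r iq0 /bsum big1 => [|k _].
    by rewrite addr0 !expr0z !mul1r [iq (0%:Z - 0)]iq0 ?mulr1.
  by rewrite [iq (0%:Z - _)]iq_neg ?mul0r ?mulr0 ?add0r // [iq (0%:Z + - _ + _)]iq_neg ?mulr0.
have {}IH := IH (ltnW NB).
rewrite big_ord_recr /= mulnS.
have q1 : 1 - Q ^+ (2 * N).+1 != 0 by []; have q2 : 1 - Q ^+ (2 * N).+2 != 0 by [].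
apply: (mulfI (mulf_neq0 q1 q2)).
have -> : (1 - Q ^+ (2 * N).+1) * (1 - Q ^+ (2 * N).+2) * (\prod_(i < N) ((1 - z * Q ^+ i) * (1 - z^-1 * Q ^+ i.+1)) *
   ((1 - z * Q ^+ N) * (1 - z^-1 * Q ^+ N.+1)) * iq (2 + 2 * N)%N)
  = (1 + Q ^+ (2 * N).+1 - z * Q ^+ N - z^-1 * Q ^+ N.+1) *
    (\prod_(i < N) ((1 - z * Q ^+ i) * (1 - z^-1 * Q ^+ i.+1)) * iq (2 * N)%N).
  rewrite add2n !iq_pos !qfS; have := qf_neq0 (2 * N); move: q1 q2.
  have -> : Q ^+ (2 * N).+1 = Q ^+ N * Q ^+ N.+1 by rewrite -exprD; congr (_ ^+ _); lia.
  move: (qf _) (\prod_(i < N) _) (Q ^+ N) (Q ^+ N.+1) (Q ^+ (2 * N).+2) => a P x y v q1 q2 a0.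
  by field; rewrite ?a0 ?q1 ?q2 ?z0.
pose I N m := iq (N%:Z - m) * iq (N%:Z + m + 0%:Z).
rewrite -IH -/(bsum B (fun m => g m * I N m)) -/(bsum B (fun m => g m * I N.+1 m)).
rewrite (_ : forall a u v w : F, (1 + u - v - w) * a = a + u * a + (- (v * a)) + (- (w * a))); last by move=> a u v w; ring.
rewrite -!bsumZ -!bsumN.
have sh1 : bsum B (fun m => - (z * Q ^+ N * (g m * I N m))) = bsum B (fun m => Q ^ (N%:Z - m + 1) * g m * I N (m - 1)).
  have := bsum_succ B (fun m => Q ^ (N%:Z - m + 1) * g m * I N (m - 1)).
  rewrite [I N (- _ - 1)](_ : _ = 0); last first.
    by rewrite /I [iq (N%:Z + _ + 0%:Z)]iq_neg ?mulr0 //; lia.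
  rewrite [I N (_ - 1)](_ : _ = 0); last first.
    by rewrite /I [iq (N%:Z - _)]iq_neg ?mul0r //; lia.
  rewrite !mulr0 subr0 addr0 => <-; apply: eq_bsum => m.
  rewrite gS addrK; have -> : N%:Z - (m + 1) + 1 = N%:Z - m by ring.
  have -> : Q ^+ N = Q ^ (N%:Z - m) * Q ^ m by rewrite -expfzDr // subrK.
  ring.
have sh2 : bsum B (fun m => - (z^-1 * Q ^+ N.+1 * (g m * I N m))) = bsum B (fun m => Q ^ (N%:Z + m + 1) * g m * I N (m + 1)).
  have := bsum_succ B (fun m => - (z^-1 * Q ^+ N.+1 * (g m * I N m))).
  rewrite [I N (- _)](_ : _ = 0); last first.
    by rewrite /I [iq (N%:Z + _ + 0%:Z)]iq_neg ?mulr0 //; lia.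
  rewrite [I N (_.+1)](_ : _ = 0); last first.
    by rewrite /I [iq (N%:Z - _)]iq_neg ?mul0r //; lia.
  rewrite !mulr0 oppr0 subr0 addr0 => <-; apply: eq_bsum => m.
  have := gP (m + 1); rewrite addrK => ->.
  have -> : 1 - (m + 1) = - m by ring.
  have -> : Q ^ (N%:Z + m + 1) = Q ^+ N.+1 * Q ^ m.
    by rewrite exprnP -expfzDr //; congr (Q ^ _); lia.
  rewrite gS -[Q ^ (- m)]invr_expz; have : Q ^ m != 0 by rewrite expfz_neq0.
  by move: (Q ^ m) => y y0; field; rewrite z0 y0.
rewrite sh1 sh2 -!bsumD; apply: eq_bsum => m.
rewrite /I !addr0.
have -> : N%:Z - m = N.+1%:Z - m - 1 by lia.
have -> : N%:Z + m = N.+1%:Z + m - 1 by lia.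
have -> : N%:Z - (m - 1) = N.+1%:Z - m by lia.
have -> : N%:Z + (m - 1) = N.+1%:Z + m - 1 - 1 by lia.
have -> : N%:Z - (m + 1) = N.+1%:Z - m - 1 - 1 by lia.
have -> : N%:Z + (m + 1) = N.+1%:Z + m by lia.
rewrite !iq_pred; have -> : N.+1%:Z - m - 1 + 1 = N.+1%:Z - m by ring.
have -> : N.+1%:Z + m - 1 + 1 = N.+1%:Z + m by ring.
have -> : Q ^+ (2 * N).+1 = Q ^ (N.+1%:Z - m) * Q ^ (N.+1%:Z + m) / Q.
  by apply: (mulIf Q0); rewrite divfK // -exprSr exprnP -expfzDr //; congr (Q ^ _); lia.
have -> : Q ^+ (2 * N).+2 = Q ^ (N.+1%:Z - m) * Q ^ (N.+1%:Z + m).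
  by rewrite exprnP -expfzDr //; congr (Q ^ _); lia.
have -> : Q ^ (N.+1%:Z - m - 1) = Q ^ (N.+1%:Z - m) / Q by rewrite expfzDr // exprN1.
have -> : Q ^ (N.+1%:Z + m - 1) = Q ^ (N.+1%:Z + m) / Q by rewrite expfzDr // exprN1.
rewrite -/(g m); move: (Q ^ _) (Q ^ _) (iq _) (iq _) (g m) => x y a b c.
by field.
Qed.

End FiniteQSeries.

Arguments iq F Q m : simpl never.

(* The division is exact. *)
Definition tri (m : int) : int := (m * (m - 1) %/ 2)%Z.

Lemma tri_succ m : tri (m + 1) = tri m + m.
Proof.
rewrite /tri (_ : (m + 1) * (m + 1 - 1) = m * 2 + m * (m - 1)); last by ring.
by rewrite divzMDl // addrC.
Qed.

Lemma tri2 m : tri m * 2 = m * (m - 1).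
Proof.
have h (n : nat) : tri n * 2 = n%:Z * (n%:Z - 1).
  elim: n => [|n IH]; first by [].
  by rewrite -addn1 PoszD tri_succ mulrDl IH; ring.
case: m => n; first exact: h.
rewrite NegzE; elim: n.+1 => [|k IH]; first by rewrite oppr0 h.
have := tri_succ (- k.+1%:Z); rewrite (_ : - k.+1%:Z + 1 = - k%:Z); last by lia.
by move: IH => + e; rewrite e mulrDl => IH; lia.
Qed.

Lemma triN m : tri (- m) = tri m + m.
Proof. by apply: (@mulIf _ (2 : int)) => //; rewrite mulrDl !tri2; ring. Qed.

Lemma tri_reflect m : tri (- 1 - m) = tri m + 2 * m + 1.
Proof. by apply: (@mulIf _ (2 : int)) => //; rewrite !mulrDl !tri2; ring. Qed.

Lemma intr_mod2 (R : fieldType) (m n : int) : (-1 : R) ^ (m + 2 * n) = (-1) ^ m.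
Proof.
rewrite expfzDr ?oppr_eq0 ?oner_eq0 // -exprz_exp.
have -> : (-1 : R) ^ (2 : int) = 1 by rewrite -exprnP sqrrN expr1n.
by rewrite exp1rz mulr1.
Qed.

(** * The initial Bailey pair and its iteration *)

Section BasePairs.
Variables (F : numFieldType) (p : F).
Let Q := p ^+ 2.
Hypothesis p0 : p != 0.
Hypothesis Q1 : forall n, 1 - Q ^+ n.+1 != 0.
Hypothesis p1 : forall n, 1 + p * Q ^+ n != 0.

Lemma sqr_neq0 : Q != 0. Proof. by rewrite expf_neq0. Qed.

(** A family of theta summands closed under the Bailey step, which only moves the pair (k, l). *)
Definition ec (k l m : int) : F := (-1) ^ m * p ^ (k * tri m + l * m).

Lemma QzE (m : int) : Q ^ m = p ^ (2 * m).
Proof. by rewrite /Q exprnP exprz_exp. Qed.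

Lemma sgn_opp (m : int) : (-1 : F) ^ (- m) = (-1) ^ m.
Proof. by rewrite -(intr_mod2 F (- m) m); congr (_ ^ _); ring. Qed.

Lemma sgn_reflect (m : int) : (-1 : F) ^ (- 1 - m) = - (-1) ^ m.
Proof.
rewrite -(intr_mod2 F (-1 - m) (m + 1)) (_ : -1 - m + 2 * (m + 1) = m + 1); last by ring.
by rewrite expfzDr ?oppr_eq0 ?oner_eq0 // expr1z mulrN1.
Qed.

Lemma ecN k l m : ec k l (- m) = ec k (k - l) m.
Proof. by rewrite /ec sgn_opp triN; congr (_ * p ^ _); ring. Qed.

Lemma ec_reflect k l m : ec k l (- 1 - m) = - (p ^ (k - l) * ec k (k * 2 - l) m).
Proof.
rewrite /ec sgn_reflect tri_reflect mulrCA -expfzDr // mulNr; congr (- (_ * p ^ _)).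
by ring.
Qed.

Lemma ec_step (k l : int) (s : nat) m :
  ec k l m * Q ^ (m * (m + s%:Z)) = ec (k + 4) (l + 2 + 2 * s%:Z) m.
Proof.
rewrite /ec QzE -mulrA -expfzDr //; congr (_ * p ^ _).
have -> : 2 * (m * (m + s%:Z)) = 2 * (tri m * 2) + (2 + 2 * s%:Z) * m by rewrite tri2; ring.
by ring.
Qed.

Lemma ec_lin (k l : int) m : ec k l m * Q ^ m = ec k (l + 2) m.
Proof. by rewrite /ec QzE -mulrA -expfzDr //; congr (_ * p ^ _); ring. Qed.

Definition qf2 (n : nat) : F := \prod_(k < n) (1 - Q ^+ (2 * k.+1)).
Definition qm (n : nat) : F := \prod_(k < n) (1 + p * Q ^+ k).

Lemma qf2_neq0 n : qf2 n != 0.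
Proof. by apply/prodf_neq0 => k _; rewrite mulnS; exact: Q1. Qed.

Lemma qm_neq0 n : qm n != 0.
Proof. by apply/prodf_neq0 => k _. Qed.

Let U B n := bsum B (fun m => ec 3 1 m * (iq Q (n%:Z - m) * iq Q (n%:Z + m))).
Let V1 B n := bsum B (fun m => ec 3 1 m * (iq Q (n%:Z - m) * iq Q (n%:Z + m + 1))).
Let V0 B n := bsum B (fun m => ec 3 2 m * (iq Q (n%:Z - m) * iq Q (n%:Z + m + 1))).

(* [U], [V1] and [V0] determine each other by the contiguous relations below,
   which yields the closed form of [U] by induction on n. *)
Lemma U_refl B n : U B n = bsum B (fun m => ec 3 2 m * (iq Q (n%:Z - m) * iq Q (n%:Z + m))).
Proof.
rewrite /U -bsum_opp; apply: eq_bsum => m.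
by rewrite ecN opprK [iq _ _ * _]mulrC.
Qed.

(** The antisymmetry behind [V1E] and [X_U]: the difference of their two sides is a sum over this
    summand that vanishes by reflection. *)
Lemma ec33_antisym (m : int) : ec 3 3 (- 1 - m) = - ec 3 3 m.
Proof. by rewrite ec_reflect subrr expr0z mul1r. Qed.

Lemma V1E B n : (n < B)%N -> V1 B n = U B n.
Proof.
move=> nB; apply/eqP; rewrite -subr_eq0 /V1 /U -bsumN -bsumD; apply/eqP.
rewrite (@eq_bsum _ _ _ (fun m => Q ^+ n.+1 * (ec 3 3 m * (iq Q (n%:Z - m) * iq Q (n%:Z + m + 1))))).
  rewrite bsumZ (_ : bsum _ _ = 0) ?mulr0 //; apply: bsum_antisym.
  - by rewrite [iq _ (n%:Z - _)]iq_neg ?mul0r ?mulr0 //; lia.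
  - by rewrite [iq _ (n%:Z + _ + 1)]iq_neg ?mulr0 //; lia.
  move=> m; rewrite ec33_antisym.
  have -> : n%:Z - (-1 - m) = n%:Z + m + 1 by ring.
  have -> : n%:Z + (-1 - m) + 1 = n%:Z - m by ring.
  by rewrite mulNr [iq _ _ * _]mulrC.
move=> m; rewrite -(ec_lin 3 1) (iq_rec Q1 (n%:Z + m)).
have -> : Q ^ (n%:Z + m + 1) = Q ^+ n.+1 * Q ^ m.
  by rewrite exprnP -expfzDr ?sqr_neq0 //; congr (Q ^ _); lia.
by ring.
Qed.

Lemma V0E B n : (n < B)%N -> U B n = (1 + p * Q ^+ n) * V0 B n.
Proof.
move=> nB; rewrite mulrDl mul1r U_refl.
have -> : p * Q ^+ n * V0 B n = - (Q ^+ n.+1 * bsum B (fun m => ec 3 2 m * Q ^ m * (iq Q (n%:Z - m) * iq Q (n%:Z + m + 1)))).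
  rewrite /V0 -(@bsum_reflect _ B (fun m => _ * (iq Q (n%:Z - m) * _))).
  - rewrite -mulrN -bsumN -!bsumZ; apply: eq_bsum => m.
    rewrite ec_reflect -(ec_lin 3 2).
    have -> : n%:Z - (-1 - m) = n%:Z + m + 1 by ring.
    have -> : n%:Z + (-1 - m) + 1 = n%:Z - m by ring.
    have -> : (3 - 2 : int) = 1 by [].
    by rewrite expr1z exprSr /Q; ring.
  - by rewrite [iq _ (n%:Z - _)]iq_neg ?mul0r ?mulr0 //; lia.
  - by rewrite [iq _ (n%:Z + _ + 1)]iq_neg ?mulr0 //; lia.
rewrite -bsumZ -bsumN /V0 -bsumD; apply: eq_bsum => m.
rewrite (iq_rec Q1 (n%:Z + m)).
have -> : Q ^ (n%:Z + m + 1) = Q ^+ n.+1 * Q ^ m.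
  by rewrite exprnP -expfzDr ?sqr_neq0 //; congr (Q ^ _); lia.
by ring.
Qed.

Lemma X_U B n : (n < B)%N ->
  bsum B (fun m => ec 3 3 m * (iq Q (n%:Z - m) * iq Q (n%:Z + m))) = Q ^+ n * U B n.
Proof.
move=> nB; apply/eqP; rewrite -subr_eq0 /U -bsumZ -bsumN -bsumD; apply/eqP.
rewrite (@eq_bsum _ _ _ (fun m => ec 3 3 m * (iq Q (n%:Z - m - 1) * iq Q (n%:Z + m)))).
  apply: bsum_antisym.
  - by rewrite [iq _ (n%:Z - _ - 1)]iq_neg ?mul0r ?mulr0 //; lia.
  - by rewrite [iq _ (n%:Z + _)]iq_neg ?mulr0 //; lia.
  move=> m; rewrite ec33_antisym.
  have -> : n%:Z - (-1 - m) - 1 = n%:Z + m by ring.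
  have -> : n%:Z + (-1 - m) = n%:Z - m - 1 by ring.
  by rewrite mulNr [iq _ _ * _]mulrC.
move=> m; rewrite -(ec_lin 3 1) (iq_pred Q1).
have -> : Q ^+ n = Q ^ (n%:Z - m) * Q ^ m.
  by rewrite exprnP -expfzDr ?sqr_neq0 //; congr (Q ^ _); lia.
by ring.
Qed.

Lemma V0_succ B n : (n.+1 < B)%N -> V0 B n = (1 - Q ^+ (2 * n.+1)) * U B n.+1.
Proof.
move=> nB; rewrite mulrBl mul1r mul2n -addnn exprD -mulrA -X_U // -bsum_opp U_refl -bsumZ -bsumN -bsumD.
apply: eq_bsum => m; rewrite ecN subrr opprK.
have -> : n%:Z - m = n.+1%:Z - m - 1 by lia.
have -> : n%:Z + m + 1 = n.+1%:Z + m by lia.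
rewrite (iq_pred Q1) -[ec 3 2 m](ec_lin 3 0).
have -> : Q ^+ n.+1 = Q ^ (n.+1%:Z - m) * Q ^ m.
  by rewrite exprnP -expfzDr ?sqr_neq0 //; congr (Q ^ _); lia.
by ring.
Qed.

Lemma U_closed B n : (n < B)%N -> U B n = (qf2 n * qm n)^-1.
Proof.
elim: n => [|n IH] nB.
  rewrite /U /bsum big1 => [|k _].
    rewrite addr0 /qf2 /qm !big_ord0 mulr1 invr1 /ec -[3 * tri 0 + 1 * 0]/(0 : int) !expr0z !mul1r.
    by rewrite [iq Q (0%:Z - 0)]iq0 ?mulr1.
  by rewrite [iq _ (0%:Z - _)]iq_neg ?mul0r ?mulr0 ?add0r // [iq _ (0%:Z + - _)]iq_neg ?mulr0.
apply: (mulfI (p1 n)); rewrite -[LHS]mul1r.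
have e : 1 - Q ^+ (2 * n.+1) != 0 by rewrite mulnS; exact: Q1.
apply: (mulfI e); rewrite mul1r [LHS]mulrCA -V0_succ // -V0E ?(ltnW nB) // IH ?(ltnW nB) //.
rewrite /qf2 /qm !big_ord_recr /= -/(qf2 n) -/(qm n).
have := qf2_neq0 n; have := qm_neq0 n; have := p1 n; move: e.
move: (1 - Q ^+ (2 * n.+1)) (1 + p * Q ^+ n) (qf2 n) (qm n) => a b c d a0 b0 d0 c0.
by field; rewrite ?a0 ?b0 ?c0 ?d0.
Qed.

(** The parameter dl becomes the first entry of the linear form: 1 for the vector b_0, 0 for the
    other b_j. *)
Lemma base_pair (B n : nat) (dl : bool) : (n < B)%N ->
  bsum B (fun m => ec 3 (dl.+1)%:Z m * (iq Q (n%:Z - m) * iq Q (n%:Z + m + 1%:Z)))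
  = (qf2 n * qm (n + dl))^-1.
Proof.
move=> nB; case: dl; last by rewrite addn0 -(@U_closed B) // -V1E.
rewrite addn1 /qm big_ord_recr /= -/(qm n).
apply: (mulfI (p1 n)); have := @V0E B n nB; rewrite /V0 => <-; rewrite U_closed //.
have := qf2_neq0 n; have := qm_neq0 n; have := p1 n.
move: (1 + p * Q ^+ n) (qf2 n) (qm n) => b c d b0 d0 c0.
by field; rewrite ?b0 ?c0 ?d0.
Qed.

Definition chain_step (s : nat) (k : nat) : F := Q ^+ (k * (k + s)).

(* The chain N_1 >= N_2 >= ... is encoded by its successive differences v, so
   that N_i is the sum of the i-th suffix of v. *)
Fixpoint chain_weight (s : nat) (ss : seq nat) (be : nat -> F) (v : seq nat) : F :=
  chain_step s (sumn v) *
  (if ss is s' :: ss' then iq Q (head 0 v)%N * chain_weight s' ss' be (behead v)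
   else be (head 0 v)%N).

Fixpoint boxes (B l : nat) : seq (seq nat) :=
  if l is l'.+1 then [seq k :: v | k <- iota 0 B.+1, v <- boxes B l'] else [:: [::]].

#[local] Arguments boxes : simpl never.

Fixpoint chain_sum (ss : seq nat) (be : nat -> F) (N : nat) : F :=
  if ss is s :: ss' then
    \sum_(k < N.+1) iq Q (N%:Z - k%:Z) * (chain_step s k * chain_sum ss' be k)
  else be N.

Lemma big_boxes (B l : nat) (f : seq nat -> F) :
  \sum_(v <- boxes B l.+1) f v = \sum_(k < B.+1) \sum_(v <- boxes B l) f (val k :: v).
Proof.
rewrite -[boxes B l.+1]/[seq k :: v | k <- iota 0 B.+1, v <- boxes B l] big_allpairs_dep.
rewrite -(big_mkord xpredT (fun k => \sum_(v <- boxes B l) f (k :: v))).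
by rewrite /index_iota subn0.
Qed.

(** With k = n + t, all terms outside t <= k <= N vanish because [iq] is 0 at negative arguments;
    this is how sums over boxes become the nested sums of the chain. *)
Lemma shift_box (B N t : nat) (h : nat -> F) : (N <= B)%N ->
  \sum_(n < B.+1) iq Q (N%:Z - (n + t)%N%:Z) * (h (n + t)%N * iq Q n)
  = \sum_(k < N.+1) iq Q (N%:Z - k%:Z) * (h k * iq Q (k%:Z - t%:Z)).
Proof.
move=> NB.
pose g k := iq Q (N%:Z - k%:Z) * (h k * iq Q (k%:Z - t%:Z)).
have big0 k : (N < k)%N -> g k = 0.
  by move=> Nk; rewrite /g iq_neg ?mul0r //; lia.
have small k : (k < t)%N -> g k = 0.
  by move=> kt; rewrite /g [iq Q (k%:Z - _)]iq_neg ?mulr0 //; lia.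
transitivity (\sum_(n < B.+1) g (n + t)%N).
  by apply: eq_bigr => n _; rewrite /g PoszD addrK.
rewrite -(big_mkord xpredT (fun n => g (n + t)%N)) -{1}[B.+1](addnK t) -(big_addn 0 (B.+1 + t) t xpredT g) add0n.
have ext n : (N < n)%N -> \sum_(0 <= k < n) g k = \sum_(k < N.+1) g k.
  move=> Nn; rewrite (@big_cat_nat _ _ _ N.+1) //= [X in _ + X]big_nat [X in _ + X]big1.
    by rewrite addr0 big_mkord.
  by move=> k /andP[h1 _]; exact: big0.
rewrite -(ext (B.+1 + t)%N); last by lia.
rewrite [RHS](@big_cat_nat _ _ _ t) //=; last by rewrite leq_addl.
by rewrite [X in X + _]big_nat [X in X + _]big1 ?add0r // => k /andP[_ h1]; exact: small.
Qed.

Lemma chain_boxes (B : nat) (s : nat) (ss : seq nat) (be : nat -> F) (N : nat) : (N <= B)%N ->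
  \sum_(v <- boxes B (size ss).+1) iq Q (N%:Z - (sumn v)%:Z) * chain_weight s ss be v
  = chain_sum (s :: ss) be N.
Proof.
elim: ss s N => [|s' ss IH] s N NB.
  rewrite big_boxes /=.
  under eq_bigr do rewrite big_seq1 /= addn0.
  rewrite -!(big_mkord xpredT (fun k => iq Q (N%:Z - k%:Z) * (chain_step s k * be k))).
  rewrite (@big_cat_nat _ _ _ N.+1) //= [X in _ + X]big_nat [X in _ + X]big1 ?addr0 //.
  by move=> k /andP[h1 _]; rewrite iq_neg ?mul0r //; lia.
rewrite big_boxes exchange_big /=.
under eq_bigr => v _.
  under eq_bigr => k _ do rewrite mulrA mulrA -mulrA -[iq Q _ * _ * _]mulrA.
  over.
rewrite (eq_bigr (fun v => \sum_(n < B.+1) (iq Q (N%:Z - (n + sumn v)%N%:Z) *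
    ((chain_step s (n + sumn v)%N * chain_weight s' ss be v) * iq Q n)))); last first.
  by move=> v _; apply: eq_bigr => n _ /=; ring.
under eq_bigr => v _ do rewrite (@shift_box B N (sumn v) (fun k => chain_step s k * chain_weight s' ss be v)) //.
rewrite exchange_big /=; apply: eq_bigr => k _.
rewrite -[X in _ = _ * (_ * X)]/(chain_sum (s' :: ss) be k) -(IH s' k); last by have := ltn_ord k; lia.
by rewrite !mulr_sumr; apply: eq_bigr => v _; ring.
Qed.

Lemma chain_weight_sum (s : nat) (ss : seq nat) (n : nat) (be : 'I_n -> nat -> F) v :
  \sum_(i < n) chain_weight s ss (be i) v = chain_weight s ss (fun k => \sum_(i < n) be i k) v.
Proof.
elim: ss s v => [|s' ss IH] s v /=; first by rewrite mulr_sumr.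
by rewrite -IH !mulr_sumr.
Qed.

Lemma eq_chain_sum ss (be be' : nat -> F) N : (forall k, (k <= N)%N -> be k = be' k) ->
  chain_sum ss be N = chain_sum ss be' N.
Proof.
elim: ss N => [|s ss IH] N h /=; first exact: h.
apply: eq_bigr => k _; do 2 congr (_ * _).
by apply: IH => i ik; apply: h; have := ltn_ord k; lia.
Qed.

Lemma chain_sumZ a ss (be : nat -> F) N :
  chain_sum ss (fun k => a * be k) N = a * chain_sum ss be N.
Proof.
elim: ss N => [|s ss IH] N //=; rewrite mulr_sumr; apply: eq_bigr => k _.
by rewrite IH; ring.
Qed.

Lemma chain_sum_cat s1 s2 (be : nat -> F) N :
  chain_sum (s1 ++ s2) be N = chain_sum s1 (chain_sum s2 be) N.
Proof.
elim: s1 N => [|s ss IH] N //=; apply: eq_bigr => k _.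
by rewrite IH.
Qed.

Lemma chain_sum_nseq (B s a : nat) (k l : int) N : (s <= 1)%N ->
  chain_sum (nseq a s) (fun n => bsum B (fun m => ec k l m * (iq Q (n%:Z - m) * iq Q (n%:Z + m + s%:Z)))) N
  = bsum B (fun m => ec (k + 4 * a%:Z) (l + (2 + 2 * s%:Z) * a%:Z) m *
      (iq Q (N%:Z - m) * iq Q (N%:Z + m + s%:Z))).
Proof.
move=> s1; elim: a N => [|a IH] N /=.
  by apply: eq_bsum => m; congr (ec _ _ _ * _); ring.
under eq_bigr do rewrite IH.
rewrite (bailey_step sqr_neq0 Q1) //; apply: eq_bsum => m; rewrite ec_step.
by congr (ec _ _ _ * _); lia.
Qed.

Lemma bailey_chain0 (B a N : nat) : (N < B)%N ->
  chain_sum (nseq a 1%N) (fun n => (qf2 n * qm n.+1)^-1) N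
  = bsum B (fun m => ec (4 * a%:Z + 3) (4 * a%:Z + 2) m * (iq Q (N%:Z - m) * iq Q (N%:Z + m + 1%:Z))).
Proof.
move=> NB; rewrite (@eq_chain_sum _ _ (fun n => bsum B (fun m => ec 3 2 m * (iq Q (n%:Z - m) * iq Q (n%:Z + m + 1%:Z))))).
  by rewrite chain_sum_nseq //; apply: eq_bsum => m; congr (ec _ _ _ * _); ring.
by move=> k kN; rewrite -addn1 -(@base_pair B k true) //; lia.
Qed.

(** The a inner steps are relative to Q and the b outer ones relative to 1. After the inner steps k
    - l = 2, which is the symmetry that [bailey_switch] requires between the two. *)
Lemma bailey_chain1 (B a b N : nat) : (N < B)%N ->
  chain_sum (nseq b 0%N ++ nseq a 1%N) (fun n => (qf2 n * qm n)^-1) N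
  = bsum B (fun m => ec (4 * (a + b)%:Z + 3) (4 * a%:Z + 2 * b%:Z + 1) m *
      (iq Q (N%:Z - m) * iq Q (N%:Z + m + 0%:Z))).
Proof.
move=> NB; rewrite chain_sum_cat.
rewrite (@eq_chain_sum _ _ (fun n => bsum B (fun m =>
  ec (3 + 4 * a%:Z) (1 + 4 * a%:Z) m * (iq Q (n%:Z - m) * iq Q (n%:Z + m + 0%:Z))))).
  by rewrite chain_sum_nseq //; apply: eq_bsum => m; congr (ec _ _ _ * _); lia.
move=> k kN; rewrite (@eq_chain_sum _ _ (fun n => bsum B (fun m => ec 3 1 m * (iq Q (n%:Z - m) * iq Q (n%:Z + m + 1%:Z))))).
  rewrite chain_sum_nseq // -(bailey_switch sqr_neq0 Q1) ?(leq_ltn_trans kN) //.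
    move=> m; rewrite ec_reflect QzE mulrC; congr (- _).
    by rewrite /ec -!mulrA -!expfzDr //; congr (_ * p ^ _); ring.
by move=> i ik; rewrite (@base_pair B i false) ?addn0 //; lia.
Qed.

(** The part of a Nahm term that depends on n_1, with n = n_r: the factor 1 / (Q;Q)_(n_1) is
    replaced by a Gaussian binomial coefficient with upper entry N - n, which tends to it as N
    grows. *)
Definition nahm_beta (dl N n1 n : nat) : F :=
  p ^+ (n1 * n1 + 2 * n1 * (n + dl)) * iq Q n1 * iq Q (N%:Z - n%:Z - n1%:Z) * qf Q (N - n)
  / qf2 n.

Definition nahm_finite (dl : nat) (s : nat) (ss : seq nat) (N : nat) (v : seq nat) : F :=
  iq Q (N%:Z - (sumn (behead v))%:Z) *
  chain_weight s ss (nahm_beta dl N (head 0 v)%N) (behead v).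

(** The q-binomial theorem with x = Q^(n + dl) evaluates the sum over n_1 as (-p;Q)_(N + dl) /
    (-p;Q)_(n + dl); together with 1 / [qf2 n] this is the right side of the base pair, times a
    factor free of n. *)
Lemma nahm_beta_sum (dl N n : nat) : (n <= N)%N ->
  \sum_(n1 < N.+1) nahm_beta dl N n1 n = qm (N + dl) * (qf2 n * qm (n + dl))^-1.
Proof.
move=> nN; rewrite -(big_mkord xpredT (fun n1 => nahm_beta dl N n1 n)).
rewrite (@big_cat_nat _ _ _ (N - n).+1) //=; last by lia.
rewrite [X in _ + X]big_nat [X in _ + X]big1 ?addr0; last first.
  move=> k /andP[h _]; rewrite /nahm_beta [iq _ (_ - _ - _)]iq_neg ?(mulr0, mul0r) //.
  by lia.
rewrite big_mkord.
have := @qbinomial F Q sqr_neq0 Q1 p (Q ^+ (n + dl)) (N - n) erefl.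
move=> h; transitivity (\prod_(i < N - n) (1 + Q ^+ (n + dl) * p * Q ^+ i) / qf2 n).
  apply: (mulIf (qf2_neq0 n)); rewrite divfK ?qf2_neq0 //.
  have e : iq Q (N - n)%N * qf Q (N - n) = 1 by rewrite iq_pos mulVf // qf_neq0.
  have -> : \prod_(i < N - n) (1 + Q ^+ (n + dl) * p * Q ^+ i)
      = \prod_(i < N - n) (1 + Q ^+ (n + dl) * p * Q ^+ i) * iq Q (N - n)%N * qf Q (N - n).
    by rewrite -mulrA e mulr1.
  rewrite -h !mulr_suml; apply: eq_bigr => k _.
  rewrite /nahm_beta divfK ?qf2_neq0 //; rewrite exprD; congr (_ * _ * _ * _ * _).
    by rewrite /Q -!exprM; congr (_ ^+ _); lia.
  by congr (iq Q _); lia.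
have -> : (N + dl = (n + dl) + (N - n))%N by lia.
rewrite {1}/qm big_split_ord /= -/(qm (n + dl)) (eq_bigr (fun i : 'I_(N - n) => 1 + p * Q ^+ (n + dl + i))).
  move: (\prod_(i < N - n) _) => P; have := qf2_neq0 n; have := qm_neq0 (n + dl).
  by move: (qf2 n) (qm (n + dl)) => x y y0 x0; field; rewrite ?x0 ?y0.
by move=> i _; rewrite [in RHS](exprD _ (n + dl)); ring.
Qed.

Lemma nahm_finite_sum (dl s : nat) (ss : seq nat) (N : nat) :
  \sum_(v <- boxes N (size ss).+2) nahm_finite dl s ss N v
  = qm (N + dl) * chain_sum (s :: ss) (fun n => (qf2 n * qm (n + dl))^-1) N.
Proof.
rewrite big_boxes exchange_big; transitivity (\sum_(v <- boxes N (size ss).+1) \sum_(i < N.+1)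
  iq Q (N%:Z - (sumn v)%:Z) * chain_weight s ss (nahm_beta dl N i) v) => //.
under eq_bigr do rewrite -mulr_sumr chain_weight_sum.
rewrite (chain_boxes s ss _ (leqnn N)) -(chain_sumZ _ (s :: ss)); apply: eq_chain_sum => k kN.
exact: nahm_beta_sum.
Qed.

Lemma nahm_finite_out (dl s : nat) (ss : seq nat) (N : nat) (v : seq nat) :
  size v = (size ss).+2 -> has (fun n => (N < n)%N) v -> nahm_finite dl s ss N v = 0.
Proof.
case: v => // n1 v /= [sv]; rewrite /nahm_finite /=.
case: (ltnP N (sumn v)) => [h _|vN]; first by rewrite iq_neg ?mul0r //; lia.
case/orP => [h|]; last first.
  move=> /hasP[x xv Nx]; have : (x <= sumn v)%N.
    by move: xv; elim: (v) => // y w IH; rewrite inE /= => /orP[/eqP ->|/IH]; lia.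
  by lia.
suff -> : forall ss' s' w, chain_weight s' ss' (nahm_beta dl N n1) w = 0 by rewrite mulr0.
elim=> [|s1 ss1 IH] s' w /=; last by rewrite IH !mulr0.
by rewrite /nahm_beta [iq _ (_ - _ - _)]iq_neg ?(mulr0, mul0r) //; lia.
Qed.

End BasePairs.

(** * Evaluation of the Nahm sum *)

Section Limits.
Variables (R : realType) (K : cplxField R).

Lemma cvg_qf (q : K) : nm q < 1 -> (fun n => qf q n) @ \oo --> poch q q.
Proof.
move=> q1; have h := @cvg_poch R K q q q1.
apply: cvg_trans h; apply: near_eq_cvg; apply: nearW => n.
by apply: eq_bigr => k _; rewrite exprS.
Qed.

Lemma qf_sub_neq0 (q : K) : nm q < 1 -> forall n, 1 - q ^+ n.+1 != 0.
Proof. by move=> q1 n; apply: sub1_neq0; apply: nmX_lt1. Qed.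

Lemma cvg_bounded (f : nat -> K) (l : K) : f @ \oo --> l -> exists2 C : R, 1 <= C & forall n, nm (f n) <= C.
Proof.
move=> /cvgnmP /(_ 1 ltr01) [N _ hN].
exists (1 + (nm l + 1) + \sum_(k < N) nm (f k)) => [|n].
  have : 0 <= \sum_(k < N) nm (f k) by apply: sumr_ge0 => k _; exact: nm_ge0.
  by have := nm_ge0 l; lra.
have h0 : 0 <= \sum_(k < N) nm (f k) by apply: sumr_ge0 => k _; exact: nm_ge0.
case: (ltnP n N) => [nN|/hN].
  rewrite (bigD1 (Ordinal nN)) //=.
  have : 0 <= \sum_(k < N | k != Ordinal nN) nm (f k) by apply: sumr_ge0 => k _; exact: nm_ge0.
  by have := nm_ge0 l; lra.
have := nmD (f n - l) l; rewrite subrK; lra.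
Qed.

Lemma cvg_iq (q : K) : nm q < 1 -> (fun n : nat => iq q n) @ \oo --> (poch q q)^-1.
Proof.
move=> q1; have h : poch q q != 0 by exact: poch_neq0_lt1.
have := cvg_qf q1; exact: cvgV.
Qed.

Lemma iq_bounded (q : K) : nm q < 1 -> exists2 C : R, 1 <= C & forall m, nm (iq q m) <= C.
Proof.
move=> q1; have [C C1 hC] := cvg_bounded (cvg_iq q1); exists C => // -[n|n]; first exact: hC.
by rewrite nm0; lra.
Qed.

Lemma cvg_iq_shift (q : K) (f : nat -> int) (k : nat) : nm q < 1 ->
  (forall n, n%:Z <= f n + k%:Z) -> (fun n => iq q (f n)) @ \oo --> (poch q q)^-1.
Proof.
move=> q1 hf; have /cvgnmP h := cvg_iq q1; apply/cvgnmP => e /h [N _ hN].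
exists (N + k)%N => // n /= Nn.
have := hf n; case: (f n) => [m|m] hm; last by lia.
by apply: hN => /=; lia.
Qed.

(** The value is quantified before the truncating factors f, so it can be computed afterwards from a
    more convenient choice of f. *)
Lemma bsum_cvg (c : int -> K) (r C : R) : 0 <= r -> r < 1 ->
  (forall m, nm (c m) <= C * r ^+ `|m|%N) ->
  exists th : K, forall (f : nat -> int -> K) (B : nat -> nat) (a : K) (D : R),
    (forall n m, nm (f n m) <= D) ->
    (forall m, (fun n => f n m) @ \oo --> a) ->
    (forall n m, (B n <= m)%N -> f n m.+1%:Z = 0 /\ f n (- m.+1%:Z) = 0) ->
    (fun n => bsum (B n) (fun m => c m * f n m)) @ \oo --> a * th.
Proof.
move=> r0 r1 hc.
have C0 : 0 <= C by have := hc 0; rewrite expr0 mulr1; apply: le_trans; exact: nm_ge0.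
pose b k := C * r ^+ k.+1 + C * r ^+ k.+1.
have b0 k : 0 <= b k by rewrite /b addr_ge0 // mulr_ge0 ?exprn_ge0.
have hb n : \sum_(k < n) b k <= 2 * C * (1 - r)^-1.
  rewrite /b big_split /= -mulr_sumr.
  have : \sum_(k < n) r ^+ k.+1 <= (1 - r)^-1.
    apply: le_trans (geo_sum_le n.+1 r0 r1); rewrite big_ord_recl /=.
    by rewrite ler_wpDl ?exprn_ge0.
  move=> h; have := ler_wpM2l C0 h; lra.
have hck k : nm (c k.+1%:Z) <= C * r ^+ k.+1 by exact: hc.
have hcN k : nm (c (- k.+1%:Z)) <= C * r ^+ k.+1 by have := hc (- k.+1%:Z); rewrite abszN.
have [S [hS _]] := @dominated_series R K b _ (fun=> fun k => c k.+1%:Z + c (- k.+1%:Z)) (fun k => c k.+1%:Z + c (- k.+1%:Z))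
  hb (fun n k => le_trans (nmD _ _) (lerD (hck k) (hcN k))) (fun k => cvg_cst _).
exists (c 0 + S) => f B a D hD fa fB.
have D0 : 0 <= D by apply: le_trans (hD 0%N 0); exact: nm_ge0.
rewrite mulrDr; apply: cvgD.
  by rewrite mulrC; apply: cvgM; [exact: cvg_cst|exact: fa].
have le1 n k : nm (c k.+1%:Z * f n k.+1%:Z + c (- k.+1%:Z) * f n (- k.+1%:Z)) <= D * b k.
  apply: le_trans (nmD _ _) _; rewrite /b mulrDr !nmM; apply: lerD; rewrite [D * _]mulrC.
    by apply: ler_pM; rewrite ?nm_ge0.
  by apply: ler_pM; rewrite ?nm_ge0.
have hl k : (fun n => c k.+1%:Z * f n k.+1%:Z + c (- k.+1%:Z) * f n (- k.+1%:Z)) @ \oo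
    --> a * (c k.+1%:Z + c (- k.+1%:Z)).
  rewrite mulrDr ![a * _]mulrC; apply: cvgD; apply: cvgMn; by [exact: cvg_cst|exact: fa].
have hb' n : \sum_(k < n) D * b k <= D * (2 * C * (1 - r)^-1).
  by rewrite -mulr_sumr ler_wpM2l.
have [S' [hS' hS'']] := dominated_series hb' le1 hl.
have -> : a * S = S'.
  have h1 : (fun n => a * \sum_(k < n) (c k.+1%:Z + c (- k.+1%:Z))) @ \oo --> a * S.
    by apply: cvgM; [exact: cvg_cst|exact: hS].
  apply: cvgC_unique h1 _; under eq_fun do rewrite mulr_sumr; exact: hS'.
by apply: hS'' => n k /fB[-> ->]; rewrite !mulr0 addr0.
Qed.

Section Theta.
Variables (p : K) (M l : nat).
Hypotheses (p0 : p != 0) (p1 : nm p < 1) (l0 : (0 < l)%N) (lM : (l < M)%N).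

(** The exponent is at least |m|: l > 0 gives this for m >= 0, and l < M for m < 0. *)
Lemma nm_ec_le m : nm (ec p M l m) <= 1 * nm p ^+ `|m|%N.
Proof.
have sgn1 : nm ((-1 : K) ^ m) = 1.
  by case: m => n; rewrite /exprz ?nmV nmX nmN nm1 expr1n ?invr1.
rewrite /ec nmM sgn1 !mul1r.
have h2 : (M%:Z * tri m + l%:Z * m) * 2 = M%:Z * (m * (m - 1)) + 2 * l%:Z * m.
  by rewrite -tri2; ring.
have h : `|m|%N%:Z <= M%:Z * tri m + l%:Z * m.
  have : `|m|%N%:Z * 2 <= M%:Z * (m * (m - 1)) + 2 * l%:Z * m.
    have nn (n : nat) : 0 <= n%:Z * (n%:Z - 1) by case: n => // n; rewrite mulr_ge0 //; lia.
    case: m {sgn1 h2} => n.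
      rewrite absz_nat; have h1 := mulr_ge0 (isT : 0 <= M%:Z) (nn n).
      have h2 : 0 <= (l%:Z - 1) * n%:Z by rewrite mulr_ge0 //; lia.
      by lra.
    rewrite NegzE abszN absz_nat.
    have h1 := mulr_ge0 (isT : 0 <= l%:Z + 1) (nn n.+1).
    have h2 : 0 <= (M%:Z - l%:Z - 1) * (n.+1%:Z * (n.+1%:Z + 1)) by rewrite mulr_ge0 //; lia.
    by lra.
  by rewrite -h2; lia.
move: (M%:Z * tri m + l%:Z * m) h => e h.
have -> : e = (`|m| + `|e - `|m|%N%:Z|)%N by lia.
rewrite -exprnP nmX exprD ler_piMr ?exprn_ge0 ?nm_ge0 //.
by rewrite exprn_ile1 ?nm_ge0 // ltW.
Qed.

Lemma cvg_bsum_iq (q : K) (sg : nat) (c : int -> K) (th : K) : nm q < 1 ->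
  (forall (f : nat -> int -> K) (B : nat -> nat) (a : K) (D : R),
    (forall n m, nm (f n m) <= D) ->
    (forall m, (fun n => f n m) @ \oo --> a) ->
    (forall n m, (B n <= m)%N -> f n m.+1%:Z = 0 /\ f n (- m.+1%:Z) = 0) ->
    (fun n => bsum (B n) (fun m => c m * f n m)) @ \oo --> a * th) ->
  (fun N => bsum (N + sg).+1 (fun m => c m * (iq q (N%:Z - m) * iq q (N%:Z + m + sg%:Z)))) @ \oo
    --> (poch q q)^-1 * (poch q q)^-1 * th.
Proof.
move=> q1 H; have [C C1 hC] := iq_bounded q1.
apply: (H _ _ _ (C * C)).
- by move=> n m; rewrite nmM; apply: ler_pM; rewrite ?nm_ge0.
- by move=> m; apply: cvgMn; apply: (@cvg_iq_shift _ _ `|m|%N) => // n; lia.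
- move=> n m nm; split.
    by rewrite [iq q (_ - _)]iq_neg ?mul0r //; lia.
  by rewrite [iq q (_ + _ + _)]iq_neg ?mulr0 //; lia.
Qed.

Definition theta_prod : K :=
  poch (p ^+ l) (p ^+ M) * poch (p ^+ (M - l)) (p ^+ M) * poch (p ^+ M) (p ^+ M).

(** The theta series does not involve q. It is summed with p^M in place of q and with sg = 0, where
    the finite triple product evaluates every truncation. *)
Lemma cvg_theta (q : K) (sg : nat) : nm q < 1 ->
  (fun N => bsum (N + sg).+1 (fun m => ec p M l m * (iq q (N%:Z - m) * iq q (N%:Z + m + sg%:Z)))) @ \oo
    --> (poch q q)^-1 * (poch q q)^-1 * theta_prod.
Proof.
move=> q1; have [th hth] := bsum_cvg (nm_ge0 p) p1 nm_ec_le.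
suff -> : theta_prod = th by exact: cvg_bsum_iq.
pose P := p ^+ M; have M0 : (0 < M)%N by exact: leq_ltn_trans lM.
have P1 : nm P < 1 by exact: nmX_lt1.
have P0 : P != 0 by rewrite expf_neq0.
have PP : poch P P != 0 by exact: poch_neq0_lt1.
have h1 := cvg_bsum_iq 0 P1 hth.
have h2 : (fun N => bsum (N + 0).+1 (fun m => ec p M l m * (iq P (N%:Z - m) * iq P (N%:Z + m + 0%:Z)))) @ \oo
   --> poch (p ^+ l) P * poch (p ^+ (M - l)) P * (poch P P)^-1.
  have e N : bsum (N + 0).+1 (fun m => ec p M l m * (iq P (N%:Z - m) * iq P (N%:Z + m + 0%:Z)))
     = (\prod_(i < N) (1 - p ^+ l * P ^+ i) * \prod_(i < N) (1 - p ^+ (M - l) * P ^+ i)) * iq P (2 * N)%N.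
    rewrite -big_split /= addn0.
    have := @finite_triple_product K P P0 (qf_sub_neq0 P1) N.+1 N (p ^+ l) (expf_neq0 _ p0) (ltnSn N).
    rewrite (eq_bigr (fun i : 'I_N => (1 - p ^+ l * P ^+ i) * (1 - p ^+ (M - l) * P ^+ i))).
      move=> <-; apply: eq_bsum => m; congr (_ * _); rewrite /ec -mulrA; congr (_ * _).
      by rewrite /P !exprnP !exprz_exp -expfzDr // addrC.
    move=> i _; congr (_ * (1 - _)); rewrite exprS mulrA; congr (_ * _).
    by rewrite /P -{1}(subnK (ltnW lM)) exprD mulrC mulfK ?expf_neq0.
  under eq_fun do rewrite e.
  apply: cvgMn; first by apply: cvgMn; exact: cvg_poch.
  by apply: (@cvg_iq_shift _ _ 0%N) => // n; lia.
have := cvgC_unique h1 h2; rewrite /theta_prod -/P => h.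
apply: (mulfI (mulf_neq0 (invr_neq0 PP) (invr_neq0 PP))); rewrite h.
by move: (poch _ _) (poch (p ^+ (M - l)) _) (poch P P) PP => x y z z0; field.
Qed.

End Theta.

Lemma mem_boxes B l v : (v \in boxes B l) = (size v == l) && all (fun k => (k <= B)%N) v.
Proof.
elim: l v => [|l IH] v; first by rewrite inE; case: v.
apply/allpairsPdep/andP => [[k [w [+ + ->]]]|].
  by rewrite mem_iota /= IH add0n ltnS eqSS => -> /andP[-> ->].
case: v => [|k w] []; first by rewrite eq_sym.
rewrite eqSS /= => sw /andP[kB wB]; exists k, w; split=> //.
  by rewrite -[0%N :: iota 1 B]/(iota 0 B.+1) mem_iota add0n ltnS.
by rewrite IH; apply/andP.
Qed.

Lemma uniq_boxes B l : uniq (boxes B l).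
Proof.
elim: l => // l IH; apply: allpairs_uniq_dep; rewrite ?iota_uniq //.
by move=> [a b] [a' b'] _ _ /= [-> ->].
Qed.

(** * Summation vectors as sequences *)

Section Vectors.
Variable (r : nat).
Local Open Scope fset_scope.
Local Open Scope ring_scope.

Definition vec_seq (x : 'cV[nat]_r) : seq nat := [seq x i 0 | i <- enum 'I_r].
Definition seq_vec (v : seq nat) : 'cV[nat]_r := \col_i nth 0%N v i.

Lemma size_vec_seq x : size (vec_seq x) = r.
Proof. by rewrite size_map size_enum_ord. Qed.

Lemma nth_vec_seq x (i : 'I_r) : nth 0%N (vec_seq x) i = x i 0.
Proof. by rewrite (nth_map i) ?size_enum_ord // nth_ord_enum. Qed.

Lemma seq_vecK v : size v = r -> vec_seq (seq_vec v) = v.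
Proof.
move=> sv; apply: (@eq_from_nth _ 0%N); rewrite size_vec_seq // => i ir.
by rewrite (nth_vec_seq _ (Ordinal ir)) mxE.
Qed.

Lemma vec_seqK : cancel vec_seq seq_vec.
Proof. by move=> x; apply/colP => i; rewrite mxE nth_vec_seq. Qed.

Definition box_set (B : nat) : {fset 'cV[nat]_r} := [fset seq_vec v | v in boxes B r].

Lemma mem_box_set B x : (x \in box_set B) = all (fun k => (k <= B)%N) (vec_seq x).
Proof.
apply/imfsetP/idP => [[v /=]|h].
  by rewrite mem_boxes => /andP[/eqP sv h] ->; rewrite seq_vecK.
by exists (vec_seq x); rewrite ?vec_seqK //= mem_boxes size_vec_seq eqxx.
Qed.

Lemma sum_box_set (V : nmodType) (B : nat) (f : seq nat -> V) :
  \sum_(x <- box_set B) f (vec_seq x) = \sum_(v <- boxes B r) f v.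
Proof.
rewrite big_imfset /=; last first.
  move=> v w; rewrite !mem_boxes => /andP[/eqP sv _] /andP[/eqP sw _] h.
  by rewrite -(seq_vecK sv) h seq_vecK.
rewrite (perm_big (boxes B r)) /=; last first.
  by rewrite undup_id ?uniq_boxes.
rewrite !big_seq; apply: eq_bigr => v; rewrite mem_boxes => /andP[/eqP sv _].
by rewrite seq_vecK.
Qed.

Lemma sub_box_set (J : {fset 'cV[nat]_r}) : exists B, J `<=` box_set B.
Proof.
exists (\max_(x <- J) \max_(k <- vec_seq x) k); apply/fsubsetP => x xJ.
rewrite mem_box_set; apply/allP => k kx.
apply: leq_trans (leq_bigmax_seq (F := fun x => \max_(k <- vec_seq x) k) x xJ isT).
exact: leq_bigmax_seq.
Qed.

Lemma sum_geo_vec (rho C : R) (J : {fset 'cV[nat]_r}) : 0 <= rho -> rho < 1 -> 0 <= C ->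
  \sum_(x <- J) C * rho ^+ sumn (vec_seq x) <= C * ((1 - rho)^-1) ^+ r.
Proof.
move=> r0 r1 C0; have [B JB] := sub_box_set J.
apply: (@le_trans _ _ (\sum_(x <- box_set B) C * rho ^+ sumn (vec_seq x))).
  rewrite (sum_fsetID _ (box_set B) J) (fsetIidPr JB) lerDl.
  by apply: sumr_ge0 => x _; rewrite mulr_ge0 ?exprn_ge0.
rewrite (sum_box_set B (fun v => C * rho ^+ sumn v)) -mulr_sumr ler_wpM2l //.
elim: r => [|l IH]; first by rewrite big_seq1 /= !expr0.
rewrite big_boxes exprS.
under eq_bigr => k _.
  under eq_bigr do rewrite /= exprD.
  rewrite -mulr_sumr; over.
rewrite -mulr_suml; apply: ler_pM => //.
- by apply: sumr_ge0 => k _; rewrite exprn_ge0.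
- by apply: sumr_ge0 => k _; rewrite exprn_ge0.
- exact: geo_sum_le.
Qed.

End Vectors.

(** * The limit of the truncated Nahm sums *)

Section NahmLimit.
Variables (p : K).
Hypotheses (p0 : p != 0) (p1 : nm p < 1).
Let Q := p ^+ 2.

Let Q1 : nm Q < 1. Proof. exact: nmX_lt1. Qed.

Definition nahm_beta_lim (dl n1 n : nat) : K :=
  p ^+ (n1 * n1 + 2 * n1 * (n + dl)) * iq Q n1 / qf2 p n.

Lemma cvg_qf2 : (fun n => qf2 p n) @ \oo --> poch (Q ^+ 2) (Q ^+ 2).
Proof.
apply: cvg_trans (@cvg_poch R K (Q ^+ 2) (Q ^+ 2) _); last exact: nmX_lt1.
apply: near_eq_cvg; apply: nearW => n; apply: eq_bigr => k _.
by rewrite -[p ^+ 2]/Q -!exprM -exprD; congr (1 - _ ^+ _); lia.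
Qed.

Lemma cvg_qm (dl : nat) : (fun N => qm p (N + dl)) @ \oo --> poch (- p) Q.
Proof.
have h := @cvg_poch R K (- p) Q Q1.
have : (fun n => qm p n) @ \oo --> poch (- p) Q.
  apply: cvg_trans h; apply: near_eq_cvg; apply: nearW => n.
  by apply: eq_bigr => k _; rewrite mulNr opprK.
by rewrite -(cvg_shiftn dl); under eq_fun do rewrite addnC.
Qed.

Lemma cvg_nahm_beta dl n1 n : (fun N => nahm_beta p dl N n1 n) @ \oo --> nahm_beta_lim dl n1 n.
Proof.
have PQ : poch Q Q != 0 by exact: poch_neq0_lt1.
have -> : nahm_beta_lim dl n1 n = p ^+ (n1 * n1 + 2 * n1 * (n + dl)) * iq Q n1 * (poch Q Q)^-1 * poch Q Q / qf2 p n.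
  by rewrite /nahm_beta_lim mulfVK.
apply: cvgMn; last exact: cvg_cst.
apply: cvgMn; first apply: cvgMn.
- exact: cvg_cst.
- by apply: (@cvg_iq_shift _ _ (n + n1)%N) => // N; lia.
have := cvg_qf Q1; rewrite -(cvg_shiftn n) => h.
have /cvgnmP h2 := cvg_qf Q1; apply/cvgnmP => e /h2 [N0 _ hN]; exists (N0 + n)%N => // N /= NN.
by apply: hN => /=; lia.
Qed.

Lemma cvg_chain_weight s ss (be : nat -> nat -> K) be' v :
  (forall n, (fun N => be N n) @ \oo --> be' n) ->
  (fun N => chain_weight p s ss (be N) v) @ \oo --> chain_weight p s ss be' v.
Proof.
move=> h; elim: ss s v => [|s' ss IH] s v /=; apply: cvgMn; try exact: cvg_cst.
  exact: h.
by apply: cvgMn; [exact: cvg_cst|exact: IH].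
Qed.

Lemma nm_chain_step s n : nm (chain_step p s n) <= nm p ^+ n.
Proof.
rewrite /chain_step nmX nmX -exprM; apply: ler_wiXn2l; rewrite ?nm_ge0 //; first exact: ltW.
by nia.
Qed.

Lemma nm_chain_weight (C D : R) s ss (be : nat -> K) v : 0 <= C -> 0 <= D ->
  (forall m, nm (iq Q m) <= C) -> (forall n, nm (be n) <= D) ->
  nm (chain_weight p s ss be v) <= C ^+ size ss * D * nm p ^+ sumn v.
Proof.
move=> C0 D0 hC hD; elim: ss s v => [|s' ss IH] s v /=; rewrite nmM mulrC.
  by rewrite expr0 mul1r; apply: ler_pM; rewrite ?nm_ge0 ?nm_chain_step.
apply: ler_pM; rewrite ?nm_ge0 ?nm_chain_step //.
rewrite nmM [C ^+ _]exprS -[C * _ * D]mulrA; apply: ler_pM; rewrite ?nm_ge0 //.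
apply: le_trans (IH _ _) _; rewrite ler_piMr ?mulr_ge0 ?exprn_ge0 //.
by rewrite exprn_ile1 ?nm_ge0 // ltW.
Qed.

Definition nahm_lim (dl s : nat) (ss : seq nat) (v : seq nat) : K :=
  chain_weight p s ss (nahm_beta_lim dl (head 0%N v)) (behead v).

(** A truncated term is at most a constant times |p| to the sum of its entries, because [iq], [qf]
    and the inverse of [qf2] are bounded; dominated convergence then applies over growing boxes. *)
Lemma nahm_sum_lim (dl s : nat) (ss : seq nat) (L : K) :
  (fun N => qm p (N + dl) * chain_sum p (s :: ss) (fun n => (qf2 p n * qm p (n + dl))^-1) N) @ \oo --> L ->
  forall e : R, 0 < e -> exists J0 : {fset 'cV[nat]_((size ss).+2)},
    forall J : {fset 'cV[nat]_((size ss).+2)}, (J0 `<=` J)%fset ->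
    nm (\sum_(x <- J) nahm_lim dl s ss (vec_seq x) - poch Q Q * L) < e.
Proof.
move=> hL; have PQ : poch Q Q != 0 by exact: poch_neq0_lt1.
have [C C1 hC] := iq_bounded Q1; have [C2 C21 hC2] := cvg_bounded (cvg_qf Q1).
have [C3 C31 hC3] : exists2 C : R, 1 <= C & forall n, nm (qf2 p n)^-1 <= C.
  by apply: cvg_bounded; apply: cvgV cvg_qf2; apply: poch_neq0_lt1; exact: nmX_lt1.
have C0 : 0 <= C by lra.
pose D n1 := nm p ^+ n1 * (C * C * C2 * C3).
have hD N n1 n : nm (nahm_beta p dl N n1 n) <= D n1.
  rewrite /nahm_beta /D -!mulrA !nmM nmX; apply: ler_pM; rewrite ?exprn_ge0 ?mulr_ge0 ?nm_ge0 //.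
    by apply: ler_wiXn2l; rewrite ?nm_ge0 ?(ltW p1) //; nia.
  do 3 (apply: ler_pM; rewrite ?mulr_ge0 ?nm_ge0 //).
pose E := nm (poch Q Q) * (C * (C ^+ size ss * (C * C * C2 * C3))).
(* The factor (Q;Q)_oo cancels the limit of the outermost reciprocal [iq] of the chain. *)
pose f N (x : 'cV[nat]_((size ss).+2)) := poch Q Q * nahm_finite p dl s ss N (vec_seq x).
have E0 : 0 <= E by rewrite /E !mulr_ge0 ?nm_ge0 ?exprn_ge0 //; lra.
have hf N x : nm (f N x) <= E * nm p ^+ sumn (vec_seq x).
  rewrite /f /E nmM -mulrA ler_wpM2l ?nm_ge0 //.
  case: (vec_seq x) (size_vec_seq x) => // n1 v _.
  rewrite /nahm_finite /= nmM -!mulrA; apply: ler_pM; rewrite ?nm_ge0 //.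
  apply: le_trans (@nm_chain_weight C (D n1) _ _ _ _ C0 _ hC (hD N n1)) _.
    by rewrite /D !mulr_ge0 ?exprn_ge0 ?nm_ge0 //; lra.
  by rewrite le_eqVlt; apply/orP; left; apply/eqP; rewrite exprD /D; ring.
have hg x : (fun N => f N x) @ \oo --> nahm_lim dl s ss (vec_seq x).
  have -> : nahm_lim dl s ss (vec_seq x) = poch Q Q * ((poch Q Q)^-1 * nahm_lim dl s ss (vec_seq x)) by rewrite mulVKf.
  apply: cvgMn; first exact: cvg_cst.
  apply: cvgMn.
    by apply: (@cvg_iq_shift _ _ (sumn (behead (vec_seq x)))) => // N; lia.
  by apply: cvg_chain_weight => n; exact: cvg_nahm_beta.
have [S [h1 h2]] := dominated_sum (fun J => sum_geo_vec J (nm_ge0 p) p1 E0) hf hg.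
have h3 := h2 (@box_set (size ss).+2).
have {}h3 : (fun N => \sum_(x <- box_set (size ss).+2 N) f N x) @ \oo --> S.
  apply: h3 => N x; rewrite mem_box_set => xN; rewrite /f nahm_finite_out ?mulr0 ?size_vec_seq //.
  by move: xN; rewrite -has_predC; apply: sub_has => k /=; rewrite -ltnNge.
suff -> : poch Q Q * L = S by [].
have h4 : (fun N => poch Q Q *
    (qm p (N + dl) * chain_sum p (s :: ss) (fun n => (qf2 p n * qm p (n + dl))^-1) N)) @ \oo --> poch Q Q * L.
  by apply: cvgMn hL; exact: cvg_cst.
apply: cvgC_unique h4 _; apply: cvg_trans h3; apply: near_eq_cvg; apply: nearW => N.
rewrite /f -mulr_sumr (sum_box_set _ N (nahm_finite p dl s ss N)) nahm_finite_sum //.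
- exact: qf_sub_neq0.
- move=> n; rewrite -[X in 1 + X]opprK; apply: sub1_neq0.
  rewrite nmN nmM nmX -/Q; apply: le_lt_trans p1.
  by rewrite ler_piMr ?nm_ge0 // exprn_ile1 ?nm_ge0 // ltW.
Qed.

Lemma poch_bounds_neq0 : (forall n, 1 - Q ^+ n.+1 != 0) /\ (forall n, 1 + p * Q ^+ n != 0).
Proof.
split=> [|n]; first exact: qf_sub_neq0.
rewrite -[X in 1 + X]opprK; apply: sub1_neq0; rewrite nmN nmM nmX; apply: le_lt_trans p1.
by rewrite ler_piMr ?nm_ge0 // exprn_ile1 ?nm_ge0 // ltW.
Qed.

Theorem nahm_sum0 (ss : seq nat) : ss = nseq (size ss) 1%N ->
  forall e : R, 0 < e -> exists J0 : {fset 'cV[nat]_((size ss).+2)},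
    forall J : {fset 'cV[nat]_((size ss).+2)}, (J0 `<=` J)%fset ->
    nm (\sum_(x <- J) nahm_lim 1 1 ss (vec_seq x)
        - poch (- p) Q / poch Q Q * theta_prod p (4 * size ss + 7) (4 * size ss + 6)) < e.
Proof.
move=> hss; have PQ : poch Q Q != 0 by exact: poch_neq0_lt1.
have [h1 h2] := poch_bounds_neq0.
have -> : poch (- p) Q / poch Q Q * theta_prod p (4 * size ss + 7) (4 * size ss + 6)
   = poch Q Q * (poch (- p) Q * ((poch Q Q)^-1 * (poch Q Q)^-1 * theta_prod p (4 * size ss + 7) (4 * size ss + 6))).
  by move: (theta_prod _ _ _) (poch (- p) _) => a b; move: (poch Q Q) PQ => c c0; field.
apply: nahm_sum_lim; apply: cvgMn; first exact: cvg_qm.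
have -> : 1%N :: ss = nseq (size ss).+1 1%N by rewrite {1}hss.
have h := @cvg_theta p (4 * size ss + 7) (4 * size ss + 6) p0 p1 _ _ Q 1 Q1.
apply: cvg_trans (h _ _); try lia.
apply: near_eq_cvg; apply: nearW => N /=.
rewrite -[RHS]/(chain_sum p (nseq (size ss).+1 1%N) _ N).
rewrite (eq_chain_sum p0 _ (be' := fun n => (qf2 p n * qm p n.+1)^-1) (N := N)); last by move=> k _; rewrite addn1.
rewrite (@bailey_chain0 K p p0 h1 h2 (N + 1).+1); last by lia.
by apply: eq_bsum => m; congr (ec _ _ _ _ * _); lia.
Qed.

Theorem nahm_sum1 (s : nat) (ss : seq nat) (a b : nat) : s :: ss = nseq b 0%N ++ nseq a 1%N ->
  forall e : R, 0 < e -> exists J0 : {fset 'cV[nat]_((size ss).+2)},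
    forall J : {fset 'cV[nat]_((size ss).+2)}, (J0 `<=` J)%fset ->
    nm (\sum_(x <- J) nahm_lim 0 s ss (vec_seq x)
        - poch (- p) Q / poch Q Q * theta_prod p (4 * (a + b) + 3) (4 * a + 2 * b + 1)) < e.
Proof.
move=> hss; have PQ : poch Q Q != 0 by exact: poch_neq0_lt1.
have [h1 h2] := poch_bounds_neq0.
have -> : poch (- p) Q / poch Q Q * theta_prod p (4 * (a + b) + 3) (4 * a + 2 * b + 1)
   = poch Q Q * (poch (- p) Q * ((poch Q Q)^-1 * (poch Q Q)^-1 * theta_prod p (4 * (a + b) + 3) (4 * a + 2 * b + 1))).
  by move: (theta_prod _ _ _) (poch (- p) _) => x y; move: (poch Q Q) PQ => c c0; field.
apply: nahm_sum_lim; apply: cvgMn; first exact: cvg_qm.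
rewrite hss.
have h := @cvg_theta p (4 * (a + b) + 3) (4 * a + 2 * b + 1) p0 p1 _ _ Q 0 Q1.
apply: cvg_trans (h _ _); try lia.
apply: near_eq_cvg; apply: nearW => N.
rewrite (eq_chain_sum p0 _ (be' := fun n => (qf2 p n * qm p n)^-1) (N := N)); last by move=> k _; rewrite addn0.
rewrite (@bailey_chain1 K p p0 h1 h2 (N + 0).+1); last by lia.
by apply: eq_bsum => m; congr (ec _ _ _ _ * _); lia.
Qed.

End NahmLimit.

End Limits.

(** * Invariance under Gamma_1 *)

Section ThetaQuotient.
Variables (R : realType) (K : cplxField R).
Implicit Types (p t : K).

Lemma im_natM (n : nat) t : im (n%:R * t) = n%:R * im t.
Proof. by rewrite -(rmorph_nat (ofR : {rmorphism R -> K})) imM re_ofR im_ofR mul0r addr0. Qed.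

Lemma im_natM_gt0 (n : nat) t : (0 < n)%N -> 0 < im t -> 0 < im (n%:R * t).
Proof. by move=> n0 t0; rewrite im_natM mulr_gt0 ?ltr0n. Qed.

Lemma ee_natM (n : nat) t : ee (n%:R * t) = ee t ^+ n.
Proof. by rewrite mulr_natl eeMn. Qed.

Lemma poch_pp p (n : nat) : nm p < 1 ->
  poch p p = \prod_(i < n) (poch (p ^+ i.+1) (p ^+ (2 * n + 1)) *
     poch (p ^+ (2 * n + 1 - i.+1)) (p ^+ (2 * n + 1))) * poch (p ^+ (2 * n + 1)) (p ^+ (2 * n + 1)).
Proof.
move=> p1; rewrite (@poch_dissect R K p p (2 * n + 1)) //; last by rewrite addn1.
set P := p ^+ (2 * n + 1).
rewrite -(big_mkord xpredT (fun i => poch (p * p ^+ i) P)).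
rewrite (_ : (2 * n + 1 = (n + n).+1)%N); last by lia.
rewrite big_nat_recr //= big_mkord big_split_ord big_split /=; congr (_ * _ * _).
- by apply: eq_bigr => i _; rewrite exprS.
- rewrite (reindex_inj rev_ord_inj) /=; apply: eq_bigr => i _; congr (poch _ _).
  by rewrite -exprS; congr (_ ^+ _); have := ltn_ord i; lia.
- by congr (poch _ _); rewrite -exprS /P; congr (_ ^+ _); lia.
Qed.

(** Both sides equal (p^2;p^4) / (p;p): multiply numerator and denominator by (p;p^2), and split
    (p^2;p^4) modulo 8. The residues 2 and 6 modulo 8 account for the index 1/4 in
    [eta_quotient]. *)
Lemma poch_ratio p : nm p < 1 ->
  poch (- p) (p ^+ 2) / poch (p ^+ 2) (p ^+ 2) = poch (p ^+ 2) (p ^+ 8) * poch (p ^+ 6) (p ^+ 8) / poch p p.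
Proof.
move=> p1; have q1 : nm (p ^+ 2) < 1 by exact: nmX_lt1.
have h1 := @poch_mulN R K p _ q1.
have h2 := @poch_dissect R K p p 2 isT p1.
have h3 := @poch_dissect R K (p ^+ 2) (p ^+ 2 ^+ 2) 2 isT (nmX_lt1 (isT : (0 < 2)%N) q1).
move: h1 h2 h3; rewrite !big_ord_recr !big_ord0 /= !mul1r !expr0 !mulr1 !expr1 -!exprM -!exprD -expr2 => h1 h2 h3.
have p2 : poch (p ^+ 2) (p ^+ 2) != 0 by exact: poch_neq0_lt1.
have pp : poch p (p ^+ 2) != 0 by exact: poch_neq0_lt1.
rewrite h2 -h3 -h1.
by move: (poch p _) (poch (p ^+ 2) _) (poch (- p) _) p2 pp => a b c b0 a0; field; rewrite a0 b0.
Qed.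

Lemma theta_prodC p (M l : nat) : (l <= M)%N -> theta_prod p M (M - l) = theta_prod p M l.
Proof. by move=> lM; rewrite /theta_prod subKn // [poch _ _ * poch (p ^+ l) _]mulrC. Qed.

(** The omitted index k is the pair of residues modulo M that the theta product cancels in the
    dissection of (p;p)_oo. *)
Definition eta_quotient (n k : nat) t : K :=
  let M := (2 * n + 1)%N in
  - gs (1 / 4) 0 ((32 * M)%N%:R * t) /
  \prod_(i < n | i.+1 != k) gs (i.+1%:R / M%:R) 0 ((4 * M ^ 2)%N%:R * t).

Lemma gs_quarter (M : nat) t p : (0 < M)%N -> 0 < im t -> p = ee ((4 * M)%N%:R * t) ->
  gs (1 / 4) 0 ((32 * M)%N%:R * t)
  = - ee (- (M%:R * t / 3)) * (poch (p ^+ 2) (p ^+ 8) * poch (p ^+ 6) (p ^+ 8)).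
Proof.
move=> M0 t0 ->; rewrite gs_prod; last by apply: im_natM_gt0 => //; lia.
have M0' : M%:R != 0 :> K by rewrite pnatr_eq0 -lt0n.
congr (- ee _ * (poch _ _ * poch _ _)); rewrite -?ee_natM ?natrM.
- by field.
- by congr ee; field.
- by congr ee; ring.
- by congr ee; field.
- by congr ee; ring.
Qed.

Lemma gs_level (M i : nat) t p : (0 < i)%N -> (i < M)%N -> 0 < im t -> p = ee ((4 * M)%N%:R * t) ->
  gs (i%:R / M%:R) 0 ((4 * M ^ 2)%N%:R * t)
  = - ee ((2 * i%:R ^+ 2 + M%:R ^+ 2 / 3 - 2 * i%:R * M%:R) * t) *
    (poch (p ^+ i) (p ^+ M) * poch (p ^+ (M - i)) (p ^+ M)).
Proof.
move=> i0 iM t0 ->; have M0 : (0 < M)%N by lia.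
rewrite gs_prod; last by apply: im_natM_gt0 => //; lia.
have M0' : M%:R != 0 :> K by rewrite pnatr_eq0 -lt0n.
congr (- ee _ * (poch _ _ * poch _ _)); rewrite -?ee_natM ?natrB ?(ltnW iM) // ?natrM ?natrX.
- by field.
- by congr ee; field.
- by congr ee; ring.
- by congr ee; field.
- by congr ee; ring.
Qed.

(** The summand is 2 M^2 times the second Bernoulli polynomial at i / M; the sum over all i is found
    in closed form and the k-th term is subtracted. *)
Lemma sum_level (n k : nat) (M : K) : M = (2 * n + 1)%N%:R -> (0 < k)%N -> (k <= n)%N ->
  \sum_(i < n | i.+1 != k) (2 * i.+1%:R ^+ 2 + M ^+ 2 / 3 - 2 * i.+1%:R * M)
  = - (M * n%:R / 3) - (2 * k%:R ^+ 2 + M ^+ 2 / 3 - 2 * k%:R * M).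
Proof.
move=> -> k0 kn; have kn' : (k.-1 < n)%N by lia.
have all : \sum_(i < n) (2 * i.+1%:R ^+ 2 + (2 * n + 1)%N%:R ^+ 2 / 3 - 2 * i.+1%:R * (2 * n + 1)%N%:R)
    = - ((2 * n + 1)%N%:R * n%:R / 3) :> K.
  have h (m : nat) (a : K) : \sum_(i < m) (2 * i.+1%:R ^+ 2 + a ^+ 2 / 3 - 2 * i.+1%:R * a)
     = m%:R * (m%:R + 1) * (2 * m%:R + 1) / 3 + m%:R * a ^+ 2 / 3 - m%:R * (m%:R + 1) * a.
    elim: m => [|m IH]; first by rewrite big_ord0; field.
    by rewrite big_ord_recr /= IH -[m.+1%:R]natr1; field.
  by rewrite h natrD natrM; field.
rewrite (bigD1 (Ordinal kn')) //= prednK // in all; rewrite -all.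
have hS (f : nat -> K) : \sum_(i < n | i.+1 != k) f i = \sum_(i < n | i != Ordinal kn') f i.
  by apply: eq_bigl => i; rewrite -val_eqE /=; lia.
rewrite (hS (fun i => 2 * i.+1%:R ^+ 2 + (2 * n + 1)%N%:R ^+ 2 / 3 - 2 * i.+1%:R * (2 * n + 1)%N%:R)).
by move: (\sum_(i < n | _) _) => S; ring.
Qed.

(** The exponential in front is the quotient of the leading exponentials of the Siegel functions.
    Since n is odd, the n - 1 signs of the denominator cancel. *)
Lemma theta_eta (n k l : nat) t p : odd n -> (0 < k)%N -> (k <= n)%N ->
  l = k \/ (l = 2 * n + 1 - k)%N -> 0 < im t -> p = ee ((4 * (2 * n + 1))%N%:R * t) ->
  ee (((2 * n + 1)%N%:R * n%:R - 2 * l%:R * ((2 * n + 1)%N%:R - l%:R)) * t) *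
  (poch (- p) (p ^+ 2) / poch (p ^+ 2) (p ^+ 2) * theta_prod p (2 * n + 1) l)
  = eta_quotient n k t.
Proof.
move=> on k0 kn hl t0 pE; set M := (2 * n + 1)%N.
have M0 : (0 < M)%N by rewrite /M; lia.
have p1 : nm p < 1 by rewrite pE nm_ee_lt1 // im_natM_gt0 //; lia.
have P1 : nm (p ^+ M) < 1 by exact: nmX_lt1.
have -> : 2 * l%:R * (M%:R - l%:R) = 2 * k%:R * (M%:R - k%:R) :> K.
  by case: hl => -> //; rewrite natrB -/M; by [rewrite /M; lia|ring].
have -> : theta_prod p M l = theta_prod p M k by case: hl => -> //; rewrite theta_prodC //; lia.
rewrite poch_ratio // /eta_quotient -/M (gs_quarter M0 t0 pE) (poch_pp n p1) -/M.
pose pr i := poch (p ^+ i) (p ^+ M) * poch (p ^+ (M - i)) (p ^+ M).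
pose ex i : K := 2 * i%:R ^+ 2 + M%:R ^+ 2 / 3 - 2 * i%:R * M%:R.
have pr0 i : (0 < i < M)%N -> pr i != 0.
  by move=> h; rewrite mulf_neq0 // poch_neq0_lt1 // nmX_lt1 //; lia.
have -> : \prod_(i < n | i.+1 != k) gs (i.+1%:R / M%:R) 0 ((4 * M ^ 2)%N%:R * t)
    = ee ((- (M%:R * n%:R / 3) - ex k) * t) * \prod_(i < n | i.+1 != k) pr i.+1.
  rewrite (eq_bigr (fun i : 'I_n => - (ee (ex i.+1 * t) * pr i.+1))); last first.
    move=> i _; rewrite (@gs_level M i.+1 t p) ?mulNr //.
    by have := ltn_ord i; rewrite /M; lia.
  have kn' : (k.-1 < n)%N by lia.
  rewrite prodrN (_ : #|_| = n.-1); last first.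
    rewrite (@eq_card _ _ (predC1 (Ordinal kn'))); last by move=> i; rewrite !inE -val_eqE /=; lia.
    by have := cardC1 (Ordinal kn'); rewrite card_ord.
  rewrite -signr_odd (_ : odd n.-1 = false); last by case: (n) on => //= m /negbTE.
  rewrite expr0 mul1r big_split /=; congr (_ * _).
  rewrite -(@sum_level n k M%:R) // mulr_suml.
  by elim/big_rec2: _ => [|i x y _ ->]; rewrite ?ee0 // eeD.
have kn' : (k.-1 < n)%N by lia.
rewrite (bigD1 (Ordinal kn')) //= prednK // -/(pr k).
have -> : \prod_(i < n | i != Ordinal kn') (poch (p ^+ i.+1) (p ^+ M) * poch (p ^+ (M - i.+1)) (p ^+ M))
   = \prod_(i < n | i.+1 != k) pr i.+1.
  by apply: eq_bigl => i; rewrite -val_eqE /=; lia.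
have nz : \prod_(i < n | i.+1 != k) pr i.+1 != 0.
  by apply/prodf_neq0 => i _; apply: pr0; have := ltn_ord i; rewrite /M; lia.
have k1 : pr k != 0 by apply: pr0; rewrite /M; lia.
have PM : poch (p ^+ M) (p ^+ M) != 0 by exact: poch_neq0_lt1.
have -> : theta_prod p M k = pr k * poch (p ^+ M) (p ^+ M) by [].
have -> : ee ((M%:R * n%:R - 2 * k%:R * (M%:R - k%:R)) * t)
    = ee (- (M%:R * t / 3)) / ee ((- (M%:R * n%:R / 3) - ex k) * t).
  by rewrite -eeB; congr ee; rewrite /ex /M natrD natrM; field.
have e0 := ee_neq0 ((- (M%:R * n%:R / 3) - ex k) * t).
move: (\prod_(i < n | _) _) (pr k) (poch (p ^+ M) _) (ee ((- _ - _) * t)) nz k1 PM e0 => a b c d a0 b0 c0 d0.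
move: (poch _ _) (poch _ _) (ee _) => x y z.
by field; rewrite a0 b0 c0 d0.
Qed.

End ThetaQuotient.

Section Invariance.
Variables (R : realType) (K : cplxField R).
Implicit Types (t x y : K) (a b c d : int).

Lemma gs_shift1n (n : nat) x y t : 0 < im t ->
  gs (x + n%:R) y t = (- ee (- (y / 2))) ^+ n * gs x y t.
Proof.
move=> t0; elim: n => [|n IH]; first by rewrite addr0 expr0 mul1r.
by rewrite -natr1 addrA gs_shift1 // IH exprS mulrA.
Qed.

Lemma gs_shift2n (n : nat) x y t :
  gs x (y + n%:R) t = (- ee (x / 2)) ^+ n * gs x y t.
Proof.
elim: n => [|n IH]; first by rewrite addr0 expr0 mul1r.
by rewrite -natr1 addrA gs_shift2 IH exprS mulrA.
Qed.

Lemma gs_shift1_even (A : int) x t : 0 < im t -> gs (x + 2 * A%:~R) 0 t = gs x 0 t.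
Proof.
move=> t0; have h (n : nat) z : gs (z + 2 * n%:R) 0 t = gs z 0 t.
  by rewrite -natrM gs_shift1n // mul0r oppr0 ee0 exprM sqrrN !expr1n mul1r.
case: A => n; first exact: h.
by rewrite NegzE mulrNz -[in RHS](subrK (2 * n.+1%:R) x) h mulrN.
Qed.

Lemma gs_shift2_even (B : int) x t : ee (x * B%:~R) = 1 -> gs x (2 * B%:~R) t = gs x 0 t.
Proof.
have h (n : nat) y : ee (x * n%:R) = 1 -> gs x (y + 2 * n%:R) t = gs x y t.
  move=> e; rewrite -natrM gs_shift2n exprM sqrrN -exprM -ee_natM.
  rewrite (_ : (2 * n)%N%:R * (x / 2) = x * n%:R) ?e ?mul1r //.
  by rewrite natrM; field.
case: B => n e; first by rewrite -[in LHS](add0r (2 * _)) h.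
rewrite NegzE mulrNz mulrN -[in RHS](addNr (2 * n.+1%:R)) h //.
by move: e; rewrite NegzE mulrNz mulrN eeN => e; rewrite -[LHS]invrK e invr1.
Qed.

(** Conjugation by diag(m, 1) turns the matrix into (a, m b; c / m, d). The conditions on A and B
    say that it moves the index (x, 0) by even integers, with trivial multiplier. *)
Lemma gs_level_inv (m : nat) x a b c d c2 (A B : int) t : (0 < m)%N -> 0 < im t ->
  a * d - b * c = 1 -> c = m%:Z * c2 ->
  x * a%:~R = x + 2 * A%:~R -> x * (m%:R * b%:~R) = 2 * B%:~R -> ee (x * B%:~R) = 1 ->
  gs x 0 (m%:R * ((a%:~R * t + b%:~R) / (c%:~R * t + d%:~R)))
  = mult K a (m%:Z * b) c2 d * gs x 0 (m%:R * t).
Proof.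
move=> m0 t0 h cE hA hB eB; have mt0 := im_natM_gt0 m0 t0.
have h' : a * d - m%:Z * b * c2 = 1 by rewrite -h cE; ring.
have -> : m%:R * ((a%:~R * t + b%:~R) / (c%:~R * t + d%:~R))
    = (a%:~R * (m%:R * t) + (m%:Z * b)%:~R) / (c2%:~R * (m%:R * t) + d%:~R).
  rewrite (_ : c2%:~R * (m%:R * t) + d%:~R = c%:~R * t + d%:~R); last by rewrite cE rmorphM; ring.
  by rewrite rmorphM mulrA; congr (_ / _); ring.
rewrite (gs_modular h' _ _ mt0) !mul0r !addr0 rmorphM hA hB gs_shift2_even ?gs_shift1_even //.
rewrite mulrDl eeD eB mul1r -mulrA -rmorphM (_ : 2 * _ = (2 * (A * B))%:~R) ?ee_int //.
by rewrite [in RHS]rmorphM.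
Qed.

(** With m = n - 1, the numerator's multiplier agrees modulo 3 with the m-fold one of the
    denominator. This is a finite check on residues; the congruences on a and d enter when 3 divides
    M. *)
Lemma u3_level (m : nat) (a b c d : int) : let M := (2 * m.+1 + 1)%N%:Z in
  a * d - b * (128 * M ^+ 2 * c) = 1 ->
  (res 3 M = 0%N -> res 3 a = 1%N /\ res 3 d = 1%N) ->
  u3 (res 3 a) (res 3 (32 * M * b)) (res 3 (4 * M * c)) (res 3 d)
  = (m * u3 (res 3 a) (res 3 (4 * M ^+ 2 * b)) (res 3 (32 * c)) (res 3 d) %% 3)%N.
Proof.
move=> M h hM.
have e0 : res 3 M = (2 * (m %% 3) %% 3)%N.
  rewrite /res modz_nat absz_nat (_ : (2 * m.+1 + 1 = 1 * 3 + 2 * m)%N); last by lia.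
  by rewrite modnMDl modnMmr.
have := @res_det 3 a b (128 * M ^+ 2 * c) d isT h; rewrite -modnMml.
rewrite !resM // -!/(res 3 (_ : nat)) e0.
move: hM; rewrite e0; have := ltn_pmod m (isT : (0 < 3)%N).
have := res_lt a (isT : (0 < 3)%N); have := res_lt b (isT : (0 < 3)%N).
have := res_lt c (isT : (0 < 3)%N); have := res_lt d (isT : (0 < 3)%N).
rewrite -[res 3 32]/2%N -[res 3 4]/1%N -[res 3 128]/2%N.
move: (res 3 a) (res 3 b) (res 3 c) (res 3 d) (m %% 3)%N => a' b' c' d' m' hd hc hb ha hm.
by case: m' hm => [|[|[|//]]] _; case: a' ha => [|[|[|//]]] _; case: d' hd => [|[|[|//]]] _ /= hM /eqP; move: hM;
  case: b' hb => [|[|[|//]]] _; case: c' hc => [|[|[|//]]] _ //= hM; case: (hM erefl).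
Qed.

(** The level is used through c / (32 M) = 4 M c_1, c / (4 M^2) = 32 c_1, and through a = 1 modulo
    128 M^2, which moves the indices 1/4 and i / M by even integers. *)
Lemma eta_quotient_inv (n k : nat) a b c d c1 t : odd n -> (0 < k <= n)%N -> 0 < im t ->
  let N := (128 * (2 * n + 1) ^ 2)%N%:Z in
  a * d - b * c = 1 -> c = N * c1 -> (N %| a - 1)%Z -> (N %| d - 1)%Z ->
  eta_quotient n k ((a%:~R * t + b%:~R) / (c%:~R * t + d%:~R)) = eta_quotient n k t.
Proof.
move=> on /andP[k0 kn] t0 N h cE /dvdzP[a1 aE] /dvdzP[d1 dE].
have {}aE : a = 1 + a1 * N by rewrite -aE; ring.
have {}dE : d = 1 + d1 * N by rewrite -dE; ring.
set M := (2 * n + 1)%N in N aE dE cE *.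
have M0 : (0 < M)%N by rewrite /M; lia.
have MK : M%:R != 0 :> K by rewrite pnatr_eq0 -lt0n.
have NE : N = 128 * M%:Z ^+ 2 by rewrite /N -/M; lia.
have NK : N%:~R = 128 * M%:R ^+ 2 :> K by rewrite NE rmorphM rmorphXn /=.
have aK : a%:~R = 1 + a1%:~R * (128 * M%:R ^+ 2) :> K by rewrite -NK aE rmorphD rmorphM.
rewrite /eta_quotient -/M.
rewrite (@gs_level_inv (32 * M) (1 / 4) a b c d (4 * M%:Z * c1) (16 * a1 * M%:Z ^+ 2) (4 * M%:Z * b) t) //; first last.
- by rewrite (_ : 1 / 4 * _ = (M%:Z * b)%:~R) ?ee_int // !rmorphM /=; field.
- by rewrite natrM !rmorphM /=; field.
- by rewrite aK !rmorphM ?rmorphXn /=; field.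
- by rewrite cE NE PoszM; ring.
- by lia.
rewrite (eq_bigr (fun i : 'I_n => mult K a ((4 * M ^ 2)%N%:Z * b) (32 * c1) d *
  gs (i.+1%:R / M%:R) 0 ((4 * M ^ 2)%N%:R * t))); last first.
  move=> i _; apply: (@gs_level_inv (4 * M ^ 2) (i.+1%:R / M%:R) a b c d (32 * c1)
    (64 * i.+1%:Z * M%:Z * a1) (2 * M%:Z * i.+1%:Z * b) t) => //.
  - by lia.
  - by rewrite cE NE PoszM; lia.
  - by rewrite aK !rmorphM /=; field.
  - by rewrite natrM natrX !rmorphM /=; field.
  - rewrite (_ : i.+1%:R / M%:R * _ = (2 * i.+1%:Z * i.+1%:Z * b)%:~R) ?ee_int // !rmorphM /=; by field.
have kn' : (k.-1 < n)%N by lia.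
rewrite big_split prodr_const /= (_ : #|_| = n.-1); last first.
  rewrite (@eq_card _ _ (predC1 (Ordinal kn'))); last by move=> i; rewrite !inE -val_eqE /=; lia.
  by have := cardC1 (Ordinal kn'); rewrite card_ord.
suff -> : mult K a ((32 * M)%N%:Z * b) (4 * M%:Z * c1) d = mult K a ((4 * M ^ 2)%N%:Z * b) (32 * c1) d ^+ n.-1.
  have m0 : mult K a ((4 * M ^ 2)%N%:Z * b) (32 * c1) d ^+ n.-1 != 0.
    by rewrite expf_neq0 // mulf_neq0 // ee_neq0.
  rewrite invfM -mulrN mulrA; congr (_ * _).
  by rewrite mulrC mulKf.
(* Modulo 4 both conjugated matrices are the identity, so their multipliers reduce to the cube roots
   of unity. *)
have r4 (x : int) : res 4 (4 * x) = 0%N by rewrite /res modzMr.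
have r41 (x y : int) : x = 1 + y * N -> res 4 x = 1%N.
  by move=> ->; rewrite NE (_ : y * _ = 4 * (y * 32 * M%:Z ^+ 2)) ?resD ?r4 //; ring.
rewrite (_ : (32 * M)%N%:Z * b = 32 * M%:Z * b); last by rewrite PoszM.
rewrite (_ : (4 * M ^ 2)%N%:Z * b = 4 * M%:Z ^+ 2 * b); last by lia.
rewrite /mult (r41 a a1) // (r41 d d1) //.
have -> : res 4 (32 * M%:Z * b) = 0%N by rewrite -[RHS](r4 (8 * M%:Z * b)); congr res; ring.
have -> : res 4 (4 * M%:Z * c1) = 0%N by rewrite -[RHS](r4 (M%:Z * c1)); congr res; ring.
have -> : res 4 (4 * M%:Z ^+ 2 * b) = 0%N by rewrite -[RHS](r4 (M%:Z ^+ 2 * b)); congr res; ring.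
have -> : res 4 (32 * c1) = 0%N by rewrite -[RHS](r4 (8 * c1)); congr res; ring.
rewrite -[v4 1 0 0 1]/0%N mul0r ee0 !mulr1 -ee_natM mulrA -natrM -[RHS]ee_modn //; congr (ee (_%:R / _)).
have nE : n.-1.+1 = n by rewrite prednK //; lia.
have := @u3_level n.-1 a b c1 d; rewrite nE; apply; first by rewrite -NE -cE.
rewrite -/M => M3; have r3 (x y : int) : x = 1 + y * N -> res 3 x = 1%N.
  move=> ->; rewrite NE expr2 resD // (_ : y * _ = M%:Z * (y * (128 * M%:Z))); last by ring.
  by rewrite [res 3 (M%:Z * _)]resM // M3.
by split; [apply: (r3 a a1)|apply: (r3 d d1)].
Qed.

End Invariance.

(** * Expansions at the cusps *)

Section PowerSeries.
Variables (R : realType) (K : cplxField R).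
Implicit Types (u z : K) (G H : K -> K).

Definition psum (a : nat -> K) u (n : nat) : K := \sum_(k < n) a k * u ^+ k.

Lemma psumS (a : nat -> K) u n : psum a u n.+1 = psum a u n + a n * u ^+ n.
Proof. by rewrite /psum big_ord_recr. Qed.

(** A power series on |u| < 1 / A with an explicit geometric bound on its coefficients: products and
    reciprocals are formed on coefficients, without Cauchy's theorem. *)
Definition analytic (A : R) G (a0 : K) : Prop :=
  exists (a : nat -> K) (B : R), [/\ a 0%N = a0, forall k, nm (a k) <= B * A ^+ k &
    forall u, nm u * A < 1 -> psum a u @ \oo --> G u].

Lemma psum_summable (a : nat -> K) (A B : R) u : 0 < A -> (forall k, nm (a k) <= B * A ^+ k) -> nm u * A < 1 ->
  (forall k, nm (a k * u ^+ k) <= B * (nm u * A) ^+ k) /\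
  (forall n, \sum_(k < n) B * (nm u * A) ^+ k <= B * (1 - nm u * A)^-1).
Proof.
move=> A0 aB uA; split=> [k|n].
  by rewrite nmM nmX exprMn [_ ^+ k * A ^+ k]mulrC mulrA ler_wpM2r ?exprn_ge0 ?nm_ge0.
have B0 : 0 <= B by have := aB 0%N; rewrite expr0 mulr1; apply: le_trans; exact: nm_ge0.
by rewrite -mulr_sumr ler_wpM2l // geo_sum_le // mulr_ge0 ?nm_ge0 // ltW.
Qed.

Lemma psum_bounded (a : nat -> K) (A B : R) u : 0 < A -> (forall k, nm (a k) <= B * A ^+ k) -> nm u * A < 1 ->
  forall n, nm (psum a u n) <= B * (1 - nm u * A)^-1.
Proof.
move=> A0 aB uA n; have [h1 h2] := psum_summable A0 aB uA.
apply: le_trans (h2 n); apply: le_trans (nm_sum _ _ _) _; exact: ler_sum.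
Qed.

Lemma analyticW (A A' : R) G a0 : 0 < A -> A <= A' -> analytic A G a0 -> analytic A' G a0.
Proof.
move=> A0 AA [a [B [h0 h1 h2]]]; exists a, B; split=> // [k|u h].
  apply: le_trans (h1 k) _; apply: ler_wpM2l; last by apply: lerXn2r; rewrite ?nnegrE //; lra.
  by have := h1 0%N; rewrite expr0 mulr1; apply: le_trans; exact: nm_ge0.
by apply: h2; apply: le_lt_trans h; rewrite ler_wpM2l ?nm_ge0.
Qed.

(** Written with the inner truncation n - i, the truncated product has the form required by
    dominated convergence. *)
Lemma cauchy_product (a b : nat -> K) u n :
  psum (fun k => \sum_(i < k.+1) a i * b (k - i)%N) u n = \sum_(i < n) (a i * u ^+ i) * psum b u (n - i).
Proof.
elim: n => [|n IH]; first by rewrite /psum !big_ord0.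
rewrite psumS IH [RHS]big_ord_recr /= subSnn.
have -> : psum b u 1 = b 0%N by rewrite /psum big_ord1 expr0 mulr1.
rewrite [X in _ + X * _]big_ord_recr /= subnn mulrDl addrA [a n * _ * _]mulrAC; congr (_ + _).
rewrite mulr_suml -big_split /=; apply: eq_bigr => i _.
rewrite subSn ?(ltnW (ltn_ord i)) // psumS mulrDr; congr (_ + _).
rewrite (_ : u ^+ n = u ^+ i * u ^+ (n - i)); first by ring.
by rewrite -exprD subnKC // ltnW.
Qed.

Lemma cauchy_cvg (a b : nat -> K) (A B C : R) u (g h : K) : 0 < A ->
  (forall k, nm (a k) <= B * A ^+ k) -> (forall k, nm (b k) <= C * A ^+ k) -> nm u * A < 1 ->
  psum a u @ \oo --> g -> psum b u @ \oo --> h ->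
  psum (fun k => \sum_(i < k.+1) a i * b (k - i)%N) u @ \oo --> g * h.
Proof.
move=> A0 aB bC uA ag bh.
have [h1 h2] := psum_summable A0 aB uA.
have bb := psum_bounded A0 bC uA.
have D0 : 0 <= C * (1 - nm u * A)^-1 by apply: le_trans (bb 0%N); exact: nm_ge0.
have l1 n k : nm ((a k * u ^+ k) * psum b u (n - k)) <= B * (nm u * A) ^+ k * (C * (1 - nm u * A)^-1).
  by rewrite nmM; apply: ler_pM; rewrite ?nm_ge0.
have l2 n : \sum_(k < n) B * (nm u * A) ^+ k * (C * (1 - nm u * A)^-1) <= B * (1 - nm u * A)^-1 * (C * (1 - nm u * A)^-1).
  by rewrite -mulr_suml ler_wpM2r.
have l3 k : (fun n => (a k * u ^+ k) * psum b u (n - k)) @ \oo --> (a k * u ^+ k) * h.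
  apply: cvgMn; first exact: cvg_cst.
  rewrite -(cvg_shiftn k) /=; under eq_fun do rewrite addnK; exact: bh.
have [S [hS1 hS2]] := dominated_series l2 l1 l3.
have -> : g * h = S.
  have hm : (fun n => psum a u n * h) @ \oo --> g * h.
    by apply: cvgMn; [exact: ag|exact: cvg_cst].
  apply: cvgC_unique hm _; apply: cvg_trans hS1; apply: near_eq_cvg; apply: nearW => n.
  by rewrite /psum mulr_suml.
have hS : (fun n => \sum_(k < n) (a k * u ^+ k) * psum b u (n - k)) @ \oo --> S.
  by apply: hS2 => n k; rewrite -subn_eq0 => /eqP ->; rewrite /psum big_ord0 mulr0.
apply: cvg_trans hS; apply: near_eq_cvg; apply: nearW => n; exact/esym/cauchy_product.
Qed.

Lemma natr_expr2 (n : nat) : n.+1%:R <= 2 ^+ n :> R.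
Proof. by rewrite -natrX ler_nat; exact: ltn_expl. Qed.

(** A coefficient of the product has k + 1 <= 2^k terms, each bounded by B C A^k; doubling A absorbs
    their number. *)
Lemma analyticM (A : R) G H a0 b0 : 0 < A ->
  analytic A G a0 -> analytic A H b0 -> analytic (2 * A) (fun u => G u * H u) (a0 * b0).
Proof.
move=> A0 [a [B [ha0 aB aG]]] [b [C [hb0 bC bH]]].
have B0 : 0 <= B by have := aB 0%N; rewrite expr0 mulr1; apply: le_trans; exact: nm_ge0.
have C0 : 0 <= C by have := bC 0%N; rewrite expr0 mulr1; apply: le_trans; exact: nm_ge0.
exists (fun k => \sum_(i < k.+1) a i * b (k - i)%N), (B * C); split=> [|k|u uA].
- by rewrite big_ord1 subnn ha0 hb0.
- apply: le_trans (nm_sum _ _ _) _.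
  apply: (@le_trans _ _ (\sum_(i < k.+1) B * C * A ^+ k)).
    apply: ler_sum => i _; rewrite nmM; apply: le_trans (ler_pM (nm_ge0 _) (nm_ge0 _) (aB _) (bC _)) _.
    by rewrite mulrACA -exprD subnKC // -ltnS.
  rewrite sumr_const card_ord -[_ *+ _]mulr_natr exprMn [2 ^+ k * _]mulrC mulrA ler_wpM2l //.
    by rewrite !mulr_ge0 ?exprn_ge0 // ltW.
  exact: natr_expr2.
have uA' : nm u * A < 1.
  by apply: le_lt_trans uA; rewrite ler_wpM2l ?nm_ge0 //; lra.
by apply: (cauchy_cvg A0 aB bC uA'); [exact: aG|exact: bH].
Qed.

(* Coefficients of the inverse of 1 - h_1 u - h_2 u^2 - ... *)
Fixpoint recip_seq (h : nat -> K) (n : nat) : seq K :=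
  if n is m.+1 then rcons (recip_seq h m) (\sum_(i < m.+1) h i.+1 * (recip_seq h m)`_(m - i))
  else [:: 1].

Definition recip h n : K := (recip_seq h n)`_n.

Lemma size_recip_seq h n : size (recip_seq h n) = n.+1.
Proof. by elim: n => //= n IH; rewrite size_rcons IH. Qed.

Lemma nth_recip_seq h n k : (k <= n)%N -> (recip_seq h n)`_k = recip h k.
Proof.
elim: n => [|n IH]; first by rewrite leqn0 => /eqP ->.
rewrite leq_eqVlt => /orP[/eqP -> //|]; rewrite ltnS => kn /=.
by rewrite nth_rcons size_recip_seq ltnS kn IH.
Qed.

Lemma recipS h n : recip h n.+1 = \sum_(i < n.+1) h i.+1 * recip h (n - i)%N.
Proof.
rewrite {1}/recip /= nth_rcons size_recip_seq ltnn eqxx; apply: eq_bigr => i _.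
by rewrite nth_recip_seq // leq_subr.
Qed.

(** The recursion is dominated by a geometric one: B times the sum of (1 + B)^i for i <= n is (1 +
    B)^(n+1) - 1, whence the rate A (1 + B). *)
Lemma recip_bound h (A B : R) : 0 < A -> 0 <= B -> (forall k, nm (h k) <= B * A ^+ k) ->
  forall n, nm (recip h n) <= (A * (1 + B)) ^+ n.
Proof.
move=> A0 B0 hB n; have [m] := ubnP n; elim: m n => // m IH [|n] nm_lt.
  by rewrite /recip /= nm1 expr0.
rewrite recipS; apply: le_trans (nm_sum _ _ _) _.
apply: (@le_trans _ _ (\sum_(i < n.+1) A ^+ n.+1 * (B * (1 + B) ^+ (n - i)))).
  apply: ler_sum => i _; rewrite nmM.
  apply: le_trans (ler_pM (nm_ge0 _) (nm_ge0 _) (hB i.+1) (IH (n - i)%N _)) _.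
    by have := ltn_ord i; lia.
  rewrite exprMn mulrACA (_ : A ^+ n.+1 = A ^+ i.+1 * A ^+ (n - i)); last first.
    by rewrite -exprD; congr (_ ^+ _); have := ltn_ord i; lia.
  by rewrite le_eqVlt; apply/orP; left; apply/eqP; ring.
rewrite -!mulr_sumr exprMn ler_wpM2l ?exprn_ge0 ?(ltW A0) //.
rewrite (reindex_inj rev_ord_inj) /=.
under eq_bigr => i _ do rewrite subSS subKn ?(leq_ord i) //.
have -> : B * \sum_(i < n.+1) (1 + B) ^+ i = (1 + B) ^+ n.+1 - 1.
  by rewrite subrX1; congr (_ * _); ring.
by lra.
Qed.

Lemma analyticV (A : R) G a0 : 0 < A -> a0 != 0 -> analytic A G a0 ->
  exists2 A' : R, A <= A' & analytic A' (fun u => (G u)^-1) a0^-1.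
Proof.
move=> A0 a00 [a [B [ha0 aB aG]]].
have B0 : 0 <= B by have := aB 0%N; rewrite expr0 mulr1; apply: le_trans; exact: nm_ge0.
pose h k := - (a k / a0).
have na0 : 0 < nm a0 by rewrite nm_gt0.
pose B' := B / nm a0; have B'0 : 0 <= B' by rewrite divr_ge0 // ltW.
have hB k : nm (h k) <= B' * A ^+ k.
  by rewrite nmN nmM nmV /B' mulrAC ler_wpM2r // invr_ge0 ltW.
pose A1 := A * (1 + B').
have A10 : 0 < A1 by rewrite mulr_gt0 //; lra.
have AA1 : A <= A1 by rewrite /A1 ler_peMr ?(ltW A0) //; lra.
pose b k := recip h k / a0.
have bB k : nm (b k) <= (nm a0)^-1 * A1 ^+ k.
  by rewrite nmM nmV mulrC ler_wpM2l ?invr_ge0 ?(ltW na0) // recip_bound.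
exists A1 => //; exists b, (nm a0)^-1; split=> // [|u uA].
  by rewrite /b /recip /= mul1r.
have [h1 h2] := psum_summable A10 bB uA.
have l3 k : (fun n : nat => b k * u ^+ k) @ \oo --> b k * u ^+ k by exact: cvg_cst.
have [S [hS _]] := dominated_series h2 (fun n k => h1 k) l3.
pose H := fun v => lim (psum b v @ \oo).
have bH v : nm v * A1 < 1 -> psum b v @ \oo --> H v.
  move=> vA; have [g1 g2] := psum_summable A10 bB vA.
  have g3 k : (fun n : nat => b k * v ^+ k) @ \oo --> b k * v ^+ k by exact: cvg_cst.
  have [S' [hS' _]] := dominated_series g2 (fun n k => g1 k) g3.
  by have -> : H v = S' by apply: cvg_lim => //; exact: norm_hausdorff.
have GH : G u * H u = 1.
  have e k : \sum_(i < k.+1) a i * b (k - i)%N = (k == 0%N)%:R.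
    case: k => [|k]; first by rewrite big_ord1 /b /recip /= mul1r ha0 mulfV.
    rewrite big_ord_recl /= subn0 {1}/b recipS ha0 mulrCA mulfV // mulr1 -big_split big1 // => i _ /=.
    by rewrite /bump add1n subSS /b /h; field.
  have aB1 k : nm (a k) <= B * A1 ^+ k.
    by apply: le_trans (aB k) _; rewrite ler_wpM2l //; apply: lerXn2r; rewrite ?nnegrE //; lra.
  have uA2 : nm u * A < 1 by apply: le_lt_trans uA; rewrite ler_wpM2l ?nm_ge0.
  have hp := cauchy_cvg A10 aB1 bB uA (aG u uA2) (bH u uA).
  apply: cvgC_unique hp _; rewrite -(cvg_shiftS (psum _ u)).
  have e' n : psum (fun k => \sum_(i < k.+1) a i * b (k - i)%N) u n.+1 = 1.
    by rewrite /psum big_ord_recl e mul1r expr0 big1 ?addr0 // => i _; rewrite e mul0r.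
  under eq_fun do rewrite e'; exact: cvg_cst.
have -> : (G u)^-1 = H u.
  have G0 : G u != 0 by apply/negP => /eqP g; move: GH; rewrite g mul0r => /esym/eqP; rewrite oner_eq0.
  by apply: (mulfI G0); rewrite GH mulfV.
exact: bH.
Qed.

Section InfiniteProduct.
Variables (c : nat -> K) (m : nat -> nat) (C A : R).
Hypotheses (cC : forall j, nm (c j) <= C) (mj : forall j, (j < m j)%N) (A1 : 1 < A).

Let rho := A^-1.
Let P n : {poly K} := \prod_(j < n) (1 - c j *: 'X^(m j)).

Let rho0 : 0 < rho. Proof. by rewrite invr_gt0 (lt_trans ltr01). Qed.
Let rho1 : rho < 1. Proof. by rewrite invf_lt1 // (lt_trans ltr01). Qed.
Let C0 : 0 <= C. Proof. exact: le_trans (nm_ge0 _) (cC 0%N). Qed.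

Lemma coef_factor n i :
  (P n.+1)`_i = (P n)`_i - (if (i < m n)%N then 0 else c n * (P n)`_(i - m n)).
Proof.
rewrite /P big_ord_recr /= mulrBr mulr1 coefB -scalerAr coefZ coefMXn.
by case: ifP; rewrite ?mulr0.
Qed.

(** The weighted sum of the moduli of the coefficients grows by at most 1 + C rho^(m n) <= exp(C
    rho^n) with each factor, so it is bounded uniformly in n. *)
Lemma weight_bound n L : \sum_(i < L) nm (P n)`_i * rho ^+ i <= expR (C * \sum_(j < n) rho ^+ j).
Proof.
elim: n L => [|n IH] L.
  rewrite big_ord0 mulr0 expR0 /P big_ord0; case: L => [|L]; first by rewrite big_ord0.
  rewrite big_ord_recl coefC /= nm1 mulr1 big1 ?addr0 // => i _.
  by rewrite coefC /= nm0 mul0r.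
rewrite big_ord_recr /= mulrDr expRD.
apply: (@le_trans _ _ (expR (C * \sum_(j < n) rho ^+ j) * (1 + C * rho ^+ n))); last first.
  by rewrite ler_wpM2l ?expR_ge0 // expR_ge1Dx.
apply: (@le_trans _ _ (\sum_(i < L) nm (P n)`_i * rho ^+ i +
    C * rho ^+ (m n) * \sum_(i < L - m n) nm (P n)`_i * rho ^+ i)).
  rewrite mulr_sumr.
  have -> : \sum_(i < L - m n) C * rho ^+ m n * (nm (P n)`_i * rho ^+ i)
      = \sum_(i < L) (if (i < m n)%N then 0 else C * (nm (P n)`_(i - m n) * rho ^+ i)).
    rewrite -(big_mkord xpredT (fun i => if (i < m n)%N then 0 else C * (nm (P n)`_(i - m n) * rho ^+ i))).
    rewrite -(big_mkord xpredT (fun i => C * rho ^+ m n * (nm (P n)`_i * rho ^+ i))).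
    case: (leqP (m n) L) => [mL|/ltnW Lm].
      rewrite [RHS](@big_cat_nat _ _ _ (m n)) //= [X in X + _]big_nat [X in X + _]big1 ?add0r; last first.
        by move=> i /andP[_ ->].
      rewrite -[X in _ = \sum_(X <= _ < _) _]add0n big_addn; apply: eq_bigr => i _.
      rewrite ltnNge leq_addl /= addnK exprD; ring.
    rewrite (eqP (_ : L - m n == 0)%N) ?subn_eq0 // big_geq // big_nat big1 // => i /andP[_ iL].
    by rewrite (leq_trans iL Lm).
  rewrite -big_split /=; apply: ler_sum => i _; rewrite coef_factor.
  case: ifP => _; first by rewrite subr0 addr0.
  rewrite mulrA -mulrDl ler_wpM2r ?exprn_ge0 ?(ltW rho0) //.
  apply: le_trans (nmB _ _) _; rewrite nmM lerD2l ler_wpM2r ?nm_ge0 //.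
rewrite mulrDr mulr1; apply: lerD; first exact: IH.
rewrite mulrC; apply: ler_pM => //.
- by apply: sumr_ge0 => i _; rewrite mulr_ge0 ?nm_ge0 ?exprn_ge0 // ltW.
- by rewrite mulr_ge0 ?exprn_ge0 // ltW.
- rewrite ler_wpM2l //; apply: ler_wiXn2l; rewrite ?(ltW rho0) ?(ltW rho1) //.
  exact/ltnW/mj.
Qed.

(** As m j > j, the coefficient of u^i does not change after i factors; these stable values are the
    coefficients, and [weight_bound] is their majorant. *)
Lemma analytic_product G : (forall u, nm u * A < 1 ->
    (fun n => \prod_(j < n) (1 - c j * u ^+ m j)) @ \oo --> G u) -> analytic A G 1.
Proof.
move=> hG; pose E := expR (C * (1 - rho)^-1).
have A0 : 0 < A by exact: lt_trans A1.
have bd n i : nm (P n)`_i <= E * A ^+ i.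
  have h1 : nm (P n)`_i * rho ^+ i <= E.
    have := weight_bound n i.+1; rewrite big_ord_recr /= => h.
    apply: (@le_trans _ _ (expR (C * \sum_(j < n) rho ^+ j))).
      apply: le_trans h; rewrite lerDr; apply: sumr_ge0 => j _.
      by rewrite mulr_ge0 ?nm_ge0 ?exprn_ge0 // ltW.
    by rewrite ler_expR ler_wpM2l // geo_sum_le // ltW.
  by rewrite -ler_pdivrMr ?exprn_gt0 // -exprVn.
have stab n i : (i <= n)%N -> (P n)`_i = (P i)`_i.
  elim: n => [|n IH]; first by rewrite leqn0 => /eqP ->.
  rewrite leq_eqVlt => /orP[/eqP -> //|]; rewrite ltnS => ni.
  by rewrite coef_factor (leq_ltn_trans ni (mj n)) subr0 IH.
exists (fun i => (P i)`_i), E; split=> [|k|u uA].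
- by rewrite /P big_ord0 coefC.
- exact: bd.
have [_ h2] := psum_summable A0 (fun k => bd k k) uA.
have h1 n k : nm ((P n)`_k * u ^+ k) <= E * (nm u * A) ^+ k.
  by rewrite nmM nmX exprMn [_ ^+ k * A ^+ k]mulrC mulrA ler_wpM2r ?exprn_ge0 ?nm_ge0.
have h3 k : (fun n => (P n)`_k * u ^+ k) @ \oo --> (P k)`_k * u ^+ k.
  by apply: cvg_near_cst; exists k => // n /= kn; rewrite stab.
have [S [hS1 hS2]] := dominated_series h2 h1 h3.
have -> : G u = S.
  apply: cvgC_unique (hG u uA) _.
  have := hS2 (fun n => size (P n)) (fun n k nk => ltac:(by rewrite nth_default ?mul0r)).
  apply: cvg_trans; apply: near_eq_cvg; apply: nearW => n.
  rewrite -horner_coef /P horner_prod; apply: eq_bigr => j _.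
  by rewrite !hornerE.
exact: hS1.
Qed.

End InfiniteProduct.

Definition germ G (a0 : K) : Prop := exists2 A : R, 0 < A & analytic A G a0.

Lemma germM G H a0 b0 : germ G a0 -> germ H b0 -> germ (fun u => G u * H u) (a0 * b0).
Proof.
move=> [A A0 hG] [B B0 hH]; exists (2 * Order.max A B).
  by rewrite mulr_gt0 // lt_max A0.
apply: analyticM; first by rewrite lt_max A0.
  by apply: analyticW hG => //; rewrite le_max lexx.
by apply: analyticW hH => //; rewrite le_max lexx orbT.
Qed.

Lemma germV G a0 : a0 != 0 -> germ G a0 -> germ (fun u => (G u)^-1) a0^-1.
Proof.
move=> a00 [A A0 hG]; have [A' AA' h] := analyticV A0 a00 hG.
by exists A' => //; exact: lt_le_trans AA'.
Qed.

Lemma germC (x : K) : germ (fun=> x) x.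
Proof.
exists 1 => //; exists (fun k => if k == 0%N then x else 0), (nm x); split=> // [k|u _].
  by rewrite expr1n mulr1; case: eqP => _; rewrite ?nm0 ?nm_ge0.
rewrite -(cvg_shiftS (psum _ u)).
have e n : psum (fun k => if k == 0%N then x else 0) u n.+1 = x.
  by rewrite /psum big_ord_recl /= expr0 mulr1 big1 ?addr0 // => i _; rewrite mul0r.
under eq_fun do rewrite e; exact: cvg_cst.
Qed.

Lemma germ_poch (x y : K) (k l : nat) : nm y <= 1 -> (0 < k)%N -> (0 < l)%N ->
  germ (fun u => poch (x * u ^+ l) (y * u ^+ k)) 1.
Proof.
move=> y1 k0 l0; exists 2 => //.
apply: (@analytic_product (fun j => x * y ^+ j) (fun j => l + k * j)%N (nm x) 2).
- move=> j; rewrite nmM nmX ler_piMr ?nm_ge0 // exprn_ile1 ?nm_ge0 //.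
- by move=> j; nia.
- by rewrite ltr1n.
move=> u u2; have u1 : nm u < 1 by have := nm_ge0 u; lra.
have q1 : nm (y * u ^+ k) < 1.
  rewrite nmM; apply: le_lt_trans (_ : nm (u ^+ k) < 1); last exact: nmX_lt1.
  by rewrite ler_piMl ?nm_ge0.
apply: cvg_trans (@cvg_poch R K (x * u ^+ l) _ q1); apply: near_eq_cvg; apply: nearW => n.
apply: eq_bigr => j _; congr (1 - _); rewrite exprMn exprD exprM; ring.
Qed.

Lemma analytic_poch (A : R) (k l : nat) : 1 < A -> (0 < k)%N -> (0 < l)%N ->
  analytic A (fun u => poch (u ^+ l) (u ^+ k)) 1.
Proof.
move=> A1 k0 l0; apply: (@analytic_product (fun=> 1) (fun j => l + k * j)%N 1 A) => //.
- by move=> j; rewrite nm1.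
- by move=> j; nia.
move=> u uA; have u1 : nm u < 1.
  by apply: le_lt_trans uA; rewrite ler_peMr ?nm_ge0 // ltW.
apply: cvg_trans (@cvg_poch R K (u ^+ l) _ (nmX_lt1 k0 u1)); apply: near_eq_cvg; apply: nearW => n.
by apply: eq_bigr => j _; rewrite mul1r exprD exprM.
Qed.

End PowerSeries.

(** * Laurent expansions in e(t / D) *)

Section Laurent.
Variables (R : realType) (K : cplxField R).
Implicit Types (t x y : K) (F G : K -> K).

(** The leading coefficient a_0 is required to be nonzero, which makes the notion stable under
    reciprocals. *)
Definition laurent (D : nat) F : Prop :=
  exists (n0 : int) G (a0 : K) (Y : R), [/\ germ G a0, a0 != 0 &
    forall t, Y < im t -> F t = ee (n0%:~R * (t / D%:R)) * G (ee (t / D%:R))].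

Lemma laurentM D F1 F2 : laurent D F1 -> laurent D F2 -> laurent D (fun t => F1 t * F2 t).
Proof.
move=> [n1 [G1 [a1 [Y1 [g1 a10 h1]]]]] [n2 [G2 [a2 [Y2 [g2 a20 h2]]]]].
exists (n1 + n2), (fun u => G1 u * G2 u), (a1 * a2), (Order.max Y1 Y2).
split; [exact: germM|exact: mulf_neq0|move=> t].
rewrite gt_max => /andP[t1 t2]; rewrite h1 // h2 // rmorphD mulrDl eeD /=; ring.
Qed.

Lemma laurentV D F : laurent D F -> laurent D (fun t => (F t)^-1).
Proof.
move=> [n1 [G1 [a1 [Y1 [g1 a10 h1]]]]]; exists (- n1), (fun u => (G1 u)^-1), a1^-1, Y1.
split; [exact: germV|by rewrite invr_eq0|move=> t t1].
by rewrite h1 // invfM rmorphN mulNr eeN.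
Qed.

Lemma laurentC D x : x != 0 -> laurent D (fun=> x).
Proof.
move=> x0; exists 0, (fun=> x), x, 0; split=> // [|t _]; first exact: germC.
by rewrite mul0r ee0 mul1r.
Qed.

Lemma eq_laurent D F1 F2 : (forall t, 0 < im t -> F1 t = F2 t) -> laurent D F1 -> laurent D F2.
Proof.
move=> e [n1 [G1 [a1 [Y1 [g1 a10 h1]]]]]; exists n1, G1, a1, (Order.max Y1 0); split=> // t.
by rewrite gt_max => /andP[t1 t0]; rewrite -e // h1.
Qed.

Lemma laurent_prod D (I : Type) (s : seq I) (Pr : pred I) (F : I -> K -> K) :
  (forall i, Pr i -> laurent D (F i)) -> laurent D (fun t => \prod_(i <- s | Pr i) F i t).
Proof.
move=> h; elim: s => [|i s IH].
  by under [X in laurent _ X]eq_fun do rewrite big_nil; exact/laurentC/oner_neq0.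
under [X in laurent _ X]eq_fun do rewrite big_cons.
by case hi: (Pr i) => //; apply: laurentM => //; exact: h.
Qed.

Lemma im_affine (A D' : nat) (B : int) t :
  im ((A%:R * t + B%:~R) / D'%:R) = A%:R * im t / D'%:R.
Proof.
have -> : (A%:R * t + B%:~R) / D'%:R = ofR D'%:R^-1 * (ofR A%:R * t + ofR B%:~R) :> K.
  by rewrite fmorphV !rmorph_nat rmorph_int mulrC.
by rewrite imM re_ofR im_ofR imD imM re_ofR !im_ofR !mul0r !addr0 mulrC.
Qed.

(** The leading exponent is (A / D') (6 j^2 - 6 j L + L^2) / (12 L^2), so the denominator 12 L^2 D'
    makes it and the exponents in both q-products integral; e is a free multiple. *)
Lemma laurent_gs_reduced (L j e A D' : nat) (B : int) y : (j < L)%N ->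
  (0 < A)%N -> (0 < D')%N -> (0 < e)%N -> (j = 0%N -> ee y != 1) ->
  laurent (12 * L ^ 2 * D' * e) (fun t => gs (j%:R / L%:R) y ((A%:R * t + B%:~R) / D'%:R)).
Proof.
move=> jL A0 D0 e0 jy; set D := (12 * L ^ 2 * D' * e)%N; pose x : K := j%:R / L%:R.
have L0 : (0 < L)%N by exact: leq_ltn_trans jL.
have Lk : L%:R != 0 :> K by rewrite pnatr_eq0 -lt0n.
have Dk : D'%:R != 0 :> K by rewrite pnatr_eq0 -lt0n.
have ek : e%:R != 0 :> K by rewrite pnatr_eq0 -lt0n.
pose be : K := B%:~R / D'%:R.
pose k := (12 * L ^ 2 * e * A)%N; pose l := (12 * L * e * A * j)%N.
have k0 : (0 < k)%N by rewrite /k; nia.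
have lk : (l < k)%N.
  have -> : k = (12 * L * e * A * L)%N by rewrite /k; nia.
  by rewrite /l ltn_pmul2l //; nia.
pose n0 : int := (A * e)%N%:Z * (6 * j%:Z ^+ 2 + L%:Z ^+ 2 - 6 * j%:Z * L%:Z).
pose cst := - ee ((x * (x * be + y) / 2 + be / 12 - (x * be + y) / 2)).
pose c1 := ee (x * be + y); pose q := ee be; pose c2 := ee (be - (x * be + y)).
have nq : nm q <= 1.
  have -> : nm q = 1; last by [].
  rewrite nm_ee (_ : im be = 0) ?mulr0 ?oppr0 ?expR0 //.
  by have := im_affine 0 D' B 0; rewrite !mul0r add0r.
have kK : k%:R = 12 * L%:R ^+ 2 * e%:R * A%:R :> K.
  by rewrite /k (natrM _ (12 * L ^ 2 * e) A) (natrM _ (12 * L ^ 2) e) (natrM _ 12 (L ^ 2)) natrX.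
have DK : D%:R = 12 * L%:R ^+ 2 * D'%:R * e%:R :> K.
  by rewrite /D (natrM _ (12 * L ^ 2 * D') e) (natrM _ (12 * L ^ 2) D') (natrM _ 12 (L ^ 2)) natrX.
have lK : l%:R = 12 * L%:R * e%:R * A%:R * j%:R :> K.
  by rewrite /l (natrM _ (12 * L * e * A) j) (natrM _ (12 * L * e) A) (natrM _ (12 * L) e) (natrM _ 12 L).
have n0K : n0%:~R = A%:R * e%:R * (6 * j%:R ^+ 2 + L%:R ^+ 2 - 6 * j%:R * L%:R) :> K.
  by rewrite /n0 PoszM !rmorphM rmorphB rmorphD !rmorphM /=; ring.
have main t : 0 < im t -> let u := ee (t / D%:R) in
    gs x y ((A%:R * t + B%:~R) / D'%:R) = ee (n0%:~R * (t / D%:R)) *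
     (cst * (poch (c1 * u ^+ l) (q * u ^+ k) * poch (c2 * u ^+ (k - l)) (q * u ^+ k))).
  move=> t0 u; set t' := (_ / D'%:R).
  have t0' : 0 < im t' by rewrite im_affine divr_gt0 ?mulr_gt0 ?ltr0n.
  have tE : t' = k%:R * (t / D%:R) + be.
    by rewrite /t' /be kK DK; field; rewrite ?Lk ?Dk ?ek.
  have xE : x * t' = l%:R * (t / D%:R) + x * be.
    by rewrite tE lK kK DK /x; field; rewrite ?Lk ?Dk ?ek.
  rewrite gs_prod // /u [RHS]mulrA; congr (_ * (poch _ _ * poch _ _)).
  - rewrite /cst mulrN -eeD; congr (- ee _).
    by rewrite xE tE n0K lK kK DK /x; field; rewrite ?Lk ?Dk ?ek.
  - by rewrite xE addrC addrA [y + _]addrC -addrA addrC /c1 eeD ee_natM; congr (ee _ * _); ring.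
  - by rewrite tE eeD ee_natM mulrC.
  - rewrite xE tE /c2 -ee_natM -eeD natrB ?(ltnW lk) //; congr ee; ring.
  - by rewrite tE eeD ee_natM mulrC.
have cst0 : cst != 0 by rewrite oppr_eq0 ee_neq0.
have kl0 : (0 < k - l)%N by rewrite subn_gt0.
case: (posnP j) => [j0|j0]; last first.
  exists n0, (fun u => cst * (poch (c1 * u ^+ l) (q * u ^+ k) * poch (c2 * u ^+ (k - l)) (q * u ^+ k))), (cst * (1 * 1)), 0.
  split; [|by rewrite !mulr1|exact: main].
  apply: germM; first exact: germC.
  by apply: germM; apply: germ_poch => //; rewrite /l; nia.
(* For j = 0 the first product starts with the constant factor 1 - e(y). It is split off, since
   [germ_poch] requires a positive power of u, and it is the nonzero leading coefficient. *)
have x0 : x = 0 by rewrite /x j0 mul0r.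
have c1E : c1 = ee y by rewrite /c1 x0 mul0r add0r.
exists n0, (fun u => cst * ((1 - ee y) * poch (c1 * q * u ^+ k) (q * u ^+ k) * poch (c2 * u ^+ (k - l)) (q * u ^+ k))),
  (cst * ((1 - ee y) * 1 * 1)), 0.
split=> [||t t0].
- apply: germM; first exact: germC.
  by do 2 (apply: germM; last exact: germ_poch); exact: germC.
- by rewrite !mulr1 mulf_neq0 // subr_eq0 eq_sym jy.
rewrite main //; congr (_ * (_ * (_ * _))).
have l0 : l = 0%N by rewrite /l j0 muln0.
have u1 : nm (q * ee (t / D%:R) ^+ k) < 1.
  rewrite nmM; apply: le_lt_trans (_ : nm (ee (t / D%:R) ^+ k) < 1).
    by rewrite ler_piMl ?nm_ge0.
  apply: nmX_lt1 => //; apply: nm_ee_lt1.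
  have := im_affine 1 D 0 t; rewrite mul1r addr0 => ->.
  by rewrite mul1r divr_gt0 // ltr0n /D; nia.
by rewrite l0 expr0 mulr1 poch_rec // c1E mulrA.
Qed.

Lemma gs_shift1z (Q : int) x y : exists2 c : K, c != 0 & forall t, 0 < im t -> gs (x + Q%:~R) y t = c * gs x y t.
Proof.
have s0 : - ee (- (y / 2)) != 0 :> K by rewrite oppr_eq0 ee_neq0.
case: Q => n.
  by exists ((- ee (- (y / 2))) ^+ n) => [|t t0]; [rewrite expf_neq0|rewrite -gs_shift1n].
exists ((- ee (- (y / 2))) ^- n.+1) => [|t t0]; first by rewrite invr_eq0 expf_neq0.
apply: (mulfI (expf_neq0 n.+1 s0)); rewrite -gs_shift1n // mulrA mulfV ?expf_neq0 // mul1r.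
by rewrite NegzE mulrNz subrK.
Qed.

(** diag(m, 1) times the given matrix is written as (p, q'; r, s) (g, B; 0, D') with the first
    factor in SL_2(Z) and g = gcd(m a, c). Modularity removes the first factor, and the triangular
    one is an affine substitution. *)
Lemma laurent_gs (m L i : nat) (a b c d : int) (D : nat) :
  (0 < m)%N -> (0 < i < L)%N -> a * d - b * c = 1 -> (0 < D)%N -> (12 * L ^ 2 * m %| D)%N ->
  laurent D (fun t => gs (i%:R / L%:R) 0 (m%:R * ((a%:~R * t + b%:~R) / (c%:~R * t + d%:~R)))).
Proof.
move=> m0 /andP[i0 iL] h D0 mD; have L0 : (0 < L)%N by lia.
pose g := gcdz (m%:Z * a) c.
have mE : m%:Z = (m%:Z * a) * d - m%:Z * b * c by rewrite -[LHS]mulr1 -h; ring.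
have g0 : g != 0.
  apply/negP => /eqP g0; have : (g %| m%:Z)%Z.
    by rewrite [X in (_ %| X)%Z]mE; apply: rpredB; [exact: dvdz_mulr (dvdz_gcdl _ _)|exact: dvdz_mull (dvdz_gcdr _ _)].
  by rewrite g0 dvd0z => /eqP; lia.
have /dvdzP[p pE] := dvdz_gcdl (m%:Z * a) c.
have /dvdzP[r rE] := dvdz_gcdr (m%:Z * a) c.
rewrite -/g in pE rE.
have [s [q' bez]] : exists s q', p * s - q' * r = 1.
  have [s [v bz]] := Bezoutz (m%:Z * a) c; exists s, (- v); apply: (mulIf g0).
  rewrite mul1r; transitivity (s * (m%:Z * a) + v * c); last exact: bz.
  by rewrite pE {1}rE; ring.
have gE : g = `|g|%N by rewrite gez0_abs // /g.
pose D' := p * d - r * b * m%:Z; pose B := s * (m%:Z * b) - q' * d.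
have D'g : D' * g = m%:Z by rewrite [RHS]mE pE rE -/g /D'; ring.
have D'0 : 0 < D'.
  have gp : 0 < g by rewrite lt_def g0.
  by rewrite -(pmulr_lgt0 _ gp) D'g; lia.
have D'E : D' = `|D'|%N by rewrite gez0_abs // ltW.
have [e eE] : exists e, D = (12 * L ^ 2 * `|D'| * e)%N.
  have /dvdnP[e ->] : (12 * L ^ 2 * `|D'| %| D)%N.
    apply: dvdn_trans mD; rewrite dvdn_pmul2l; last by nia.
    by rewrite -[X in (_ %| X)%N]absz_nat -D'g abszM dvdn_mulr.
  by exists e; rewrite mulnC.
have mL (z : int) : exists j Q, (j < L)%N /\ z = j%:Z + L%:Z * Q.
  exists `|(z %% L%:Z)%Z|%N, (z %/ L%:Z)%Z; split.
    by rewrite -ltz_nat gez0_abs ?modz_ge0 ?ltz_pmod //; lia.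
  by rewrite gez0_abs ?modz_ge0 //; [rewrite [LHS](divz_eq z L%:Z); ring|lia].
have [j [Q [jL jE]]] := mL (i%:Z * p).
have Lk : L%:R != 0 :> K by rewrite pnatr_eq0 -lt0n.
have [cs cs0 csE] := gs_shift1z Q (j%:R / L%:R) (i%:R / L%:R * q'%:~R).
have mu0 : mult K p q' r s != 0 by rewrite mulf_neq0 // ee_neq0.
have gK : g%:~R = `|g|%N%:R :> K by rewrite gE.
have DK : D'%:~R = `|D'|%N%:R :> K by rewrite [in LHS]D'E.
apply: (@eq_laurent _ (fun t => mult K p q' r s * (cs *
   gs (j%:R / L%:R) (i%:R / L%:R * q'%:~R) ((`|g|%N%:R * t + B%:~R) / `|D'|%N%:R)))).
  move=> t t0; rewrite -csE; last first.
    by rewrite im_affine divr_gt0 ?mulr_gt0 ?ltr0n // absz_gt0 // gt_eqF.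
  set t' := (_ / `|D'|%N%:R).
  have t0' : 0 < im t' by rewrite im_affine divr_gt0 ?mulr_gt0 ?ltr0n // absz_gt0 // gt_eqF.
  have -> : m%:R * ((a%:~R * t + b%:~R) / (c%:~R * t + d%:~R))
     = (p%:~R * t' + q'%:~R) / (r%:~R * t' + s%:~R).
    have Dn : D'%:~R != 0 :> K by rewrite DK pnatr_eq0 absz_eq0 gt_eqF.
    have tD : t' * D'%:~R = g%:~R * t + B%:~R by rewrite DK gK /t' divfK // -DK.
    have e1 : r * B + s * D' = d.
      by rewrite -[RHS]mulr1 -bez /B /D'; ring.
    have e2 : p * B + q' * D' = m%:Z * b.
      by rewrite -[RHS]mulr1 -bez /B /D'; ring.
    have n1 : r%:~R * t' + s%:~R = (c%:~R * t + d%:~R) / D'%:~R.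
      apply: (mulIf Dn); rewrite divfK // mulrDl -mulrA tD.
      have e3 : c%:~R = r%:~R * g%:~R :> K by rewrite -rmorphM -rE.
      have e4 : d%:~R = r%:~R * B%:~R + s%:~R * D'%:~R :> K by rewrite -!rmorphM -rmorphD e1.
      by rewrite e3 e4; ring.
    have n2 : p%:~R * t' + q'%:~R = m%:R * (a%:~R * t + b%:~R) / D'%:~R.
      apply: (mulIf Dn); rewrite divfK // mulrDl -mulrA tD.
      have e3 : m%:R * a%:~R = p%:~R * g%:~R :> K by rewrite -rmorphM -pE rmorphM.
      have e4 : m%:R * b%:~R = p%:~R * B%:~R + q'%:~R * D'%:~R :> K by rewrite -!rmorphM -rmorphD e2 rmorphM.
      transitivity (m%:R * a%:~R * t + m%:R * b%:~R); last by ring.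
      by rewrite e3 e4; ring.
    by rewrite n1 n2 invf_div [RHS]mulrA divfK // mulrA.
  rewrite (gs_modular bez _ _ t0') !mul0r !addr0; congr (_ * gs _ _ _).
  have : (i%:Z * p)%:~R = (j%:Z + L%:Z * Q)%:~R :> K by rewrite jE.
  by rewrite rmorphD !rmorphM /= => e5; rewrite mulrAC e5; field.
apply: laurentM; first exact: laurentC.
apply: laurentM; first exact: laurentC.
rewrite eE; apply: laurent_gs_reduced => //.
- by rewrite absz_gt0.
- by rewrite absz_gt0 gt_eqF.
- by move: D0; rewrite eE; case: (e) => //; rewrite muln0.
(* If L divided i p and i q', it would divide i = i (p s - q' r), although 0 < i < L. *)
move=> j0; apply/negP => /eqP /ee_eq1 [z hz].
have iq : i%:Z * q' = L%:Z * z.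
  apply: (@intr_inj K); rewrite !rmorphM /= -hz; by field.
have ip : i%:Z * p = L%:Z * Q by rewrite jE j0 add0r.
have : (L%:Z %| i%:Z)%Z.
  apply/dvdzP; exists (Q * s - z * r); rewrite -[LHS]mulr1 -bez mulrBr mulrA ip mulrA iq; ring.
by rewrite dvdzE !absz_nat => /dvdn_leq; lia.
Qed.

Lemma laurent_eta (n k : nat) (a b c d : int) (D : nat) :
  a * d - b * c = 1 -> (0 < D)%N ->
  (12 * 4 ^ 2 * (32 * (2 * n + 1)) %| D)%N ->
  (12 * (2 * n + 1) ^ 2 * (4 * (2 * n + 1) ^ 2) %| D)%N ->
  laurent D (fun t => eta_quotient n k ((a%:~R * t + b%:~R) / (c%:~R * t + d%:~R))).
Proof.
move=> h D0 D1 D2; rewrite /eta_quotient.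
apply: laurentM.
  under [X in laurent _ X]eq_fun do rewrite -mulN1r.
  apply: laurentM; first by apply: laurentC; rewrite oppr_eq0 oner_neq0.
  rewrite -[1 / 4]/(1%:R / 4%:R).
  by apply: laurent_gs => //; lia.
apply: laurentV; apply: laurent_prod => i _; apply: laurent_gs => //; first by lia.
by have := ltn_ord i; lia.
Qed.

Lemma germXn (r : nat) : germ (fun u : K => u ^+ r) (r == 0%N)%:R.
Proof.
exists 1 => //; exists (fun k => (r == k)%:R), 1; split=> // [k|u _].
  by rewrite mul1r expr1n; case: eqP => _; rewrite ?nm0 ?nm1.
rewrite -(cvg_shiftn r.+1 (psum _ u)).
have e n : psum (fun k => (r == k)%:R) u (n + r.+1) = u ^+ r.
  have rn : (r < n + r.+1)%N by lia.
  rewrite /psum (bigD1 (Ordinal rn)) //= eqxx mul1r big1 ?addr0 // => i.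
  by rewrite -val_eqE /= eq_sym => /negbTE ->; rewrite mul0r.
under eq_fun do rewrite e; exact: cvg_cst.
Qed.

Lemma sum_roots (e k : nat) : (0 < e)%N ->
  \sum_(s < e) ee (k%:R / e%:R : K) ^+ s = (if (e %| k)%N then e%:R else 0).
Proof.
move=> e0; have ek : e%:R != 0 :> K by rewrite pnatr_eq0 -lt0n.
case: ifP => [/dvdnP[z ->]|nd].
  rewrite natrM mulfK // ee_nat; under eq_bigr do rewrite expr1n.
  by rewrite sumr_const card_ord.
have z1 : ee (k%:R / e%:R : K) != 1.
  apply/negP => /eqP /ee_eq1 [z hz]; move/negP: nd; apply.
  have : k%:Z = z * e%:Z by apply: (@intr_inj K); rewrite rmorphM /= -hz divfK.
  by move=> h; rewrite -[k]absz_nat h abszM dvdn_mull.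
move: z1; rewrite -subr_eq0 => z1; apply: (mulfI z1); rewrite -subrX1 mulr0.
by rewrite -ee_natM mulrC divfK // ee_nat subrr.
Qed.

(* A series in e(t / (w e)) is averaged over the e translates t + s w, which
   kills the exponents that are not multiples of e. *)
Lemma laurent_expansion (w e : nat) F : (0 < w)%N -> (0 < e)%N -> laurent (w * e) F ->
  (forall t, 0 < im t -> F (t + w%:R) = F t) ->
  exists (q : int) (a : nat -> K) (Y : R), forall t, 0 < im t -> Y < im t ->
    (fun N => \sum_(k < N) a k * ee ((q + k%:Z)%:~R / w%:R * t)) @ \oo --> F t.
Proof.
move=> w0 e0 [n0 [G [a0 [Y [gG a00 hF]]]]] per; set D := (w * e)%N in hF.
have wk : w%:R != 0 :> K by rewrite pnatr_eq0 -lt0n.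
have ek : e%:R != 0 :> K by rewrite pnatr_eq0 -lt0n.
have e0z : e%:Z != 0 by lia.
(* The order n0 need not be a multiple of e; its remainder is moved into the power series as u^r
   before averaging. *)
pose q := (n0 %/ e%:Z)%Z; pose r := `|(n0 %% e%:Z)%Z|%N.
have n0E : n0 = e%:Z * q + r%:Z.
  by rewrite /r gez0_abs ?modz_ge0 // [LHS](divz_eq n0 e%:Z) mulrC.
have [A A0 [a [B [_ aB aG]]]] := germM (germXn r) gG.
have [Y1 hY1] : exists Y1 : R, forall t, Y1 < im t -> nm (ee (t / D%:R)) * A < 1.
  (* |e(t / D)| A < 1 amounts to 2 pi im t / D > ln A. *)
  exists (D%:R * ln A / (2 * pi)) => t ht.
  have D0 : 0 < D%:R :> R by rewrite ltr0n muln_gt0 w0.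
  rewrite -ltr_pdivlMr // div1r nm_ee -[X in _ < X]lnK ?posrE ?invr_gt0 // ltr_expR lnV ?posrE // ltrN2.
  have := im_affine 1 D 0 t; rewrite mul1r addr0 mul1r => ->.
  rewrite ltr_pdivrMr ?mulr_gt0 ?pi_gt0 // in ht.
  by rewrite mulrA ltr_pdivlMr // [ln A * _]mulrC [2 * pi * _]mulrC.
exists q, (fun j => a (e * j)%N), (Order.max Y Y1) => t t0.
rewrite gt_max => /andP[tY /hY1 tA].
set u := ee (t / D%:R) in tA; pose ze : K := ee (1 / e%:R).
have ue : u ^+ e = ee (t / w%:R).
  by rewrite /u -ee_natM /D natrM; congr ee; field; rewrite wk ek.
have nmze s : nm (ze ^+ s) = 1.
  rewrite nmX (_ : nm ze = 1) ?expr1n // nm_ee.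
  by have := im_affine 0 e 1 0; rewrite !mul0r add0r => ->; rewrite mulr0 oppr0 expR0.
have F_s (s : nat) : F t = ee (q%:~R * (t / w%:R)) * ((ze ^+ s * u) ^+ r * G (ze ^+ s * u)).
  have per_s : F (t + (w * s)%N%:R) = F t.
    elim: s => [|s IH]; first by rewrite muln0 addr0.
    rewrite mulnS addnC natrD addrA per // imD.
    by have := im_natM (w * s) (1 : K); rewrite mulr1 im1 mulr0 => ->; rewrite addr0.
  rewrite -per_s hF; last first.
    by rewrite imD; have := im_natM (w * s) (1 : K); rewrite mulr1 im1 mulr0 => ->; rewrite addr0.
  have -> : ee ((t + (w * s)%N%:R) / D%:R) = ze ^+ s * u.
    by rewrite /ze -ee_natM -eeD /u /D !natrM; congr ee; field; rewrite wk ek.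
  rewrite mulrA; congr (_ * _).
  rewrite n0E rmorphD mulrDl eeD /= ; congr (_ * _).
    rewrite (_ : (e%:Z * q)%:~R * _ = q%:~R * (t / w%:R) + (q * s%:Z)%:~R).
      by rewrite eeD ee_int mulr1.
    by rewrite /D !rmorphM /= ?natrM; field; rewrite wk ek.
  by rewrite /ze /u -ee_natM -eeD -ee_natM; congr ee; rewrite /D !natrM; field; rewrite wk ek.
have cv s : psum a (ze ^+ s * u) @ \oo --> (ze ^+ s * u) ^+ r * G (ze ^+ s * u).
  by apply: aG; rewrite nmM nmze mul1r.
have h1 : (fun n => \sum_(s < e) ee (q%:~R * (t / w%:R)) * psum a (ze ^+ s * u) n) @ \oo --> \sum_(s < e) F t.
  apply: cvg_big => [|s _]; first exact: add_continuous.
  by rewrite (F_s s); apply: cvgMn; [exact: cvg_cst|exact: cv].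
have h2 := cvg_subseq e0 h1.
have h3 : (fun N => e%:R^-1 * \sum_(s < e) ee (q%:~R * (t / w%:R)) * psum a (ze ^+ s * u) (N * e)) @ \oo --> F t.
  have -> : F t = e%:R^-1 * \sum_(s < e) F t.
    by rewrite sumr_const card_ord -[F t *+ e]mulr_natl mulKf.
  by apply: cvgMn; [exact: cvg_cst|exact: h2].
apply: cvg_trans h3; apply: near_eq_cvg; apply: nearW => N.
have -> : \sum_(s < e) ee (q%:~R * (t / w%:R)) * psum a (ze ^+ s * u) (N * e)
   = ee (q%:~R * (t / w%:R)) * \sum_(k < N * e) a k * u ^+ k * (if (e %| k)%N then e%:R else 0).
  rewrite -mulr_sumr; congr (_ * _); rewrite /psum exchange_big; apply: eq_bigr => k _ /=.
  rewrite -(sum_roots _ e0) mulr_sumr; apply: eq_bigr => s _.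
  rewrite exprMn -mulrA; congr (_ * _); rewrite mulrC -exprM [(s * k)%N]mulnC exprM; congr (_ * _ ^+ _).
  by rewrite /ze -ee_natM mulrA mulr1.
rewrite -(big_mkord xpredT (fun k => a k * u ^+ k * (if (e %| k)%N then e%:R else 0))) big_nat_mul big_mkord.
rewrite mulrCA mulr_sumr mulr_sumr; apply: eq_bigr => j _.
rewrite big_ltn; last by rewrite mulSn; lia.
rewrite dvdn_mull // big_nat big1 /=; last first.
  move=> i /andP[i1 i2]; rewrite (_ : (e %| i)%N = false) ?mulr0 //.
  by apply/negP => /dvdnP[z zE]; move: i1 i2; rewrite zE ltn_pmul2r // ltn_pmul2r //; lia.
rewrite addr0 mulrA [(j * e)%N]mulnC exprM ue -ee_natM.
have -> : ee ((q + j%:Z)%:~R / w%:R * t) = ee (q%:~R * (t / w%:R)) * ee (j%:R * (t / w%:R)).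
  by rewrite -eeD rmorphD /=; congr ee; field.
by move: (ee _) (ee _) => x y; field.
Qed.

End Laurent.

(** * Holomorphy *)

Section ComplexDerivative.
Variables (R : realType) (K : cplxField R).
Implicit Types (u v w z t : K) (F G : K -> K).

#[local] Instance nbhs_cplx_filter z : Filter (nbhs z) := nbhs_filter z.

Lemma nearWK z (P : K -> Prop) : (forall w, P w) -> \forall w \near z, P w.
Proof. by move=> h; apply: (@filterS _ _ _ setT) => //; exact: filterT. Qed.

(* Caratheodory's form of differentiability. *)
Definition cdiff F z : Prop := exists phi : K -> K,
  phi w @[w --> z] --> phi z /\ \forall w \near z, F w = F z + phi w * (w - z).

Lemma cvg_sub_self z : (w - z) @[w --> z] --> 0.
Proof. by rewrite -[X in _ --> X](subrr z); apply: cvgB; [exact: cvg_id|exact: cvg_cst]. Qed.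

Lemma cdiff_cvg F z : cdiff F z -> F w @[w --> z] --> F z.
Proof.
move=> [phi [h1 h2]].
have h : (F z + phi w * (w - z)) @[w --> z] --> F z.
  rewrite -[X in _ --> X]addr0 -[X in _ --> _ + X](mulr0 (phi z)).
  by apply: cvgD; [exact: cvg_cst|apply: cvgM => //; exact: cvg_sub_self].
apply: cvg_trans h; apply: near_eq_cvg.
by apply: filterS h2 => w ->.
Qed.

Lemma cdiff_eq F G z : (\forall w \near z, F w = G w) -> cdiff F z -> cdiff G z.
Proof.
move=> e [phi [h1 h2]]; exists phi; split=> //.
have ez : F z = G z by exact: nbhs_singleton e.
by apply: filterS2 e h2 => w <- ->; rewrite ez.
Qed.

Lemma cdiff_lin (a b : K) z : cdiff (fun w => a * w + b) z.
Proof.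
exists (fun=> a); split; first exact: cvg_cst.
by apply: nearWK => w; ring.
Qed.

Lemma cdiff_cst (a : K) z : cdiff (fun=> a) z.
Proof.
exists (fun=> 0); split; first exact: cvg_cst.
by apply: nearWK => w; rewrite mul0r addr0.
Qed.

Lemma cdiffM F G z : cdiff F z -> cdiff G z -> cdiff (fun w => F w * G w) z.
Proof.
move=> dF dG; have cG := cdiff_cvg dG; have [f [f1 f2]] := dF; have [g [g1 g2]] := dG.
exists (fun w => f w * G w + F z * g w); split.
  apply: cvgD; first by apply: cvgM.
  by apply: cvgM => //; exact: cvg_cst.
by apply: filterS2 f2 g2 => w -> hg; rewrite mulrDl {1}hg; ring.
Qed.

Lemma cdiffV F z : F z != 0 -> cdiff F z -> cdiff (fun w => (F w)^-1) z.
Proof.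
move=> F0 dF; have cF := cdiff_cvg dF; have [f [f1 f2]] := dF.
exists (fun w => - (f w * ((F w)^-1 * (F z)^-1))); split.
  apply: cvgN; apply: cvgM => //; apply: cvgM; last exact: cvg_cst.
  exact: cvgV.
have n0 : \forall w \near z, F w != 0.
  have /cvgnmP /(_ (nm (F z))) := cF; rewrite nm_gt0 => /(_ F0); apply: filterS => w.
  by apply: contraTneq => ->; rewrite sub0r nmN ltxx.
apply: filterS2 f2 n0 => w hw w0.
have -> : f w * ((F w)^-1 * (F z)^-1) = f w / (F w * F z) by rewrite invfM.
have e : f w * (w - z) = F w - F z by rewrite hw; ring.
have -> : - (f w / (F w * F z)) * (w - z) = - ((f w * (w - z)) / (F w * F z)) by ring.
by rewrite e; field; rewrite w0 F0.
Qed.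

Lemma cdiff_comp F G z : cdiff F (G z) -> cdiff G z -> cdiff (fun w => F (G w)) z.
Proof.
move=> [f [f1 f2]] dG; have cG := cdiff_cvg dG; have [g [g1 g2]] := dG.
exists (fun w => f (G w) * g w); split.
  by apply: cvgM => //; exact: cvg_comp cG f1.
have f2' : \forall w \near z, F (G w) = F (G z) + f (G w) * (G w - G z) by exact: (cG _ f2).
by apply: filterS2 f2' g2 => w -> hw; rewrite {2}hw; ring.
Qed.

Lemma cdiff_prod (I : Type) (s : seq I) (Pr : pred I) (F : I -> K -> K) z :
  (forall i, Pr i -> cdiff (F i) z) -> cdiff (fun w => \prod_(i <- s | Pr i) F i w) z.
Proof.
move=> h; elim: s => [|i s IH].
  by under [X in cdiff X]eq_fun do rewrite big_nil; exact: cdiff_cst.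
under [X in cdiff X]eq_fun do rewrite big_cons.
by case hi: (Pr i) => //; apply: cdiffM => //; exact: h.
Qed.

Lemma cdiff_lipschitz F z (L : K) (C : R) :
  (\forall w \near z, nm (F w - F z - L * (w - z)) <= C * nm (w - z) ^+ 2) -> cdiff F z.
Proof.
move=> h; exists (fun w => if w == z then L else (F w - F z) / (w - z)); split; last first.
  apply: nearWK => w; case: eqP => [->|/eqP wz]; first by rewrite subrr mulr0 addr0.
  by rewrite divfK ?subr_eq0 // addrC subrK.
rewrite eqxx; apply: (@cvg_nm_le _ _ _ _ _ _ _ (fun w => C * nm (w - z))).
  apply: filterS h => w; case: eqP => [->|/eqP wz] hw.
    by rewrite !subrr nm0 mulr0.
  have w0 : w - z != 0 by rewrite subr_eq0.
  have -> : (F w - F z) / (w - z) - L = (F w - F z - L * (w - z)) / (w - z).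
    by move: (F w - F z) => X; field.
  by rewrite nmM nmV ler_pdivrMr ?nm_gt0 // -mulrA -expr2.
rewrite -[X in _ --> X](mulr0 C); apply: cvgM; first exact: cvg_cst.
rewrite -[X in _ --> X](@nm0 R K); exact: cvg_nm (cvg_sub_self z).
Qed.

Lemma bernoulli (h : R) k : 0 < h -> h <= 1 -> h * k.+1%:R <= (1 + h) ^+ k.
Proof.
move=> h0 h1; have : 1 + k%:R * h <= (1 + h) ^+ k.
  elim: k => [|k IH]; first by rewrite mul0r addr0 expr0.
  rewrite exprSr; apply: le_trans (ler_wpM2r _ IH); last by lra.
  have k0 : 0 <= k%:R :> R by [].
  have := mulr_ge0 (mulr_ge0 k0 (ltW h0)) (ltW h0); rewrite -natr1; lra.
by rewrite -natr1; lra.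
Qed.

(** Bernoulli's inequality gives (k + 1)^2 <= h^-2 (1 + h)^(2 k), and h = (1 - x) / 4 is small
    enough for (1 + h)^2 x < 1. *)
Lemma sum_sqr_geo (x : R) : 0 <= x -> x < 1 ->
  exists C : R, forall n, \sum_(k < n) (k.+1%:R ^+ 2 * x ^+ k) <= C.
Proof.
move=> x0 x1; pose h := (1 - x) / 4; pose y := (1 + h) ^+ 2 * x.
have h0 : 0 < h by rewrite /h; lra.
have h1 : h <= 1 by rewrite /h; lra.
have y0 : 0 <= y by rewrite mulr_ge0 // sqr_ge0.
have y1 : y < 1.
  have xE : x = 1 - 4 * h by rewrite /h; field.
  have hh : 0 < h * h by rewrite mulr_gt0.
  have hhh : 0 < h * h * h by rewrite mulr_gt0.
  by rewrite /y xE expr2; lra.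
exists (h^-1 ^+ 2 * (1 - y)^-1) => n.
apply: (@le_trans _ _ (\sum_(k < n) h^-1 ^+ 2 * y ^+ k)); last first.
  by rewrite -mulr_sumr ler_wpM2l ?geo_sum_le // exprn_ge0 // invr_ge0 ltW.
apply: ler_sum => k _; rewrite /y exprMn mulrA ler_wpM2r ?exprn_ge0 //.
rewrite -exprM mulnC exprM -exprMn; apply: lerXn2r; rewrite ?nnegrE ?mulr_ge0 ?invr_ge0 ?exprn_ge0 //; try lra.
by rewrite ler_pdivlMl // bernoulli.
Qed.

(** The second-order remainder of u^(j+1) at u0 is at most (j+1)^2 rho^(j-1) |u - u0|^2 for |u| <=
    rho. Here rho A = x is the midpoint of |u0| A and 1, so these bounds are summable against the
    coefficients. *)
Lemma analytic_cdiff (A : R) G (a0 : K) u0 : 0 < A -> analytic A G a0 -> nm u0 * A < 1 -> cdiff G u0.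
Proof.
move=> A0 [a [B [_ aB aG]]] uA.
have B0 : 0 <= B by have := aB 0%N; rewrite expr0 mulr1; apply: le_trans; exact: nm_ge0.
pose x := (1 + nm u0 * A) / 2; pose rho := x / A.
have x0 : 0 < x by have := mulr_ge0 (nm_ge0 u0) (ltW A0); rewrite /x; lra.
have x1 : x < 1 by rewrite /x; lra.
have rho0 : 0 < rho by rewrite divr_gt0.
have rhoA : rho * A = x by rewrite /rho divfK // gt_eqF.
have u_rho : nm u0 < rho by rewrite /rho ltr_pdivlMr // /x; lra.
have [C hC] := sum_sqr_geo (ltW x0) x1.
have pow_le v i : nm v <= rho -> nm (v ^+ i) <= rho ^+ i.
  by move=> h; rewrite nmX; apply: lerXn2r; rewrite ?nnegrE ?nm_ge0 // ltW.
have pow1 v i : nm v <= rho -> nm (v ^+ i - u0 ^+ i) <= nm (v - u0) * (i%:R * rho ^+ i / rho).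
  move=> h; case: i => [|i]; first by rewrite subrr nm0 !mul0r mulr0.
  rewrite subrXX nmM ler_wpM2l ?nm_ge0 // exprSr mulrA mulfK ?gt_eqF //.
  apply: le_trans (nm_sum _ _ _) _.
  apply: (@le_trans _ _ (\sum_(k < i.+1) rho ^+ i)); last by rewrite sumr_const card_ord mulr_natl.
  apply: ler_sum => k _; rewrite nmM (_ : rho ^+ i = rho ^+ (i - k) * rho ^+ k); last first.
    by rewrite -exprD subnK // -ltnS.
  apply: ler_pM; rewrite ?nm_ge0 //; first exact: pow_le.
  exact/pow_le/ltW.
have pow2 v j : nm v <= rho ->
    nm (v ^+ j.+1 - u0 ^+ j.+1 - j.+1%:R * u0 ^+ j * (v - u0))
    <= nm (v - u0) ^+ 2 * (j.+1%:R ^+ 2 * rho ^+ j / rho).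
  move=> h; have -> : v ^+ j.+1 - u0 ^+ j.+1 - j.+1%:R * u0 ^+ j * (v - u0)
     = (v - u0) * \sum_(i < j.+1) (v ^+ (j - i) - u0 ^+ (j - i)) * u0 ^+ i.
    rewrite subrXX -[X in _ - X]mulrC -mulrBr; congr (_ * _).
    have -> : j.+1%:R * u0 ^+ j = \sum_(i < j.+1) u0 ^+ (j - i) * u0 ^+ i.
      rewrite (eq_bigr (fun=> u0 ^+ j)); first by rewrite sumr_const card_ord mulr_natl.
      by move=> i _; rewrite -exprD subnK // -ltnS.
    by rewrite -sumrB; apply: eq_bigr => i _; rewrite /= mulrBl.
  rewrite nmM expr2 -mulrA ler_wpM2l ?nm_ge0 //; apply: le_trans (nm_sum _ _ _) _.
  apply: (@le_trans _ _ (\sum_(i < j.+1) nm (v - u0) * (j.+1%:R * rho ^+ j / rho))); last first.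
    by rewrite sumr_const card_ord -[_ *+ _]mulr_natl le_eqVlt; apply/orP; left; apply/eqP; ring.
  apply: ler_sum => i _; rewrite nmM.
  have ij : (i <= j)%N by rewrite -ltnS.
  apply: le_trans (ler_pM (nm_ge0 _) (nm_ge0 _) (pow1 v (j - i)%N h) (pow_le u0 i (ltW u_rho))) _.
  have -> : rho ^+ j = rho ^+ (j - i) * rho ^+ i by rewrite -exprD subnK.
  pose cc := nm (v - u0) * (rho ^+ (j - i) * rho ^+ i / rho).
  have cc0 : 0 <= cc by rewrite !mulr_ge0 ?nm_ge0 ?exprn_ge0 ?invr_ge0 // ltW.
  have jj : (j - i)%:R <= j.+1%:R :> R by rewrite ler_nat; clear; lia.
  have -> : nm (v - u0) * ((j - i)%:R * rho ^+ (j - i) / rho) * rho ^+ i = cc * (j - i)%:R by rewrite /cc; ring.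
  have -> : nm (v - u0) * (j.+1%:R * (rho ^+ (j - i) * rho ^+ i) / rho) = cc * j.+1%:R by rewrite /cc; ring.
  exact: ler_wpM2l.
pose L := lim (psum (fun j => a j.+1 * j.+1%:R) u0 @ \oo).
have dom1 k : nm (a k.+1 * k.+1%:R * u0 ^+ k) <= B * A * (k.+1%:R ^+ 2 * x ^+ k).
  rewrite !nmM nm_nat nmX -rhoA exprMn.
  apply: (@le_trans _ _ (B * A ^+ k.+1 * k.+1%:R * rho ^+ k)).
    apply: ler_pM; rewrite ?mulr_ge0 ?exprn_ge0 ?nm_ge0 //.
      by rewrite ler_wpM2r.
    by apply: lerXn2r; rewrite ?nnegrE ?nm_ge0 // ltW.
  have -> : B * A * (k.+1%:R ^+ 2 * (rho ^+ k * A ^+ k)) = B * A ^+ k.+1 * k.+1%:R * rho ^+ k * k.+1%:R.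
    by rewrite [A ^+ k.+1]exprS; ring.
  by rewrite ler_peMr ?ler1n // !mulr_ge0 ?exprn_ge0 // ltW.
have dom2 n : \sum_(k < n) B * A * (k.+1%:R ^+ 2 * x ^+ k) <= B * A * C.
  by rewrite -mulr_sumr ler_wpM2l // mulr_ge0 // ltW.
have hL : psum (fun j => a j.+1 * j.+1%:R) u0 @ \oo --> L.
  have h3 k : (fun _ : nat => a k.+1 * k.+1%:R * u0 ^+ k) @ \oo --> a k.+1 * k.+1%:R * u0 ^+ k by exact: cvg_cst.
  have [S [hS _]] := dominated_series dom2 (fun _ => dom1) h3.
  by have -> : L = S by apply: cvg_lim => //; exact: norm_hausdorff.
apply: (@cdiff_lipschitz _ _ L (B * A / rho * C)).
have : \forall v \near u0, nm v < rho.
  have /cvgnmP /(_ (rho - nm u0)) := @cvg_id _ (nbhs u0); rewrite subr_gt0 => /(_ u_rho).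
  by apply: filterS => v /= hv; have := nmD (v - u0) u0; rewrite subrK; lra.
apply: filterS => v /ltW hv.
have vA : nm v * A < 1.
  by apply: le_lt_trans x1; rewrite -rhoA ler_wpM2r // ltW.
have part n : nm (psum a v n.+1 - psum a u0 n.+1 - psum (fun j => a j.+1 * j.+1%:R) u0 n * (v - u0))
    <= B * A / rho * C * nm (v - u0) ^+ 2.
  have -> : psum a v n.+1 - psum a u0 n.+1 - psum (fun j => a j.+1 * j.+1%:R) u0 n * (v - u0)
     = \sum_(j < n) a j.+1 * (v ^+ j.+1 - u0 ^+ j.+1 - j.+1%:R * u0 ^+ j * (v - u0)).
    rewrite /psum !big_ord_recl !expr0 opprD addrACA subrr add0r mulr_suml -!sumrB.
    by apply: eq_bigr => j _; rewrite !lift0; ring.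
  apply: le_trans (nm_sum _ _ _) _.
  apply: (@le_trans _ _ (\sum_(j < n) (B * A / rho * nm (v - u0) ^+ 2) * (j.+1%:R ^+ 2 * x ^+ j))).
    apply: ler_sum => j _; rewrite nmM.
    apply: le_trans (ler_pM (nm_ge0 _) (nm_ge0 _) (aB _) (pow2 v j hv)) _.
    have xj : x ^+ j = rho ^+ j * A ^+ j by rewrite -rhoA exprMn.
    by rewrite xj [A ^+ j.+1]exprS le_eqVlt; apply/orP; left; apply/eqP; ring.
  rewrite -mulr_sumr; apply: le_trans (ler_wpM2l _ (hC n)) _.
    by rewrite !mulr_ge0 ?exprn_ge0 ?nm_ge0 ?invr_ge0 // ltW.
  by rewrite le_eqVlt; apply/orP; left; apply/eqP; ring.
have lim1 : (fun n => psum a v n.+1 - psum a u0 n.+1 - psum (fun j => a j.+1 * j.+1%:R) u0 n * (v - u0)) @ \oo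
   --> G v - G u0 - L * (v - u0).
  apply: cvgB; first apply: cvgB.
  - by have := aG v vA; rewrite -(cvg_shiftS (psum a v)).
  - by have := aG u0 uA; rewrite -(cvg_shiftS (psum a u0)).
  - by apply: cvgMn => //; exact: cvg_cst.
have lim2 := @cvg_nm _ _ _ _ eventually_filter _ _ lim1.
by apply: cvgr_to_le lim2 _; apply: nearW.
Qed.

Lemma cdiff_ee z : cdiff (@ee R K) z.
Proof.
pose c : K := ofR (2 * pi) * imu; pose C := nm (ee z) * (6 * nm c ^+ 2).
apply: (@cdiff_lipschitz _ _ (ee z * c) C).
have cs : (c * (w - z)) @[w --> z] --> 0.
  by rewrite -[X in _ --> X](mulr0 c); apply: cvgM; [exact: cvg_cst|exact: cvg_sub_self].
have /cvgnmP /(_ (1 / 2)) := cs; have h2 : 0 < 1 / 2 :> R by lra.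
move=> /(_ h2); apply: filterS => w; rewrite subr0 => hw.
have -> : ee w - ee z - ee z * c * (w - z) = ee z * (cx (c * (w - z)) - 1 - c * (w - z)).
  by rewrite -{1}(subrK z w) addrC eeD /ee -/c; ring.
rewrite nmM /C -mulrA ler_wpM2l ?nm_ge0 //; apply: le_trans (cx_quad (ltW hw)) _.
by rewrite nmM exprMn mulrA.
Qed.

Lemma cdiff_ee_lin (a b : K) z : cdiff (fun t => ee (a * t + b)) z.
Proof. by apply: (@cdiff_comp (@ee R K)); [exact: cdiff_ee|exact: cdiff_lin]. Qed.

Lemma cdiff_poch (k l : nat) u0 : (0 < k)%N -> (0 < l)%N -> nm u0 < 1 ->
  cdiff (fun u => poch (u ^+ l) (u ^+ k)) u0.
Proof.
move=> k0 l0 u1; pose A := 2 / (1 + nm u0).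
have n0 := nm_ge0 u0; have p0 : 0 < 1 + nm u0 by lra.
apply: (@analytic_cdiff A _ 1).
- by rewrite divr_gt0.
- by apply: analytic_poch => //; rewrite ltr_pdivlMr //; lra.
- by rewrite mulrA ltr_pdivrMr //; lra.
Qed.

(** For second index 0 both q-products are power series in the single variable e(m t / L), so the
    chain rule in one variable suffices. *)
Lemma gs_holo (L i m : nat) t : (0 < i < L)%N -> (0 < m)%N -> 0 < im t ->
  cdiff (fun t => gs (i%:R / L%:R) 0 (m%:R * t)) t /\ gs (i%:R / L%:R) 0 (m%:R * t) != 0.
Proof.
move=> /andP[i0 iL] m0 t0; have L0 : (0 < L)%N by lia.
have Lk : L%:R != 0 :> K by rewrite pnatr_eq0 -lt0n.
pose c : K := (i%:R / L%:R * (i%:R / L%:R) / 2 + 1 / 12 - i%:R / L%:R / 2) * m%:R.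
pose U t : K := ee (m%:R / L%:R * t + 0).
pose G u : K := poch (u ^+ i) (u ^+ L) * poch (u ^+ (L - i)) (u ^+ L).
have gE s : 0 < im s -> gs (i%:R / L%:R) 0 (m%:R * s) = -1 * ee (c * s + 0) * G (U s).
  move=> s0; rewrite gs_prod ?im_natM_gt0 // mulN1r /G /U -!ee_natM natrB ?(ltnW iL) //.
  congr (- ee _ * (poch (ee _) (ee _) * poch (ee _) (ee _))); rewrite ?addr0 /c; by field.
have near_im : \forall s \near t, 0 < im s.
  have /cvgnmP /(_ (im t) t0) := @cvg_id _ (nbhs t); apply: filterS => s /= hs.
  have := le_lt_trans (im_le_nm (s - t)) hs; rewrite imD imN ltr_norml => /andP[]; lra.
have U1 : nm (U t) < 1.
  apply: nm_ee_lt1; rewrite addr0 mulrC mulrA; have := im_affine m L 0 t.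
  by rewrite addr0 [_ * t]mulrC => ->; rewrite divr_gt0 ?mulr_gt0 ?ltr0n.
have li0 : (0 < L - i)%N by rewrite subn_gt0.
split.
  apply: (@cdiff_eq (fun s => -1 * ee (c * s + 0) * G (U s))).
    by apply: filterS near_im => s /gE ->.
  apply: cdiffM; first by apply: cdiffM; [exact: cdiff_cst|exact: cdiff_ee_lin].
  apply: (@cdiff_comp G U); last exact: cdiff_ee_lin.
  by apply: cdiffM; apply: cdiff_poch.
rewrite gE // mulf_neq0 ?mulf_neq0 ?oppr_eq0 ?oner_neq0 ?ee_neq0 //;
  by rewrite poch_neq0_lt1 // nmX_lt1.
Qed.

Lemma eta_quotient_holo (n k : nat) t : 0 < im t -> cdiff (eta_quotient n k) t.
Proof.
move=> t0; rewrite /eta_quotient; apply: cdiffM.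
  under [X in cdiff X]eq_fun do rewrite -mulN1r -[1 / 4]/(1%:R / 4%:R).
  apply: cdiffM; first exact: cdiff_cst.
  by have [] := @gs_holo 4 1 (32 * (2 * n + 1)) t isT _ t0; first by lia.
have c1 (i : 'I_n) : (0 < i.+1 < 2 * n + 1)%N by have := ltn_ord i; lia.
have c2 : (0 < 4 * (2 * n + 1) ^ 2)%N by lia.
have h (i : 'I_n) := gs_holo (c1 i) c2 t0.
apply: cdiffV.
  by apply/prodf_neq0 => i _; have [] := h i.
by apply: cdiff_prod => i _; have [] := h i.
Qed.

End ComplexDerivative.

(** * The Nahm sum as a Siegel quotient *)

Section AbstractBridge.
Variables (R : realType) (K : cplxField R).

#[local] Instance nbhs_cplx_filter' (z : K) : Filter (nbhs z) := nbhs_filter z.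
#[local] Instance totally_proper (T : choiceType) : ProperFilter (@totally T) := totally_filter.

Lemma lim_poch (a q : K) : nm q < 1 ->
  lim ((fun n => \prod_(0 <= k < n) (1 - a * q ^+ k) : K^o) @ \oo) = poch a q.
Proof.
move=> q1; have h : (fun n => \prod_(0 <= k < n) (1 - a * q ^+ k)) @ \oo --> poch a q.
  by under eq_fun do rewrite big_mkord; exact: cvg_poch.
have e : lim ((fun n => \prod_(0 <= k < n) (1 - a * q ^+ k)) @ \oo) = poch a q.
  by apply: cvg_lim => //; exact: norm_hausdorff.
exact: e.
Qed.

Lemma lim_partial_sum (T : choiceType) (x : T -> K) (S : K) :
  (forall e : R, 0 < e -> exists J0 : {fset T}, forall J : {fset T}, (J0 `<=` J)%fset ->
     nm (\sum_(i <- J) x i - S) < e) ->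
  @summability.sum T K K^o (x : T -> K^o) = S.
Proof.
move=> h; have h1 : (fun J : {fset T} => partial_sum x J) @ totally --> S.
  apply/cvgnmP => e /h [J0 hJ]; exists J0 => // J /= /hJ.
  by rewrite /partial_sum big_seq_fsetE.
have e : lim ((fun J : {fset T} => partial_sum x J) @ totally) = S.
  by apply: cvg_lim => //; exact: norm_hausdorff.
exact: e.
Qed.

Lemma cdiff_derivable (F : K -> K) (z : K) : cdiff F z -> derivable (F : K^o -> K^o) z 1.
Proof.
move=> [phi [h1 h2]].
have h3 : (fun h : K => h + z) @ (0 : K)^' --> z.
  have c0 : (fun h : K => h + z) @ (0 : K) --> 0 + z.
    by apply: cvgD; [exact: cvg_id|exact: cvg_cst].
  rewrite add0r in c0; apply: cvg_trans c0; apply: cvg_app; exact: cvg_within.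
have h4 : (fun h : K => phi (h + z)) @ (0 : K)^' --> phi z by exact: cvg_comp h3 h1.
have h5 : (fun h : K => h^-1 *: ((F : K^o -> K^o) (h *: (1 : K^o) + z) - F z)) @ (0 : K)^' --> (phi z : K^o).
  apply: cvg_trans h4; apply: near_eq_cvg.
  have e1 : \forall h \near (0 : K)^', F (h + z) = F z + phi (h + z) * (h + z - z) by exact: (h3 _ h2).
  have e2 : \forall h \near (0 : K)^', h != 0 by exact: nbhs_dnbhs_neq.
  apply: filterS2 e1 e2 => h e hn0 /=.
  have -> : h *: (1 : K^o) = h by exact: mulr1.
  have -> (x : K) : h^-1 *: (x : K^o) = h^-1 * x by [].
  by rewrite e addrK addrAC subrr add0r mulrC mulfK.
exact: (cvgP _ h5).
Qed.

Lemma poch_split (a q : K) n : nm q < 1 ->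
  poch a q = \prod_(k < n) (1 - a * q ^+ k) * poch (a * q ^+ n) q.
Proof.
move=> q1; elim: n => [|n IH]; first by rewrite big_ord0 mul1r expr0 mulr1.
by rewrite IH (poch_rec (a * q ^+ n) q1) big_ord_recr /= exprSr !mulrA.
Qed.

Lemma poch_qf (q : K) n : nm q < 1 -> poch q q / poch (q * q ^+ n) q = qf q n.
Proof.
move=> q1; rewrite (poch_split q n q1) mulfK.
  by apply: eq_bigr => k _; rewrite exprS.
apply: poch_neq0_lt1 => //; rewrite -exprS; exact: nmX_lt1.
Qed.

End AbstractBridge.

(** * The concrete complex numbers as an instance *)

Section ComplexInstance.
Variable R : realType.

Lemma cplx_imu_sq : ('i%C : R[i]) * 'i%C = -1.
Proof. by apply/eqP; rewrite eq_complex /=; apply/andP; split; apply/eqP; ring. Qed.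

Lemma cplx_reimE (z : R[i]) : z = real_complex R (complex.Re z) + 'i%C * real_complex R (complex.Im z).
Proof. by case: z => a b; apply/eqP; rewrite eq_complex /=; apply/andP; split; apply/eqP; ring. Qed.

Lemma cplx_re_mk (a b : R) : complex.Re (real_complex R a + 'i%C * real_complex R b) = a.
Proof. by rewrite /=; ring. Qed.

Lemma cplx_im_mk (a b : R) : complex.Im (real_complex R a + 'i%C * real_complex R b) = b.
Proof. by rewrite /=; ring. Qed.

Lemma cplx_ofR_gt0 (x : R) : (0 < real_complex R x) = (0 < x).
Proof. by rewrite ltcE /= eqxx. Qed.

Definition cplx : cplxField R := @CplxField R (R[i] : numFieldType) (real_complex R) 'i%C
  (@complex.Re R) (@complex.Im R) cplx_imu_sq cplx_reimE cplx_re_mk cplx_im_mk (@normc_def R) cplx_ofR_gt0.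

Lemma cexp_cx (z : R[i]) : cexp z = cx (z : cplx).
Proof.
rewrite cx.unlock /cexp /=; congr (_ * _); apply/eqP; rewrite eq_complex /=; apply/andP.
by split; apply/eqP; ring.
Qed.

Lemma qpow_ee (tau : R[i]) (x : rat) : qpow tau x = ee (ratr x * tau : cplx).
Proof. rewrite /qpow cexp_cx; apply: (congr1 (@cx R cplx)); exact/esym/mulrA. Qed.

Lemma qpoch_infE (a q : cplx) : nm q < 1 -> qpoch_inf a q = poch a q.
Proof. exact: (@lim_poch R cplx). Qed.

Lemma qpochE (q : cplx) n : nm q < 1 -> qpoch q q n = qf q n.
Proof. by move=> q1; rewrite /qpoch !qpoch_infE //; exact: (@poch_qf R cplx). Qed.

Lemma nahm_sumE (r : nat) (d : 'I_r -> nat) (A : 'M[rat]_r) (b : 'cV[rat]_r) (c : rat) (tau : R[i]) (S : cplx) :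
  (forall e : R, 0 < e -> exists J0 : {fset 'cV[nat]_r}, forall J : {fset 'cV[nat]_r}, (J0 `<=` J)%fset ->
     nm (\sum_(x <- J) nahm_term d A b c tau x - S : cplx) < e) ->
  nahm_sum d A b c tau = S.
Proof. exact: (@lim_partial_sum R cplx). Qed.

End ComplexInstance.

(** * The exponent of the Nahm sum in terms of suffix sums *)

Section QuadraticForm.

Lemma sumn_drop (v : seq nat) k : sumn (drop k v) = (\sum_(i < size v | k <= i) nth 0 v i)%N.
Proof.
elim: v k => [|x v IH] k; first by rewrite big_ord0.
rewrite /= big_mkcond big_ord_recl /=; case: k => [|k] /=.
  congr (_ + _)%N; have := IH 0%N; rewrite drop0 => ->.
  by rewrite big_mkcond; apply: eq_bigr.
by rewrite add0n IH big_mkcond; apply: eq_bigr.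
Qed.

Lemma sum_if_le (L m : nat) (x : rat) :
  \sum_(k < L) (if (k <= m)%N then x else 0) = (minn L m.+1)%:R * x.
Proof.
elim: L => [|L IH]; first by rewrite big_ord0 min0n mul0r.
rewrite big_ord_recr /= IH; case: leqP => Lm.
  by rewrite (minn_idPl _) ?(minn_idPl _) ?ltnS // -?natr1 ?mulrDl ?mul1r //; lia.
by rewrite addr0 (minn_idPr _) // (minn_idPr _) //; lia.
Qed.

(** min(i, j) + 1 counts the k with k <= i and k <= j, which diagonalises the form in the suffix
    sums N_k. *)
Lemma min_form (L : nat) (w : nat -> rat) :
  \sum_(i < L) \sum_(j < L) (minn i j).+1%:R * (w i * w j)
  = \sum_(k < L) (\sum_(i < L | (k <= i)%N) w i) ^+ 2.
Proof.
transitivity (\sum_(i < L) \sum_(j < L) \sum_(k < L)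
   ((if (k <= i)%N then w i else 0) * (if (k <= j)%N then w j else 0))).
  apply: eq_bigr => i _; apply: eq_bigr => j _.
  rewrite -[(minn i j).+1](@minn_idPr L _ _); last by have := ltn_ord i; lia.
  rewrite -sum_if_le; apply: eq_bigr => k _.
  rewrite leq_min; case: (k <= i)%N; case: (k <= j)%N; rewrite ?mulr0 ?mul0r //.
rewrite exchange_big /= [RHS](eq_bigr (fun k : 'I_L => \sum_(j < L) \sum_(i < L)
   ((if (k <= i)%N then w i else 0) * (if (k <= j)%N then w j else 0)))).
  by rewrite [RHS]exchange_big /=; apply: eq_bigr => j _; rewrite exchange_big.
by move=> k _; rewrite big_mkcond expr2 mulr_sumr; apply: eq_bigr => j _; rewrite mulr_suml.
Qed.

Lemma lin_form (L : nat) (w s : nat -> rat) :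
  \sum_(i < L) (\sum_(k < L | (k <= i)%N) s k) * w i
  = \sum_(k < L) s k * \sum_(i < L | (k <= i)%N) w i.
Proof.
under eq_bigr => i _ do rewrite mulr_suml big_mkcond.
rewrite exchange_big /=; apply: eq_bigr => k _.
by rewrite -big_mkcond mulr_sumr.
Qed.

Lemma dual_form (L : nat) (v : nat -> rat) :
  \sum_(i < L.+1) \sum_(j < L.+1) v i * (A_dual_entry L.+2 i.+2 j.+2 * (if j.+2 == L.+2 then 2 else 1)) * v j
  = 2 * \sum_(k < L.+1) (\sum_(i < L.+1 | (k <= i)%N) v i) ^+ 2.
Proof.
rewrite -min_form mulr_sumr; apply: eq_bigr => i _; rewrite mulr_sumr; apply: eq_bigr => j _.
rewrite /A_dual_entry /= !eqSS; have := ltn_ord i; have := ltn_ord j.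
case: ifP => [/eqP jL|jL] hj hi.
  rewrite subn1 /= (_ : minn i j = i); last by lia.
  by ring.
rewrite (_ : (minn i.+2 j.+2 - 1 = (minn i j).+1)%N); last by lia.
by rewrite natrM; ring.
Qed.

Lemma dual_quadratic (L : nat) (n : 'cV[nat]_L.+2) :
  let d := @d_dual L.+2 in
  let D : 'M[rat]_L.+2 := diag_mx (\row_i (d i)%:R) in
  let v : 'cV[rat]_L.+2 := map_mx (fun k : nat => k%:R) n in
  let w (i : nat) : rat := (nth 0%N (vec_seq n) i.+1)%:R in
  let n0 : rat := (nth 0%N (vec_seq n) 0)%:R in
  (v^T *m A_dual L.+2 *m D *m v) 0 0
  = n0 ^+ 2 + 2 * n0 * w L + 2 * \sum_(k < L.+1) (\sum_(i < L.+1 | (k <= i)%N) w i) ^+ 2.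
Proof.
move=> d D v w n0.
pose x i : rat := (nth 0%N (vec_seq n) i)%:R.
have xE (i : 'I_L.+2) : v i 0 = x i by rewrite mxE /x nth_vec_seq.
have -> : (v^T *m A_dual L.+2 *m D *m v) 0 0
    = \sum_(i < L.+2) \sum_(j < L.+2) x i * (A_dual_entry L.+2 i.+1 j.+1 * (if j.+1 == L.+2 then 2 else 1)) * x j.
  rewrite mxE exchange_big /=; apply: eq_bigr => j _.
  rewrite mul_mx_diag !mxE mulr_suml mulr_suml; apply: eq_bigr => i _.
  rewrite !mxE -!nth_vec_seq -/(x i) -/(x j) /d /d_dual mulrA; congr (_ * _).
  by case: ifP.
rewrite big_ord_recl [X in X + _]big_ord_recl /=.
have -> : \sum_(i < L.+1) x (@ord0 L.+1) *
    (A_dual_entry L.+2 1 (lift (@ord0 L.+1) i).+1 * (if (lift (@ord0 L.+1) i).+1 == L.+2 then 2 else 1)) * x (lift (@ord0 L.+1) i) = n0 * w L.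
  rewrite big_ord_recr big1 ?add0r; last first.
    move=> i _; rewrite !lift0 /A_dual_entry /= !eqSS (_ : (i == L :> nat) = false); last by have := ltn_ord i; lia.
    by rewrite mul0r mulr0 mul0r.
  by rewrite !lift0 /A_dual_entry /= eqxx /x /w /n0; field.
have -> : \sum_(i < L.+1) \sum_(j < L.+2) x (lift (@ord0 L.+1) i) *
    (A_dual_entry L.+2 (lift (@ord0 L.+1) i).+1 j.+1 * (if j.+1 == L.+2 then 2 else 1)) * x j
   = n0 * w L + \sum_(i < L.+1) \sum_(j < L.+1) w i * (A_dual_entry L.+2 i.+2 j.+2 * (if j.+2 == L.+2 then 2 else 1)) * w j.
  under eq_bigr do rewrite big_ord_recl.
  rewrite big_split; congr (_ + _).
    rewrite big_ord_recr big1 ?add0r; last first.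
      move=> i _; rewrite !lift0 /A_dual_entry /= !eqSS (_ : (i == L :> nat) = false); last by have := ltn_ord i; lia.
      by rewrite mul0r mulr0 mul0r.
    by rewrite !lift0 /A_dual_entry /= eqxx /x /w /n0; ring.
rewrite dual_form /A_dual_entry /= -/n0 /x -/n0; ring.
Qed.

(** E is twice the exponent without c, hence the power of p = q^(1/2). The linear form enters the
    chain through the increments [sl] of its entries, since summation by parts turns it into the sum
    of s_k N_k. *)
Lemma dual_exponent (sl : seq nat) (dl L : nat) (c : rat) (n : 'cV[nat]_L.+2) (bv : 'cV[rat]_L.+2) :
  bv ord0 0 = dl%:R ->
  (forall i : 'I_L.+1, bv (lift ord0 i) 0 = \sum_(k < L.+1 | (k <= i)%N) (nth 0%N sl k)%:R) ->
  let v := vec_seq n in let N k := sumn (drop k (behead v)) in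
  let E := (nth 0 v 0 * nth 0 v 0 + 2 * nth 0 v 0 * (nth 0 v L.+1 + dl)
     + 2 * \sum_(k < L.+1) N k * (N k + nth 0 sl k))%N in
  nahm_exponent (@d_dual L.+2) (A_dual L.+2) bv c n = 2^-1 * E%:R + c.
Proof.
move=> b0 bS v N E; rewrite /nahm_exponent dual_quadratic -/v.
congr (_ + _).
pose w (i : nat) : rat := (nth 0%N v i.+1)%:R; pose n0 : rat := (nth 0%N v 0)%:R.
have NE k : (N k)%:R = \sum_(i < L.+1 | (k <= i)%N) w i.
  rewrite /N sumn_drop natr_sum size_behead size_vec_seq /=.
  by apply: eq_bigr => i _; rewrite /w nth_behead.
have -> : ((map_mx (fun k : nat => k%:R) n : 'cV[rat]_L.+2)^T *m bv) 0 0
  = n0 * dl%:R + \sum_(k < L.+1) (nth 0%N sl k)%:R * (N k)%:R.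
  rewrite mxE big_ord_recl !mxE b0 -nth_vec_seq -/v; congr (_ + _).
  under [RHS]eq_bigr do rewrite NE.
  rewrite -(lin_form L.+1 w (fun k => (nth 0%N sl k)%:R)); apply: eq_bigr => i _.
  by rewrite !mxE bS -nth_vec_seq lift0 -/v -/(w i) mulrC.
have -> : \sum_(k < L.+1) (\sum_(i < L.+1 | (k <= i)%N) (nth 0%N v i.+1)%:R) ^+ 2 = \sum_(k < L.+1) (N k)%:R ^+ 2 :> rat.
  by apply: eq_bigr => k _; rewrite NE.
have -> : E%:R = n0 ^+ 2 + 2 * n0 * (w L + dl%:R) + 2 * \sum_(k < L.+1) ((N k)%:R ^+ 2 + (nth 0%N sl k)%:R * (N k)%:R) :> rat.
  have S1 : \sum_(k < L.+1) ((N k)%:R ^+ 2 + (nth 0%N sl k)%:R * (N k)%:R)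
    = (\sum_(k < L.+1) N k * (N k + nth 0 sl k))%N%:R :> rat.
    by rewrite natr_sum; apply: eq_bigr => k _; rewrite natrM natrD; ring.
  by rewrite S1 /E /n0 /w; move: (\sum_(k < L.+1) _)%N (nth _ _ _) (nth _ _ _) => x y z; ring.
rewrite big_split /= -/n0 -/(w L).
by field.
Qed.

Lemma chain_weightE (F : numFieldType) (p : F) s ss (be : nat -> F) v : size v = (size ss).+1 ->
  chain_weight p s ss be v
  = (p ^+ 2) ^+ (\sum_(k < (size ss).+1) sumn (drop k v) * (sumn (drop k v) + nth 0 (s :: ss) k))%N
    * \prod_(k < size ss) iq (p ^+ 2) (nth 0%N v k) * be (nth 0%N v (size ss)).
Proof.
elim: ss s v => [|s' ss IH] s v.
  case: v => [|n [|]] // _.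
  by rewrite /chain_weight /chain_step big_ord1 big_ord0 mulr1 drop0.
case: v => // n v [sv].
have e1 : (\sum_(k < (size (s' :: ss)).+1) sumn (drop k (n :: v)) * (sumn (drop k (n :: v)) + nth 0 [:: s, s' & ss] k)
   = sumn (n :: v) * (sumn (n :: v) + s) + \sum_(k < (size ss).+1) sumn (drop k v) * (sumn (drop k v) + nth 0 (s' :: ss) k))%N.
  by rewrite big_ord_recl drop0.
have e2 : \prod_(k < size (s' :: ss)) iq (p ^+ 2) (nth 0%N (n :: v) k)
   = iq (p ^+ 2) n * \prod_(k < size ss) iq (p ^+ 2) (nth 0%N v k).
  by rewrite big_ord_recl.
by rewrite e1 e2 exprD [LHS]/= (IH s' v) // /chain_step [nth _ (n :: v) _]/=; ring.
Qed.

End QuadraticForm.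

Section AbstractTerm.
Variables (R : realType) (K : cplxField R).

Lemma ee_sqr_half (tau : K) (d : nat) : ee (d%:R * tau) = ee (tau / 2) ^+ 2 ^+ d.
Proof. by rewrite -!ee_natM; congr ee; field. Qed.

Lemma ee_half_split (tau c : K) (e : nat) : ee ((2^-1 * e%:R + c) * tau) = ee (c * tau) * ee (tau / 2) ^+ e.
Proof. by rewrite -ee_natM -eeD; congr ee; field. Qed.

Lemma qf_sqr (p : K) n : qf (p ^+ 2 ^+ 2) n = qf2 p n.
Proof. by apply: eq_bigr => k _; rewrite -[in LHS]exprM. Qed.

Definition exponent (dl : nat) (sl v : seq nat) (L : nat) : nat :=
  (nth 0 v 0 * nth 0 v 0 + 2 * nth 0 v 0 * (nth 0 v L.+1 + dl)
   + 2 * \sum_(k < L.+1) sumn (drop k (behead v)) * (sumn (drop k (behead v)) + nth 0 sl k))%N.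

Lemma nahm_limE (p : K) dl s ss v : size v = (size ss).+2 ->
  nahm_lim p dl s ss v = p ^+ exponent dl (s :: ss) v (size ss) /
   (qf (p ^+ 2) (nth 0%N v 0) * \prod_(k < size ss) qf (p ^+ 2) (nth 0%N v k.+1) *
    qf (p ^+ 2 ^+ 2) (nth 0%N v (size ss).+1)).
Proof.
case: v => // n0 w [sw]; rewrite /nahm_lim /exponent [behead _]/= [head _ _]/= chain_weightE //.
have -> : \prod_(k < size ss) iq (p ^+ 2) (nth 0%N w k) = (\prod_(k < size ss) qf (p ^+ 2) (nth 0%N (n0 :: w) k.+1))^-1.
  by rewrite -prodfV.
rewrite /nahm_beta_lim iq_pos qf_sqr -exprM [nth _ (n0 :: w) 0]/= [nth _ (n0 :: w) _.+1]/=.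
by rewrite [in RHS]exprD !invfM; ring.
Qed.

End AbstractTerm.

Section NahmTerm.
Variable R : realType.

Notation K := (cplx R).

Lemma dual_prod (L : nat) (f : nat -> nat -> K) (x : 'cV[nat]_L.+2) :
  \prod_(i < L.+2) f (@d_dual L.+2 i) (x i 0)
  = f 1%N (nth 0%N (vec_seq x) 0) * \prod_(k < L) f 1%N (nth 0%N (vec_seq x) k.+1) * f 2%N (nth 0%N (vec_seq x) L.+1).
Proof.
rewrite big_ord_recl big_ord_recr /= mulrA; congr (_ * _ * _).
- by rewrite -nth_vec_seq.
- apply: eq_bigr => i _; rewrite -nth_vec_seq /d_dual !lift0 /= !eqSS.
  by rewrite (_ : (i == L :> nat) = false) //; have := ltn_ord i; lia.
- by rewrite -nth_vec_seq /d_dual !lift0 /= eqxx.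
Qed.

Lemma nahm_termE (s : nat) (ss : seq nat) (dl : nat) (bv : 'cV[rat]_(size ss).+2) (c : rat) (tau p : K)
  (x : 'cV[nat]_(size ss).+2) :
  0 < im tau -> p = ee (tau / 2) -> bv ord0 0 = dl%:R ->
  (forall i : 'I_(size ss).+1, bv (lift ord0 i) 0 = \sum_(k < (size ss).+1 | (k <= i)%N) (nth 0%N (s :: ss) k)%:R) ->
  nahm_term (@d_dual (size ss).+2) (A_dual (size ss).+2) bv c tau x
  = ee (ratr c * tau) * nahm_lim p dl s ss (vec_seq x).
Proof.
move=> t0 pE b0 bS.
have half0 : 0 < im (tau / 2 : K).
  by have := @im_affine R K 1 2 0 tau; rewrite !mul1r addr0 => ->; rewrite divr_gt0.
have p1 : nm p < 1 by rewrite pE nm_ee_lt1.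
have qE (d : nat) : qpow tau d%:R = (p ^+ 2) ^+ d.
  by rewrite qpow_ee ratr_nat pE; exact: (@ee_sqr_half R K).
have qpE (d n : nat) : (0 < d)%N -> qpoch (qpow tau d%:R) (qpow tau d%:R) n = qf ((p ^+ 2) ^+ d) n.
  by move=> d0; rewrite qE qpochE //; apply: nmX_lt1 => //; exact: nmX_lt1.
rewrite /nahm_term (dual_exponent c x b0 bS).
rewrite (eq_bigr (fun i => qf ((p ^+ 2) ^+ (d_dual i)) (x i 0))); last first.
  by move=> i _; apply: qpE; rewrite /d_dual; case: ifP.
rewrite (@dual_prod (size ss) (fun d n => qf ((p ^+ 2) ^+ d) n)) expr1.
rewrite nahm_limE ?size_vec_seq // mulrA; congr (_ / _).
rewrite -/(exponent dl (s :: ss) (vec_seq x) (size ss)).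
rewrite qpow_ee rmorphD rmorphM fmorphV /= !ratr_nat pE; exact: (@ee_half_split R K).
Qed.

End NahmTerm.

Section NahmEta.
Variable R : realType.

Lemma scale_unordered (K : cplxField R) (T : choiceType) (a S : K) (g f : T -> K) : a != 0 ->
  (forall x, f x = a * g x) ->
  (forall e : R, 0 < e -> exists J0 : {fset T}, forall J : {fset T}, (J0 `<=` J)%fset ->
     nm (\sum_(x <- J) g x - S) < e) ->
  forall e : R, 0 < e -> exists J0 : {fset T}, forall J : {fset T}, (J0 `<=` J)%fset ->
     nm (\sum_(x <- J) f x - a * S) < e.
Proof.
move=> a0 fE h e e0; have na : 0 < nm a by rewrite nm_gt0.
have [J0 hJ] := h (e / nm a) (divr_gt0 e0 na); exists J0 => J /hJ.
under [X in _ -> nm (X - _) < _]eq_bigr do rewrite fE.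
by rewrite -mulr_sumr -mulrBr nmM ltr_pdivlMr // mulrC.
Qed.

Lemma sum_bits (L m i : nat) :
  (\sum_(k < L | (k <= i)%N) (m <= k)%N = minn L i.+1 - m)%N.
Proof.
rewrite big_mkcond; elim: L => [|L IH]; first by rewrite big_ord0 min0n.
by rewrite big_ord_recr /= IH; case: (leqP L i) => h; case: (leqP m L) => h'; lia.
Qed.

Notation K := (cplx R).

(** Here 32 r - 8 = 8 M, so that q^(1/2) at the scaled argument is p = e(4 M t). The hypothesis on c
    identifies q^c with the prefactor in [theta_eta]. *)
Lemma nahm_eta_aux (s : nat) (ss : seq nat) (dl : nat) (bv : 'cV[rat]_(size ss).+2) (c : rat)
  (n k l r : nat) (t : K) :
  r = (size ss).+2 -> n = (2 * r - 1)%N -> (0 < k <= n)%N -> l = k \/ l = (2 * n + 1 - k)%N ->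
  0 < im t -> bv ord0 0 = dl%:R ->
  (forall i : 'I_(size ss).+1, bv (lift ord0 i) 0 = \sum_(k < (size ss).+1 | (k <= i)%N) (nth 0%N (s :: ss) k)%:R) ->
  c * (32 * r - 8)%N%:R = (2 * n + 1)%N%:R * n%:R - 2 * l%:R * ((2 * n + 1)%N%:R - l%:R) ->
  (forall p : K, p != 0 -> nm p < 1 -> forall e : R, 0 < e -> exists J0 : {fset 'cV[nat]_((size ss).+2)},
    forall J : {fset 'cV[nat]_((size ss).+2)}, (J0 `<=` J)%fset ->
    nm (\sum_(x <- J) nahm_lim p dl s ss (vec_seq x)
        - poch (- p) (p ^+ 2) / poch (p ^+ 2) (p ^+ 2) * theta_prod p (2 * n + 1) l) < e) ->
  nahm_sum (@d_dual (size ss).+2) (A_dual (size ss).+2) bv c ((32 * r - 8)%N%:R * t) = eta_quotient n k t.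
Proof.
move=> rE nE /andP[k0 kn] hl t0 b0 bS hc hS.
set tau := _%:R * t; pose p : K := ee (tau / 2).
have tau0 : 0 < im (tau : K) by apply: (@im_natM_gt0 R K) => //; lia.
have half0 : 0 < im (tau / 2 : K).
  by have := @im_affine R K 1 2 0 tau; rewrite !mul1r addr0 => ->; rewrite divr_gt0.
have p1 : nm p < 1 by rewrite nm_ee_lt1.
have p0 : p != 0 by exact: ee_neq0.
have pE : p = ee ((4 * (2 * n + 1))%N%:R * t).
  rewrite /p /tau; congr ee.
  have -> : (32 * r - 8 = 4 * (2 * n + 1) * 2)%N by lia.
  rewrite natrM mulrAC mulfK //; by rewrite pnatr_eq0.
have on : odd n by rewrite nE rE; lia.
rewrite -(theta_eta on k0 kn hl t0 pE).
have cE : ratr c * tau = ((2 * n + 1)%N%:R * n%:R - 2 * l%:R * ((2 * n + 1)%N%:R - l%:R)) * t.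
  have h (x y z : rat) : ratr (x * y - 2 * z * (x - z)) = ratr x * ratr y - 2 * ratr z * (ratr x - ratr z) :> K.
    by rewrite rmorphB !rmorphM rmorphB /= ratr_nat.
  rewrite /tau mulrA; congr (_ * _).
  have -> : ratr c * (32 * r - 8)%N%:R = ratr (c * (32 * r - 8)%N%:R) :> K by rewrite rmorphM /= ratr_nat.
  by rewrite hc h !ratr_nat.
rewrite -cE; apply: nahm_sumE.
apply: (@scale_unordered K _ (ee (ratr c * tau : K)) _ (fun x => nahm_lim p dl s ss (vec_seq x))).
- exact: ee_neq0.
- by move=> x; apply: nahm_termE.
- exact: hS.
Qed.

Lemma level_rat (L : nat) :
  [/\ (32 * L.+2 - 8)%N%:R = 32 * L.+2%:R - 8 :> rat, 32 * L.+2%:R - 8 != 0 :> rat &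
     (2 * L.+2 - 1)%N%:R = 2 * L.+2%:R - 1 :> rat].
Proof.
have L0 : (32 * L.+2 - 8 != 0)%N by lia.
have L1 : (8 <= 32 * L.+2)%N by lia.
have cK : (32 * L.+2 - 8)%N%:R = 32 * L.+2%:R - 8 :> rat by rewrite natrB ?natrM.
split; [exact: cK|by rewrite -cK pnatr_eq0|by rewrite natrB ?natrM].
Qed.

Lemma nahm_eta (r j : nat) : (2 <= r)%N -> (j <= r)%N -> exists2 k : nat, (0 < k <= 2 * r - 1)%N &
  forall t : K, 0 < im t ->
    nahm_sum (@d_dual r) (A_dual r) (b_vec r j) (c_val r j) ((32 * r - 8)%N%:R * t) = eta_quotient (2 * r - 1) k t.
Proof.
case: r => [|[|L]] // _ jr.
case: j jr => [_|j jr].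
  (* For b_0 the theta series has l = 4 r - 2 = M - 1, which pairs with the residue 1. *)
  exists 1%N; first by lia.
  move=> t t0; have [ss [ssL ssE nthE]] : exists ss, [/\ size ss = L, ss = nseq (size ss) 1%N &
      forall k, (k < L.+1)%N -> nth 0%N (1%N :: ss) k = 1%N].
    exists (nseq L 1%N); split; [exact: size_nseq|by rewrite size_nseq|move=> k kL].
    by rewrite -[_ :: _]/(nseq L.+1 1%N) nth_nseq kL.
  subst L; apply: (@nahm_eta_aux 1 ss 1 _ _ _ 1 (4 * size ss + 6) _ _ erefl erefl).
  - by lia.
  - by right; lia.
  - exact: t0.
  - by rewrite !mxE.
  - move=> i; rewrite !mxE lift0 /=.
    rewrite (eq_bigr (fun k : 'I_(size ss).+1 => (0 <= k)%N%:R)); last by move=> k _; rewrite nthE.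
    by rewrite -natr_sum sum_bits; congr (_%:R); have := ltn_ord i; lia.
  - have [cK c0 nK] := level_rat (size ss).
    by rewrite /c_val /= cK divfK // !natrD !natrM nK; clear; lra.
  - move=> p p0 p1; have -> : (2 * (2 * (size ss).+2 - 1) + 1 = 4 * size ss + 7)%N by lia.
    exact: nahm_sum0.
have [s [ss [sE ssL]]] : exists s ss, s :: ss = nseq j 0%N ++ nseq (L.+1 - j) 1%N /\ size ss = L.
  have : size (nseq j 0%N ++ nseq (L.+1 - j) 1%N) = L.+1 by rewrite size_cat !size_nseq; lia.
  case: (_ ++ _) => [|s ss] //= [hs]; exists s, ss; split; [reflexivity|exact: hs].
have nthE k : (k < L.+1)%N -> nth 0%N (s :: ss) k = (j <= k)%N.
  move=> kL; rewrite sE nth_cat !nth_nseq size_nseq; case: (ltnP k j) => kj //.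
  by rewrite (_ : (k - j < L.+1 - j)%N) //; lia.
subst L; have jsz : (j <= (size ss).+1)%N by [].
(* The index j has been lowered by one, and l = M - 2 (j + 1). The representative of l or M - l that
   is at most n = 2 r - 1 is M - l, except for the last j, where l = n itself. *)
pose k := if (j == (size ss).+1) then (2 * (size ss).+2 - 1)%N else (2 * j.+1)%N.
exists k; first by rewrite /k; case: eqP; lia.
move=> t t0; apply: (@nahm_eta_aux s ss 0 _ _ _ k (4 * ((size ss).+1 - j) + 2 * j + 1) _ _ erefl erefl).
- by rewrite /k; case: eqP; lia.
- by rewrite /k; case: eqP => h; [left|right]; lia.
- exact: t0.
- by rewrite !mxE.
- move=> i; rewrite !mxE lift0 /=.
  rewrite (eq_bigr (fun k : 'I_(size ss).+1 => (j <= k)%N%:R)); last by move=> k' _; rewrite nthE.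
  by rewrite -natr_sum sum_bits; congr (_%:R); have := ltn_ord i; lia.
- have e1 : ((size ss).+1 - j)%N%:R = (size ss)%:R + 1 - j%:R :> rat by rewrite natrB // -natr1.
  have [cK c0 nK] := level_rat (size ss).
  rewrite /c_val /= cK divfK // !natrD !natrM nK e1.
  by rewrite -[(size ss).+2%:R]natr1 -[(size ss).+1%:R]natr1 -[j.+1%:R]natr1; clear; lra.
- move=> p p0 p1.
  have -> : (2 * (2 * (size ss).+2 - 1) + 1 = 4 * ((size ss).+1 - j + j) + 3)%N by lia.
  exact: nahm_sum1.
Qed.

End NahmEta.

(** * Fractional linear maps and cusp widths *)

Section Mobius.
Variables (R : realType) (K : cplxField R).
Implicit Types (t : K) (a b c d : int).

Lemma re_intr (m : int) : re (m%:~R : K) = m%:~R.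
Proof. by rewrite -(rmorph_int (ofR : {rmorphism R -> K})) re_ofR. Qed.

Lemma im_intr (m : int) : im (m%:~R : K) = 0.
Proof. by rewrite -(rmorph_int (ofR : {rmorphism R -> K})) im_ofR. Qed.

Lemma mobius_den_neq0 a b c d t : a * d - b * c = 1 -> 0 < im t -> c%:~R * t + d%:~R != 0.
Proof.
move=> h t0; apply/negP => /eqP e.
have := congr1 im e; rewrite imD imM re_intr !im_intr mul0r !addr0 im0 => /eqP.
rewrite mulf_eq0 (gt_eqF t0) orbF intr_eq0 => /eqP c0.
move: e; rewrite c0 mul0r add0r => /eqP; rewrite intr_eq0 => /eqP d0.
by move: h; rewrite c0 d0 !mulr0 subrr.
Qed.

Lemma im_mobius_gt0 a b c d t : a * d - b * c = 1 -> 0 < im t ->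
  0 < im ((a%:~R * t + b%:~R) / (c%:~R * t + d%:~R)).
Proof.
move=> h t0; have y0 := mobius_den_neq0 h t0.
set y := c%:~R * t + d%:~R in y0 *; set z := _ / y.
have xE : z * y = a%:~R * t + b%:~R by rewrite divfK.
have yr : re y = c%:~R * re t + d%:~R by rewrite reD reM !re_intr !im_intr mul0r subr0.
have yi : im y = c%:~R * im t by rewrite imD imM re_intr !im_intr mul0r !addr0.
have hR : a%:~R * d%:~R - b%:~R * c%:~R = 1 :> R by rewrite -!rmorphM -rmorphB h.
clearbody z y.
have : im z * nm y ^+ 2 = im t.
  rewrite nm_sqr; have h1 := congr1 re xE; have h2 := congr1 im xE.
  move: h1 h2; rewrite reM imM !reD !imD !reM !imM !re_intr !im_intr !mul0r !subr0 !addr0 => h1 h2.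
  transitivity ((re z * im y + im z * re y) * re y - (re z * re y - im z * im y) * im y); first by ring.
  rewrite h1 h2 yr yi; transitivity ((a%:~R * d%:~R - b%:~R * c%:~R) * im t); first by ring.
  by rewrite hR mul1r.
have n0 : 0 < nm y ^+ 2 by rewrite exprn_gt0 // nm_gt0.
by move=> e; rewrite -(pmulr_lgt0 _ n0) e.
Qed.

Lemma mobius_comp a b c d a' b' c' d' t : a' * d' - b' * c' = 1 -> 0 < im t ->
  let z := (a'%:~R * t + b'%:~R) / (c'%:~R * t + d'%:~R) in
  ((a * a' + b * c')%:~R * t + (a * b' + b * d')%:~R) / ((c * a' + d * c')%:~R * t + (c * b' + d * d')%:~R)
  = (a%:~R * z + b%:~R) / (c%:~R * z + d%:~R).
Proof.
move=> h t0 z; have y0 := mobius_den_neq0 h t0.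
set y := c'%:~R * t + d'%:~R in y0 *; set x := a'%:~R * t + b'%:~R.
have e (m n : int) : (m * a' + n * c')%:~R * t + (m * b' + n * d')%:~R = (m%:~R * z + n%:~R) * y.
  rewrite mulrDl -mulrA /z -/x -/y divfK // !rmorphD !rmorphM /x /y /=; ring.
by rewrite !e invfM mulrACA mulfV // mulr1.
Qed.

Lemma holo_near (F G : K -> K) (z : K) : 0 < im z -> (forall t, 0 < im t -> F t = G t) ->
  (forall t, 0 < im t -> cdiff G t) -> \forall w \near (z : K^o), derivable (F : K^o -> K^o) w 1.
Proof.
move=> z0 FG dG.
have near_im (t : K) : 0 < im t -> \forall s \near t, 0 < im s.
  move=> t0; have /cvgnmP /(_ (im t) t0) := @cvg_id _ (nbhs t); apply: filterS => s /= hs.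
  have := le_lt_trans (im_le_nm (s - t)) hs; rewrite imD imN ltr_norml => /andP[]; lra.
have : \forall w \near z, derivable (F : K^o -> K^o) w 1.
  apply: filterS (near_im z z0) => w w0; apply: cdiff_derivable.
  apply: cdiff_eq (dG w w0); apply: filterS (near_im w w0) => s s0.
  by rewrite FG.
by [].
Qed.

End Mobius.

Section Matrices22.

Lemma mulmx22E (A B : 'M[int]_2) i j : (A *m B) i j = A i 0 * B 0 j + A i 1 * B 1 j.
Proof.
rewrite mxE big_ord_recl big_ord_recl big_ord0 addr0.
by congr (A i _ * B _ j + A i _ * B _ j); apply/val_inj.
Qed.

Lemma det22E (A : 'M[int]_2) : \det A = A 0 0 * A 1 1 - A 0 1 * A 1 0.
Proof.
have e1 : lift (0 : 'I_2) (0 : 'I_1) = 1 by apply/val_inj.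
have e0 : lift (1 : 'I_2) (0 : 'I_1) = 0 by apply/val_inj.
rewrite (expand_det_row A 0) !big_ord_recl big_ord0 addr0 -[ord0]/(0 : 'I_2) -[ord0]/(0 : 'I_1) e1.
by rewrite /cofactor !det_mx11 !mxE e1 e0 /= expr0 mul1r expr1 mulN1r mulrN.
Qed.

Lemma det22 (A : 'M[int]_2) : \det A = 1 -> A 0 0 * A 1 1 - A 0 1 * A 1 0 = 1.
Proof. by move=> <-; rewrite det22E. Qed.

Lemma translationE (h : nat) : [/\ translation h 0 0 = 1, translation h 0 1 = h%:Z,
  translation h 1 0 = 0 & translation h 1 1 = 1].
Proof. by split; rewrite !mxE /= ?mulr0 ?mulr1 ?addr0 ?add0r. Qed.

(** Any conjugate of the translation by N is the identity modulo N; hence a positive h exists and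
    the least one is the width. *)
Lemma cusp_translation_level (N : nat) (g : 'M[int]_2) : \det g = 1 -> cusp_translation N g N.
Proof.
move=> dg; have ug : g \in unitmx by rewrite unitmxE dg unitr1.
exists (g *m translation N *m invmx g); last first.
  by rewrite !mulmxA mulVmx // mul1mx -mulmxA mulVmx // mulmx1.
have e : g *m translation N *m invmx g = 1%:M + N%:Z *: (g *m delta_mx 0 1 *m invmx g).
  by rewrite /translation mulmxDr mulmx1 mulmxDl mulmxV // -scalemxAr -scalemxAl.
split.
- rewrite !det_mulmx det_inv dg invr1 mulr1 mul1r.
  by have [t1 t2 t3 t4] := translationE N; rewrite det22E t1 t2 t3 t4 mulr0 subr0 mulr1.
- by rewrite e !mxE /= add0r dvdz_mulr.
- by rewrite e !mxE /= addrC; apply/eqP; rewrite mulrC modzMDl.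
- by rewrite e !mxE /= addrC; apply/eqP; rewrite mulrC modzMDl.
Qed.

Lemma cusp_width_exists (N : nat) (g : 'M[int]_2) : (0 < N)%N -> \det g = 1 -> exists w, is_cusp_width N g w.
Proof.
move=> N0 dg; pose P h := (0 < h)%N && `[< cusp_translation N g h >].
have exP : exists h, P h.
  by exists N; rewrite /P N0; apply/asboolP; exact: cusp_translation_level.
have [w /andP[w0 /asboolP hw] wmin] := ex_minnP exP.
exists w; split=> // h h0 hh; apply: wmin; rewrite /P h0; exact/asboolP.
Qed.

End Matrices22.

Theorem theorem1p3 (R : realType) (r : nat) (hr : (2 <= r)%N)
    (j : nat) (hj : (j <= r)%N) :
  modular_function (128 * (4 * r - 1) ^ 2)%N
    (fun tau : R[i] =>
       nahm_sum (@d_dual r) (A_dual r) (b_vec r j) (c_val r j)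
         ((32 * r - 8)%N%:R * tau)).
Proof.
have [k kn etaE] := @nahm_eta R r j hr hj.
set f := fun tau : R[i] => _; pose n := (2 * r - 1)%N.
have on : odd n by rewrite /n; lia.
have ME : (4 * r - 1 = 2 * n + 1)%N by rewrite /n; lia.
rewrite ME; set N := (128 * _)%N.
have N0 : (0 < N)%N by rewrite /N; lia.
pose K := cplx R; have fE (t : K) : 0 < im t -> f t = eta_quotient n k t by exact: etaE.
have inv (g : 'M[int]_2) (t : K) : Gamma1 N g -> 0 < im t ->
    eta_quotient n k (mobius g t : K) = eta_quotient n k t.
  move=> [dg /dvdzP[c1 cE] aN dN] t0.
  apply: (@eta_quotient_inv R K n k (g 0 0) (g 0 1) (g 1 0) (g 1 1) c1 t on kn t0).
  - exact: det22.
  - by rewrite cE mulrC.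
  - by rewrite -eqz_mod_dvd; apply/eqP.
  - by rewrite -eqz_mod_dvd; apply/eqP.
have im_mob (g : 'M[int]_2) (t : K) : \det g = 1 -> 0 < im t -> 0 < im (mobius g t : K).
  by move=> dg; apply: (@im_mobius_gt0 R K); exact: det22.
split.
(* The Siegel functions in the denominator have no zeros on the half-plane, so the function has no
   poles there. *)
- move=> z z0; left; apply: (@holo_near R K f (eta_quotient n k) z z0 fE) => t t0.
  exact: eta_quotient_holo.
- move=> g hg t t0; have dg : \det g = 1 by case: hg.
  by rewrite !fE //; [exact: inv|exact: im_mob].
move=> g dg; have [w hw] := cusp_width_exists N0 dg; exists w => //.
have [w0 [gam hgam wE] _] := hw.
(* The product of the two denominators in [laurent_eta]; averaging over translates brings the
   expansion back to the width w. *)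
pose e := ((12 * 4 ^ 2 * (32 * (2 * n + 1))) * (12 * (2 * n + 1) ^ 2 * (4 * (2 * n + 1) ^ 2)))%N.
have e0 : (0 < e)%N by rewrite /e; lia.
pose F (t : K) : K := eta_quotient n k (mobius g t : K).
have lF : laurent (w * e) F.
  apply: (@laurent_eta R K n k (g 0 0) (g 0 1) (g 1 0) (g 1 1) (w * e)).
  - exact: det22.
  - by rewrite muln_gt0 w0.
  - by apply: dvdn_mull; exact: dvdn_mulr.
  - by apply: dvdn_mull; exact: dvdn_mull.
have gT : g *m translation w = gam *m g.
  by rewrite wE !mulmxA mulmxV ?mul1mx // unitmxE dg unitr1.
have per (t : K) : 0 < im t -> F (t + w%:R) = F t.
  move=> t0; rewrite /F -(inv gam (mobius g t : K) hgam (im_mob g t dg t0)); congr (eta_quotient n k _).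
  have -> : mobius gam (mobius g t) = mobius (gam *m g) t.
    by rewrite /mobius !mulmx22E; apply/esym; apply: (@mobius_comp R K) => //; exact: det22.
  rewrite -gT /mobius !mulmx22E; have [-> -> -> ->] := translationE w.
  by rewrite !mulr1 !mulr0 !addr0; congr (_ / _); rewrite rmorphD rmorphM /=; ring.
have [q [a [Y hY]]] := @laurent_expansion R K w e F w0 e0 lF per.
(* Only z >= q occurs in the expansion, where the absolute value is z - q itself. *)
exists q, (fun z : int => a `|z - q|%N), Y => t t0 tY.
have := hY t t0 tY; rewrite -[F t]fE; last exact: im_mob.
apply: cvg_trans; apply: near_eq_cvg; apply: nearW => M.
rewrite /series /= big_mkord; apply: eq_bigr => i _.
have -> : `|(q + i%:Z - q)%R|%N = i by rewrite addrC addKr absz_nat.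
by rewrite qpow_ee fmorph_div /= ratr_int ratr_nat.
Qed.
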